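(* Let $E$ be a symmetric quasi-Banach function space on $\mathbb{R}_+$ which is $s$-convex for some $0<s<\infty$. Let $\mathcal{M},\mathcal{N}$ be von Neumann algebras equipped with normal, semi-finite, faithful traces $\tau$ and $\sigma$, respectively. Suppose that $0<p<q\leq\infty$ and let $T:L^{p,1}(\mathcal{M})_+ + L^{q,1}(\mathcal{M})_+\to S(\sigma)_+$ be a midpoint convex map such that for constants $C_p,C_q>0$, $$\|Tx\|_{L^{r,\infty}(\mathcal{N})}\leq C_r\|x\|_{L^{r,1}(\mathcal{M})}\qquad(x\in L^{r,1}(\mathcal{M})_+,\ r=p,q).$$ If $p<p_E\leq q_E<q<\infty$, or $p<p_E$ and $q=\infty$, then there is a constant $c_{p,q}$ depending only on $p$ and $q$ such that $$\|Tx\|_{E(\mathcal{N})}\leq c_{p,q}\max\{C_p,C_q\}\,\|S_{p,q}\|_{E\to E}\,\|x\|_{E(\mathcal{M})}\qquad(x\in E(\mathcal{M})_+).$$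
   Context: Calderón's operator: for $0<p<q<\infty$, $S_{p,q}f(t)=t^{-1/p}\int_0^ts^{1/p}f(s)\frac{ds}{s}+t^{-1/q}\int_t^\infty s^{1/q}f(s)\frac{ds}{s}$, and $S_{p,\infty}f(t)=t^{-1/p}\int_0^ts^{1/p}f(s)\frac{ds}{s}$ ($t>0$). $\|S_{p,q}\|_{E\to E}$ is its operator norm on $E$, which is finite under the stated index conditions (known). For measurable a.e. finite $f$ on $\mathbb{R}_+$, $d(v;f)=\lambda(|f|>v)$ ($\lambda$ Lebesgue measure); $S(\mathbb{R}_+)$ denotes those $f$ with $d(v;f)<\infty$ for some $v>0$; $\mu_t(f)=\inf\{v>0:d(v;f)\le t\}$. A (nonzero) symmetric quasi-Banach function space $E$ on $\mathbb{R}_+$ is a complete quasi-normed linear subspace of $S(\mathbb{R}_+)$ such that $f\in S(\mathbb{R}_+)$, $g\in E$, $\mu(f)\le\mu(g)$ imply $f\in E$, $\|f\|_E\le\|g\|_E$. $E$ is $s$-convex if for some $C$, $\|(\sum_i|f_i|^s)^{1/s}\|_E\le C(\sum_i\|f_i\|_E^s)^{1/s}$ for all finite sequences in $E$. With $(D_af)(u)=f(au)$ on $E$, $p_E=\lim_{u\to\infty}\frac{\log u}{\log\|D_{1/u}\|}$, $q_E=\lim_{u\downarrow0}\frac{\log u}{\log\|D_{1/u}\|}$ ($=\infty$ if the denominator vanishes). $S(\tau)$ is the $*$-algebra of $\tau$-measurable operators affiliated with $\mathcal{M}$, $S(\tau)_+$ its positive cone, $\mu_t(x)=\inf\{v>0:\tau(e^{|x|}(v,\infty))\le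 t\}$, $E(\mathcal{M})=\{x\in S(\tau):\mu(x)\in E\}$, $\|x\|_{E(\mathcal{M})}=\|\mu(x)\|_E$, $E(\mathcal{M})_+=E(\mathcal{M})\cap S(\tau)_+$; similarly for $(\mathcal{N},\sigma)$. For $r<\infty$: $\|x\|_{L^{r,1}}=\int_0^\infty t^{1/r-1}\mu_t(x)\,dt$, $\|x\|_{L^{r,\infty}}=\sup_{t>0}t^{1/r}\mu_t(x)$. For $r=\infty$: $L^{\infty,1}(\mathcal{M})$ is understood as $L^\infty(\mathcal{M})=\mathcal{M}$, and $L^{\infty,\infty}(\mathcal{N})=\mathcal{N}$. A map $T:D\to S(\sigma)_+$ on a convex set $D\subset S(\tau)$ is midpoint convex if $T(\frac12x+\frac12y)\le\frac12T(x)+\frac12T(y)$ for all $x,y\in D$. *)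

(* Defs.v *)
From HB Require Import structures.
From mathcomp Require Import all_boot all_order all_algebra.
From mathcomp Require Import complex.
From mathcomp Require Import all_classical all_reals all_analysis.

Set Implicit Arguments.
Unset Strict Implicit.
Unset Printing Implicit Defensive.

Import Order.TTheory GRing.Theory Num.Theory.
Import numFieldNormedType.Exports.
Local Open Scope classical_set_scope.
Local Open Scope ring_scope.
Local Open Scope complex_scope.

(** * Symmetric quasi-Banach function spaces on R_+ = (0, +oo) *)

(* Functions on R_+ are represented by functions R -> R; only their values on
   (0, +oo), up to null sets, matter. *)

Section function_spaces.
Variable R : realType.
Implicit Types (f g : R -> R) (E : set (R -> R)) (nrm : (R -> R) -> R).

Notation lambda := (@lebesgue_measure R).

Definition Rpos : set R := [set t | 0 < t].

Definition fdistr (f : R -> R) (v : R) : \bar R :=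
  lambda (Rpos `&` [set t | v < `|f t|]).

Definition S_Rplus (f : R -> R) : Prop :=
  measurable_fun Rpos f /\ exists2 v : R, 0 < v & (fdistr f v < +oo)%E.

Definition fmu (f : R -> R) (t : R) : R :=
  inf [set v : R | 0 < v /\ (fdistr f v <= t%:E)%E].

(* A function space is a set E of functions together with a quasi-norm nrm,
   whose values outside E are irrelevant. *)
Record symmetric_quasi_Banach (E : set (R -> R)) (nrm : (R -> R) -> R) : Prop := {
  sqb_sub : E `<=` S_Rplus ;
  sqb_linear : forall (a : R) f g, E f -> E g -> E (fun t => a * f t + g t) ;
  sqb_nonzero : exists2 f, E f & ~ {ae lambda, forall t : R, 0 < t -> f t = 0} ;
  sqb_ge0 : forall f, E f -> 0 <= nrm f ;
  sqb_eq0 : forall f, E f ->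
    (nrm f = 0 <-> {ae lambda, forall t : R, 0 < t -> f t = 0}) ;
  sqb_homo : forall (a : R) f, E f -> nrm (fun t => a * f t) = `|a| * nrm f ;
  sqb_quasi_triangle : exists K : R, forall f g, E f -> E g ->
    nrm (fun t => f t + g t) <= K * (nrm f + nrm g) ;
  sqb_complete : forall u : nat -> R -> R, (forall n, E (u n)) ->
    (forall e : R, 0 < e -> exists n0 : nat, forall m n : nat,
       (n0 <= m)%N -> (n0 <= n)%N -> nrm (fun t => u m t - u n t) < e) ->
    exists2 f, E f & (fun n => nrm (fun t => u n t - f t)) @ \oo --> 0 ;
  sqb_symmetric : forall f g, S_Rplus f -> E g ->
    (forall t : R, 0 < t -> fmu f t <= fmu g t) -> E f /\ nrm f <= nrm g
}.

Definition s_convex (E : set (R -> R)) (nrm : (R -> R) -> R) (s : R) : Prop :=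
  exists C : R, forall (n : nat) (f : 'I_n -> R -> R), (forall i, E (f i)) ->
    nrm (fun t => (\sum_(i < n) `|f i t| `^ s) `^ s^-1) <=
    C * (\sum_(i < n) nrm (f i) `^ s) `^ s^-1.

(* The operator norm on E, equal to +oo when A does not map E boundedly into
   itself. *)
Definition opnorm (E : set (R -> R)) (nrm : (R -> R) -> R)
    (A : (R -> R) -> R -> R) : \bar R :=
  ereal_inf [set C%:E | C in
    [set C : R | 0 <= C /\ forall f, E f -> E (A f) /\ nrm (A f) <= C * nrm f]].

Definition dilation (a : R) (f : R -> R) : R -> R := fun u => f (a * u).

Definition boyd_quotient (E : set (R -> R)) (nrm : (R -> R) -> R) (u : R)
    : \bar R :=
  let l := (ln (fine (opnorm E nrm (dilation u^-1))) : R) in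
  if l == 0 then +oo%E else (ln u / l)%:E.

Definition boyd_p (E : set (R -> R)) (nrm : (R -> R) -> R) : \bar R :=
  lim (boyd_quotient E nrm u @[u --> +oo%R]).

Definition boyd_q (E : set (R -> R)) (nrm : (R -> R) -> R) : \bar R :=
  lim (boyd_quotient E nrm u @[u --> 0^'+]).

(* The real-valued integral of the library is 0 when the integral diverges.
   This does not affect opnorm E nrm (calderon p q): if one of these integrals
   diverges for some f in E, truncating |f| in size and in support yields
   elements of E of norm at most nrm f whose images have arbitrarily large
   quasi-norm, so the operator norm is +oo. *)
Definition calderon (p : R) (q : \bar R) (f : R -> R) : R -> R := fun t =>
  t `^ (- p^-1) * (\int[lambda]_(s in `]0%R, t[) (s `^ p^-1 * f s / s))%R +
  (if q is q'%:E then
     t `^ (- q'^-1) *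
       (\int[lambda]_(s in `]t, +oo[) (s `^ q'^-1 * f s / s))%R
   else 0).

End function_spaces.

(** * Hilbert spaces and unbounded operators *)

(* The inner product is linear in its first argument. *)
Record hilbertSpace (R : realType) := HilbertSpace {
  hcarrier :> completeNormedModType R[i] ;
  hdot : {dot hcarrier for Num.conj} ;
  hdot_norm : forall a : hcarrier, `|a| ^+ 2 = hdot a a
}.

Notation "⟨ a , b ⟩" := (hdot _ a b) (at level 0, a at level 99, b at level 99)
  : ring_scope.

Section operators.
Variables (R : realType) (H : hilbertSpace R).

Definition bounded_op (f : H -> H) : Prop := linear f /\ continuous f.

Definition adjoint_pair (f g : H -> H) : Prop :=
  forall a b : H, ⟨f a, b⟩ = ⟨a, g b⟩.

Definition pos_bounded (f : H -> H) : Prop :=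
  bounded_op f /\ forall a : H, 0 <= ⟨f a, a⟩.

Definition projection (f : H -> H) : Prop :=
  [/\ bounded_op f, f \o f = f & adjoint_pair f f].

(* Unbounded operators are identified with their graphs. *)
Definition graph_of (f : H -> H) : set (H * H) := [set z | z.2 = f z.1].

Definition op_dom (x : set (H * H)) : set H := fst @` x.

Definition closed_densely_defined (x : set (H * H)) : Prop :=
  [/\ (forall (a : R[i]) (u v : H * H), x u -> x v -> x (a *: u + v)),
      (forall a b c : H, x (a, b) -> x (a, c) -> b = c),
      closed x & dense (op_dom x)].

Definition op_adj (x : set (H * H)) : set (H * H) :=
  [set z | forall w, x w -> ⟨w.2, z.1⟩ = ⟨w.1, z.2⟩].

Definition positive_op (x : set (H * H)) : Prop :=
  [/\ closed_densely_defined x, op_adj x = x &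
      forall w, x w -> 0 <= ⟨w.2, w.1⟩].

(* |x| is the positive self-adjoint operator such that |x|^2 = x^* x; in
   relation_scope, B \; A composes graphs with A applied first. *)
Definition op_abs (x : set (H * H)) : set (H * H) :=
  get [set h | positive_op h /\ (h \; h)%relation = (op_adj x \; x)%relation].

(* P is the projection-valued spectral measure of the self-adjoint operator h:
   h = \int l dP(l), with domain the vectors a such that l |-> l^2 is integrable
   for the measure <P(.)a, a>. *)
Definition is_spectral_measure (h : set (H * H)) (P : set R -> H -> H) : Prop :=
  [/\ (forall B : set (measurableTypeR R), measurable B -> projection (P B)),
      P setT = id &
      forall a : H, exists m : {measure set (measurableTypeR R) -> \bar R},
        [/\ (forall B, measurable B -> m B = (complex.Re ⟨P B a, a⟩)%:E),
            (op_dom h a <-> (\int[m]_l (l ^+ 2)%:E < +oo)%E) &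
            forall b : H, h (a, b) -> ⟨b, a⟩ = ((\int[m]_l l)%R : R)%:C]].

Definition spectral_measure (h : set (H * H)) : set R -> H -> H :=
  get (is_spectral_measure h).

Definition op_add (x y : set (H * H)) : set (H * H) :=
  [set z | exists b c, [/\ x (z.1, b), y (z.1, c) & z.2 = b + c]].

(* The sum in the *-algebra S(tau) is the closure of the algebraic sum. *)
Definition strong_add (x y : set (H * H)) : set (H * H) :=
  closure (op_add x y).

Definition op_scale (a : R[i]) (x : set (H * H)) : set (H * H) :=
  [set z | exists2 b, x (z.1, b) & z.2 = a *: b].

Definition op_le (x y : set (H * H)) : Prop :=
  positive_op (strong_add y (op_scale (- 1) x)).

Definition midpoint (x y : set (H * H)) : set (H * H) :=
  strong_add (op_scale (2^-1) x) (op_scale (2^-1) y).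

Definition op_norm (x : set (H * H)) : \bar R :=
  ereal_inf [set C%:E | C in
    [set C : R | 0 <= C /\ forall z, x z -> `|z.2| <= C%:C * `|z.1|]].

(** * von Neumann algebras and traces *)

Definition commutant (M : set (H -> H)) : set (H -> H) :=
  [set f | bounded_op f /\ forall g, M g -> f \o g = g \o f].

(* A *-closed subset of B(H) equal to its bicommutant is automatically a unital
   *-subalgebra. *)
Definition von_Neumann_algebra (M : set (H -> H)) : Prop :=
  [/\ M `<=` bounded_op,
      (forall f, M f -> exists2 g, M g & adjoint_pair f g) &
      commutant (commutant M) = M].

Definition vN_pos (M : set (H -> H)) : set (H -> H) := M `&` pos_bounded.

Definition bounded_le (f g : H -> H) : Prop := pos_bounded (g \- f).

Definition is_sup_in (M D : set (H -> H)) (f : H -> H) : Prop :=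
  [/\ vN_pos M f, (forall g, D g -> bounded_le g f) &
      forall h, vN_pos M h -> (forall g, D g -> bounded_le g h) ->
        bounded_le f h].

(* Only the values of tau on the positive cone of M matter. *)
Record normal_semifinite_faithful_trace (M : set (H -> H))
    (tau : (H -> H) -> \bar R) : Prop := {
  tr_ge0 : forall f, vN_pos M f -> (0 <= tau f)%E ;
  tr_add : forall f g, vN_pos M f -> vN_pos M g ->
    tau (f \+ g) = (tau f + tau g)%E ;
  tr_homo : forall (a : R) f, 0 <= a -> vN_pos M f ->
    tau (a%:C \*: f) = (a%:E * tau f)%E ;
  tr_trace : forall f g, M f -> M g -> adjoint_pair f g ->
    tau (g \o f) = tau (f \o g) ;
  tr_normal : forall (D : set (H -> H)) f,
    D !=set0 -> D `<=` vN_pos M ->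
    (forall g h, D g -> D h ->
       exists k, [/\ D k, bounded_le g k & bounded_le h k]) ->
    is_sup_in M D f -> tau f = ereal_sup (tau @` D) ;
  tr_semifinite : forall f, vN_pos M f -> f <> (fun=> 0) ->
    exists g, [/\ vN_pos M g, g <> (fun=> 0), bounded_le g f &
                  (tau g < +oo)%E] ;
  tr_faithful : forall f, vN_pos M f -> tau f = 0%E -> f = (fun=> 0)
}.

(** * tau-measurable operators and noncommutative function spaces *)

Variables (M : set (H -> H)) (tau : (H -> H) -> \bar R).

Definition affiliated (x : set (H * H)) : Prop :=
  closed_densely_defined x /\
  forall f, commutant M f -> forall a b : H, x (a, b) -> x (f a, f b).

Definition S_tau : set (set (H * H)) :=
  [set x | affiliated x /\
    forall e : R, 0 < e -> exists P : H -> H,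
      [/\ M P, projection P, range P `<=` op_dom x &
          (tau (id \- P)%R <= e%:E)%E]].

Definition S_tau_pos : set (set (H * H)) := S_tau `&` positive_op.

Definition op_distr (x : set (H * H)) (v : R) : \bar R :=
  tau (spectral_measure (op_abs x) `]v, +oo[).

Definition op_mu (x : set (H * H)) (t : R) : R :=
  inf [set v : R | 0 < v /\ (op_distr x v <= t%:E)%E].

Definition ncspace (E : set (R -> R)) : set (set (H * H)) :=
  [set x | S_tau x /\ E (op_mu x)].

Definition ncnorm (nrm : (R -> R) -> R) (x : set (H * H)) : R := nrm (op_mu x).

(* The exponent of the Lorentz spaces ranges over (0, +oo]. *)
Definition lorentz1_norm (r : \bar R) (x : set (H * H)) : \bar R :=
  if r is r'%:E then
    (\int[@lebesgue_measure R]_(t in `]0%R, +oo[)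
       (t `^ (r'^-1 - 1) * op_mu x t)%:E)%E
  else op_norm x.

Definition lorentz1 (r : \bar R) : set (set (H * H)) :=
  if r is r'%:E then [set x | S_tau x /\ (lorentz1_norm r x < +oo)%E]
  else graph_of @` M.

Definition weak_norm (r : \bar R) (x : set (H * H)) : \bar R :=
  if r is r'%:E then
    ereal_sup [set (t `^ r'^-1 * op_mu x t)%:E | t in `]0%R, +oo[]
  else op_norm x.

Definition lorentz1_pos (r : \bar R) : set (set (H * H)) :=
  lorentz1 r `&` S_tau_pos.

Definition sum_cone (p q : \bar R) : set (set (H * H)) :=
  [set z | exists x y,
    [/\ lorentz1_pos p x, lorentz1_pos q y & z = strong_add x y]].

End operators.

(* Main.v *)
Require Import Defs.
From HB Require Import structures.
From mathcomp Require Import all_boot all_order all_algebra.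
From mathcomp Require Import complex.
From mathcomp Require Import all_classical all_reals all_analysis.
From mathcomp Require Import measurable_realfun.
From mathcomp Require Import ring lra.
Import Order.TTheory GRing.Theory Num.Theory.
Import numFieldNormedType.Exports.
Local Open Scope classical_set_scope.
Local Open Scope ring_scope.

(* Fix t > 0 and a level v slightly above mu_t(x), and cut x spectrally at v:
   x is the midpoint of y1 = 2 x e(v, oo) and y2 = 2 x e[0, v]. Convexity of T
   and mu_{s+t}(a + b) <= mu_s(a) + mu_t(b) bound mu_t(T x) by half of
   mu_{t/2}(T y1) + mu_{t/2}(T y2). Since mu(y1) vanishes beyond t and mu(y2) is
   at most 2 v, the weak type hypotheses bound these two terms by the two Hardy
   integrals of mu(x) forming S_{p,q}(mu(x))(t), up to constants and a term
   mu_t(x), itself controlled by the first integral. Hence mu(T x) <= c max(C_p, C_q)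
   S_{p,q}(mu(x)) pointwise, and the norm estimate follows.

   The spectral theory needed for the cuts rests on the closed subspaces of the
   vectors a with |x^k a| = O(v^k), which are the spectral subspaces of [0, v]:
   no functional calculus is used. The Boyd index conditions serve to make the
   integrals of mu(x) finite: discretised along a geometric progression, they are
   dominated by a series of dilations of mu(x) converging in E. *)

(** * Hilbert spaces and orthogonal projections *)

(** [op_distr] passes through [op_abs] and [spectral_measure], both selected by [get]: nothing is
    known of them before their defining properties are shown to be satisfiable and, on half-lines,
    to determine the projection. This forces an existence and uniqueness proof, carried out for
    positive operators only. Afterwards [op_distr x v] is the trace of [1 - spE x v], and bounds on
    singular values become statements about vectors: if the form of [x] is at most [v] on the range
    of a projection [e] of [M], this range meets that of [1 - spE x v] only in 0, so the latter
    projection has trace at most [tau (1 - e)]. That comparison usually rests on polar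
    decomposition; [tau_compare] uses only square roots, the trace property and normality.

    On the function side the obstacle is that [fine] sends an infinite dilation norm to 0: Boyd
    quotients carry no information until dilations are proved bounded, from symmetry and the
    quasi-triangle inequality alone. There is no Fatou property either, so domination by the sum of
    a series is extracted from completeness. *)

Section hilbert_basics.
Set Implicit Arguments.
Unset Strict Implicit.
Variables (R : realType) (H : hilbertSpace R).
Implicit Types (a b c : H) (r s : R).

(** Working with the real part keeps every estimate in the ordered field [R]; [hdotE] recovers the
    complex product from it. *)
Definition rdot a b : R := complex.Re ⟨a, b⟩.
Definition n2 a : R := rdot a a.

Lemma hdotC a b : ⟨a, b⟩ = (⟨b, a⟩)^*.
Proof. by have := hermC (hdot H) a b; rewrite expr0 mul1r. Qed.

Lemma rdotC a b : rdot a b = rdot b a.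
Proof. by rewrite /rdot hdotC; case: (hdot H b a). Qed.

Lemma rdotDl a b c : rdot (a + b) c = rdot a c + rdot b c.
Proof. by rewrite /rdot linearDl raddfD. Qed.

Lemma rdotNl a c : rdot (- a) c = - rdot a c.
Proof. by rewrite /rdot linearNl raddfN. Qed.

Lemma rdotBl a b c : rdot (a - b) c = rdot a c - rdot b c.
Proof. by rewrite rdotDl rdotNl. Qed.

Lemma rdotDr a b c : rdot c (a + b) = rdot c a + rdot c b.
Proof. by rewrite rdotC rdotDl !(rdotC c). Qed.

Lemma rdotNr a c : rdot c (- a) = - rdot c a.
Proof. by rewrite rdotC rdotNl (rdotC c). Qed.

Lemma rdotBr a b c : rdot c (a - b) = rdot c a - rdot c b.
Proof. by rewrite rdotDr rdotNr. Qed.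

Lemma rdotZl r a b : rdot (r%:C%C *: a) b = r * rdot a b.
Proof.
rewrite /rdot linearZl_LR /=; case: (hdot H a b) => x y /=.
by rewrite mul0r subr0.
Qed.

Lemma rdotZr r a b : rdot b (r%:C%C *: a) = r * rdot b a.
Proof. by rewrite rdotC rdotZl rdotC. Qed.

Lemma rdot_i a b : rdot ('i%C *: a) b = - rdot a ('i%C *: b).
Proof.
rewrite (rdotC a) /rdot !linearZl_LR /= (hdotC a b).
by case: (hdot H b a) => x y /=; rewrite !mul0r !mul1r; ring.
Qed.

Lemma hdotE a b : ⟨a, b⟩ = (rdot a b +i* rdot a ('i%C *: b))%C.
Proof.
rewrite -[rdot a ('i%C *: b)]opprK -rdot_i /rdot linearZl_LR /=.
by case: (hdot H a b) => x y /=; rewrite !mul0r !mul1r sub0r opprK.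
Qed.

Lemma rdot0l a : rdot 0 a = 0.
Proof. by rewrite /rdot linear0l. Qed.
Lemma rdot0r a : rdot a 0 = 0.
Proof. by rewrite rdotC rdot0l. Qed.

Lemma norm2E a : `|a| ^+ 2 = (n2 a)%:C%C.
Proof.
rewrite hdot_norm /n2 /rdot; have : 0 <= ⟨a, a⟩ by rewrite -hdot_norm exprn_ge0.
by case: (hdot H a a) => x y /= /andP[/eqP /= -> _].
Qed.

Lemma n2_ge0 a : 0 <= n2 a.
Proof. by have : 0 <= `|a| ^+ 2 by []; rewrite norm2E lecR. Qed.

Lemma n2_eq0 a : n2 a = 0 -> a = 0.
Proof.
move=> h; apply/eqP; rewrite -normr_eq0 -sqrf_eq0 norm2E h; exact/eqP.
Qed.

Lemma normE a : `|a| = (Num.sqrt (n2 a))%:C%C.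
Proof.
apply/eqP; rewrite -(eqrXn2 (n := 2)) //; last by rewrite lecR sqrtr_ge0.
by rewrite norm2E -rmorphXn /= sqr_sqrtr ?n2_ge0.
Qed.

Lemma n2D a b : n2 (a + b) = n2 a + 2 * rdot a b + n2 b.
Proof. by rewrite /n2 !(rdotDl, rdotDr) (rdotC b a); ring. Qed.
Lemma n2N a : n2 (- a) = n2 a.
Proof. by rewrite /n2 rdotNl rdotNr opprK. Qed.
Lemma n2B a b : n2 (a - b) = n2 a - 2 * rdot a b + n2 b.
Proof. by rewrite n2D rdotNr n2N; ring. Qed.
Lemma n2Z r a : n2 (r%:C%C *: a) = r ^+ 2 * n2 a.
Proof. by rewrite /n2 rdotZl rdotZr mulrA. Qed.
Lemma n20 : n2 0 = 0. Proof. exact: rdot0l. Qed.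
Lemma n2_i a : n2 ('i%C *: a) = n2 a.
Proof.
by rewrite /n2 rdot_i scalerA -expr2 sqr_i scaleN1r rdotNr opprK.
Qed.
Lemma n2BC a b : n2 (a - b) = n2 (b - a).
Proof. by rewrite -n2N opprB. Qed.

Lemma n2Zc (k : R[i]) a : n2 (k *: a) = (complex.Re k ^+ 2 + complex.Im k ^+ 2) * n2 a.
Proof.
have -> : k *: a = (complex.Re k)%:C%C *: a + 'i%C *: ((complex.Im k)%:C%C *: a).
  rewrite scalerA -scalerDl; congr (_ *: _); case: (k) => x y.
  by apply/eqP; rewrite eq_complex /=; apply/andP; split; apply/eqP; ring.
rewrite n2D n2_i !n2Z rdotZl -(rdotC ('i%C *: _)) rdot_i.
have -> : rdot ((complex.Im k)%:C%C *: a) ('i%C *: a) = 0.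
  by rewrite rdotZl; have := rdot_i a a; rewrite rdotC => ?; nra.
by rewrite oppr0 mulr0 mulr0 addr0 mulrDl.
Qed.

Lemma n2D_le a b : n2 (a + b) <= 2 * n2 a + 2 * n2 b.
Proof. by have := n2_ge0 (a - b); rewrite n2B n2D; lra. Qed.

(** The minimum, at [r = - y / z], is nonnegative. If [z = 0] the polynomial is affine, and for
    nonzero [y] the chosen [r] gives it the value [-1]. Used with [x = 0], the conclusion forces
    [y = 0]. *)
Lemma disc_le (x y z : R) : 0 <= x -> 0 <= z ->
  (forall r, 0 <= x + 2 * r * y + r ^+ 2 * z) -> y ^+ 2 <= x * z.
Proof.
move=> x0 z0 h; have [z00|zn] := eqVneq z 0.
  have [->|yn] := eqVneq y 0; first by rewrite expr0n /= mulr_ge0.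
  have := h (- (x + 1) / (2 * y)); rewrite z00 mulr0 addr0.
  have -> : 2 * (- (x + 1) / (2 * y)) * y = - (x + 1) by field.
  by lra.
have zp : 0 < z by rewrite lt_neqAle eq_sym zn.
have := h (- y / z).
have -> : x + 2 * (- y / z) * y + (- y / z) ^+ 2 * z = (x * z - y ^+ 2) / z.
  by field.
by rewrite pmulr_lge0 ?invr_gt0 // subr_ge0.
Qed.

Lemma CS a b : rdot a b ^+ 2 <= n2 a * n2 b.
Proof.
apply: disc_le; rewrite ?n2_ge0 // => r.
have := n2_ge0 (a + r%:C%C *: b); rewrite n2D n2Z rdotZr; lra.
Qed.

(** Convergence in squared norm with real tolerances: the norm of [H] takes its values in [R[i]]. *)
Definition hlim (u : nat -> H) a :=
  forall e : R, 0 < e -> exists N, forall n, (N <= n)%N -> n2 (u n - a) < e.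

Definition hcauchy (u : nat -> H) :=
  forall e : R, 0 < e ->
    exists N, forall m n, (N <= m)%N -> (N <= n)%N -> n2 (u m - u n) < e.

Lemma norm_lt (e : R) a : 0 < e -> (`|a| < e%:C%C) = (n2 a < e ^+ 2).
Proof.
move=> e0; rewrite normE ltcR -[X in _ < X]ger0_norm ?(ltW e0) //.
rewrite -sqrtr_sqr ltr_sqrt ?exprn_gt0 //.
Qed.

Lemma ball_n2 a b (e : R) : 0 < e -> ball a e%:C%C b <-> n2 (b - a) < e ^+ 2.
Proof. by move=> e0; rewrite -ball_normE /= norm_lt // n2BC. Qed.

Lemma hcomplete u : hcauchy u -> exists a, hlim u a.
Proof.
move=> hu.
have /cauchy_cvg /cvg_ex[a ua] : cauchy (u @ \oo).
  apply/cauchy_ballP => e e0.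
  have [r r0 re] : exists2 r : R, 0 < r & r%:C%C = e.
    exists (complex.Re e); move: e0; rewrite ltcE => /andP[/eqP i0 r0] //.
    by case: e i0 r0 => x y /= -> .
  have [N hN] := hu (r ^+ 2) ltac:(by rewrite exprn_gt0).
  exists (u @` [set n | (N <= n)%N], u @` [set n | (N <= n)%N]) => /=.
    by split; exists N => // n /= hn; exists n.
  move=> [_ _] /= [[m hm <-] [n hn <-]] /=.
  by rewrite -re; apply/ball_n2 => //; apply: hN.
exists a => e e0.
have se : 0 < Num.sqrt e by rewrite sqrtr_gt0.
have /cvg_ballP /(_ (Num.sqrt e)%:C%C) := ua.
rewrite ltcR => /(_ se) [N _ hN]; exists N => n hn.
by have /ball_n2 -/(_ se) := hN n hn; rewrite sqr_sqrtr // ltW.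
Qed.


Lemma posC (e : R[i]) : 0 < e -> exists2 r : R, 0 < r & r%:C%C = e.
Proof.
move=> e0; exists (complex.Re e); move: e0; rewrite ltcE => /andP[/eqP i0 r0] //.
by case: e i0 r0 => x y /= -> .
Qed.

Lemma closure2P (S : set (H * H)) a b : closure S (a, b) <->
  forall e : R, 0 < e -> exists a' b', [/\ S (a', b'), n2 (a' - a) < e & n2 (b' - b) < e].
Proof.
split=> [hS e e0|h B /nbhs_ballP[e e0 heB]].
  have se : 0 < Num.sqrt e by rewrite sqrtr_gt0.
  have [|[a' b'] [Sab [/= hb1 hb2]]] := hS (ball (a, b) (Num.sqrt e)%:C%C).
    by apply: nbhsx_ballx; rewrite ltcR.
  exists a', b'; split=> //.
    by move/ball_n2 : hb1 => /(_ se); rewrite sqr_sqrtr // ltW.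
  by move/ball_n2 : hb2 => /(_ se); rewrite sqr_sqrtr // ltW.
have [r r0 re] := posC e0.
have [|a' [b' [Sab ha hb]]] := h (r ^+ 2); first exact: exprn_gt0.
exists (a', b'); split=> //; apply: heB; rewrite -re.
by split; apply/ball_n2.
Qed.

Lemma denseP (S : set H) : dense S <->
  forall a (e : R), 0 < e -> exists2 b, S b & n2 (b - a) < e.
Proof.
split=> [dS a e e0|h O [a Oa] oO].
  have se : 0 < Num.sqrt e by rewrite sqrtr_gt0.
  have [||b [hb Sb]] := dS (ball a (Num.sqrt e)%:C%C).
  - by exists a; apply: ballxx; rewrite ltcR.
  - by apply: ball_open; rewrite ltcR.
  by exists b => //; move/ball_n2 : hb => /(_ se); rewrite sqr_sqrtr // ltW.
have /nbhs_ballP[e e0 heB] := open_nbhs_nbhs (conj oO Oa).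
have [r r0 re] := posC e0.
have [|b Sb hb] := h a (r ^+ 2); first exact: exprn_gt0.
by exists b; split=> //; apply: heB; rewrite -re; apply/ball_n2.
Qed.

Section linear_functions.
Variables (f : H -> H) (lf : linear f).

Lemma lin0 : f 0 = 0.
Proof. by have := lf (-1) 0 0; rewrite scaleN1r oppr0 addr0 scaleN1r addNr. Qed.
Lemma linZ k a : f (k *: a) = k *: f a.
Proof. by have := lf k a 0; rewrite !addr0 lin0 addr0. Qed.
Lemma linD a b : f (a + b) = f a + f b.
Proof. by have := lf 1 a b; rewrite !scale1r. Qed.
Lemma linN a : f (- a) = - f a.
Proof. by rewrite -scaleN1r linZ scaleN1r. Qed.
Lemma linB a b : f (a - b) = f a - f b.
Proof. by rewrite linD linN. Qed.

End linear_functions.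

(** Continuity at 0 gives a ball of radius [r] mapped into the unit ball; rescaling a vector to norm
    [r / 2] puts it in that ball, whence the constant [(r / 2) ^- 2]. *)
Lemma bounded_opP (f : H -> H) : bounded_op f <->
  linear f /\ exists2 C : R, 0 <= C & forall a, n2 (f a) <= C * n2 a.
Proof.
split=> [[lf cf]|[lf [C C0 hC]]]; split=> //.
  have f0 := lin0 lf.
  have /nbhs_ballP[e e0 he] : nbhs (0 : H) (f @^-1` (ball (f 0) 1)).
    by apply: (cf 0); apply: nbhsx_ballx.
  have [r r0 re] := posC e0.
  exists ((r / 2) ^- 2); first by rewrite invr_ge0 exprn_ge0 // divr_ge0 // ltW.
  move=> a; rewrite mulrC.
  have [a0|an] := eqVneq (n2 a) 0.
    by rewrite (n2_eq0 a0) f0 n20 mul0r.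
  have ap : 0 < n2 a by rewrite lt_neqAle eq_sym an n2_ge0.
  set s := Num.sqrt (n2 a).
  have s0 : 0 < s by rewrite sqrtr_gt0.
  have sE : n2 a = s ^+ 2 by rewrite sqr_sqrtr // ltW.
  have : ball (0 : H) e ((r / 2 / s)%:C%C *: a).
    rewrite -re; apply/ball_n2 => //; rewrite subr0 n2Z sE.
    have -> : (r / 2 / s) ^+ 2 * s ^+ 2 = (r / 2) ^+ 2 by field; rewrite gt_eqF.
    by rewrite ltr_pXn2r ?nnegrE //; lra.
  move/he => /=; rewrite f0 => /(@ball_n2 _ _ 1) -/(_ ltr01).
  rewrite subr0 (linZ lf) n2Z expr1n sE => h.
  rewrite ler_pdivlMr; last by rewrite exprn_gt0 // divr_gt0.
  have -> : n2 (f a) * (r / 2) ^+ 2 = (r / 2 / s) ^+ 2 * n2 (f a) * s ^+ 2.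
    by field; rewrite gt_eqF.
  by rewrite -[leRHS]mul1r ler_pM2r ?exprn_gt0 // ltW.
move=> a B /nbhs_ballP[e e0 heB]; have [r r0 re] := posC e0.
have C1 : 0 < C + 1 by rewrite ltr_wpDl.
apply/nbhs_ballP; exists (Num.sqrt (r ^+ 2 / (C + 1)))%:C%C.
  by rewrite /= ltcR sqrtr_gt0 divr_gt0 // exprn_gt0.
move=> b /ball_n2; rewrite sqrtr_gt0 divr_gt0 ?exprn_gt0 // => /(_ isT).
rewrite sqr_sqrtr ?divr_ge0 ?exprn_ge0 ?ltW // => hb.
apply: heB; rewrite -re; apply/ball_n2 => //.
rewrite -(linB lf).
apply: (le_lt_trans (hC _)).
rewrite ltr_pdivlMr // in hb.
have := n2_ge0 (b - a); nra.
Qed.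

Lemma hlim_unique u a b : hlim u a -> hlim u b -> a = b.
Proof.
move=> ha hb; apply/eqP; rewrite -subr_eq0; apply/eqP/n2_eq0.
apply/eqP; rewrite eq_le n2_ge0 andbT; apply/ler_addgt0Pr => e e0; rewrite add0r.
have [|N hN] := ha (e / 4); first by rewrite divr_gt0.
have [|N' hN'] := hb (e / 4); first by rewrite divr_gt0.
have := hN (maxn N N') (leq_maxl _ _); have := hN' (maxn N N') (leq_maxr _ _).
set v := u _ => h1 h2.
have -> : a - b = (v - b) - (v - a) by rewrite opprB [RHS]addrC subrKA.
by have := n2D_le (v - b) (- (v - a)); rewrite n2N; lra.
Qed.

Lemma hlim_cst a : hlim (fun=> a) a.
Proof. by move=> e e0; exists 0%N => n _; rewrite subrr n20. Qed.

Lemma hlimD u v a b : hlim u a -> hlim v b -> hlim (fun n => u n + v n) (a + b).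
Proof.
move=> ha hb e e0.
have [|N hN] := ha (e / 4); first by rewrite divr_gt0.
have [|N' hN'] := hb (e / 4); first by rewrite divr_gt0.
exists (maxn N N') => n; rewrite geq_max => /andP[/hN h1 /hN' h2].
have -> : u n + v n - (a + b) = (u n - a) + (v n - b) by rewrite opprD addrACA.
by have := n2D_le (u n - a) (v n - b); lra.
Qed.

Lemma hlim_op f u a : bounded_op f -> hlim u a -> hlim (fun n => f (u n)) (f a).
Proof.
move=> /bounded_opP[lf [C C0 hC]] ha e e0.
have C1 : 0 < C + 1 by rewrite ltr_wpDl.
have [|N hN] := ha (e / (C + 1)); first by rewrite divr_gt0.
exists N => n /hN h.
rewrite -(linB lf).
apply: (le_lt_trans (hC _)); rewrite ltr_pdivlMr // in h.
have := n2_ge0 (u n - a); nra.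
Qed.

Lemma hlim_rdot u v a b (e : R) : hlim u a -> hlim v b -> 0 < e ->
  exists N, forall n, (N <= n)%N -> `|rdot (u n) (v n) - rdot a b| < e.
Proof.
move=> ha hb e0.
set K := n2 a + n2 b + 1.
have K0 : 0 < K by rewrite ltr_wpDl // addr_ge0 ?n2_ge0.
(* The bound [d <= 1] keeps [n2 (v n)] below [2 * K]; then [d * 16 * K <= e ^+ 2] makes both
   Cauchy-Schwarz terms smaller than [e / 2]. *)
set d := Num.min 1 (e ^+ 2 / (16 * K)).
have d0 : 0 < d by rewrite lt_min ltr01 divr_gt0 // ?exprn_gt0 // mulr_gt0.
have [N hN] := ha d d0; have [N' hN'] := hb d d0.
exists (maxn N N') => n; rewrite geq_max => /andP[/hN h1 /hN' h2].
have -> : rdot (u n) (v n) - rdot a b = rdot (u n - a) (v n) + rdot a (v n - b).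
  by rewrite rdotBl rdotBr; ring.
have dK : d * (16 * K) <= e ^+ 2.
  by rewrite -ler_pdivlMr ?mulr_gt0 // /d ge_min lexx orbT.
have d1 : d <= 1 by rewrite /d ge_min lexx.
have vb : n2 (v n) <= 2 * K.
  have -> : v n = (v n - b) + b by rewrite subrK.
  by have := n2D_le (v n - b) b; have := n2_ge0 a; rewrite /K; lra.
have X1 : `|rdot (u n - a) (v n)| < e / 2.
  rewrite -(@ltr_pXn2r _ 2) ?nnegrE ?divr_ge0 ?(ltW e0) // -normrX ger0_norm ?sqr_ge0 //.
  apply: (le_lt_trans (CS _ _)); have := n2_ge0 (u n - a); have := n2_ge0 (v n).
  by nra.
have X2 : `|rdot a (v n - b)| < e / 2.
  rewrite -(@ltr_pXn2r _ 2) ?nnegrE ?divr_ge0 ?(ltW e0) // -normrX ger0_norm ?sqr_ge0 //.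
  apply: (le_lt_trans (CS _ _)); have := n2_ge0 (v n - b); have := n2_ge0 a.
  have := n2_ge0 b; rewrite /K in dK K0 *; nra.
by apply: (le_lt_trans (ler_normD _ _)); lra.
Qed.

Lemma hlim_rdot_le u v a b (M : R) : hlim u a -> hlim v b ->
  (forall n, rdot (u n) (v n) <= M) -> rdot a b <= M.
Proof.
move=> ha hb h; apply/ler_addgt0Pr => e e0.
have [N hN] := hlim_rdot ha hb e0.
by have := hN N (leqnn _); rewrite ltr_norml => /andP[]; have := h N; lra.
Qed.

Lemma hlim_rdot_ge u v a b (M : R) : hlim u a -> hlim v b ->
  (forall n, M <= rdot (u n) (v n)) -> M <= rdot a b.
Proof.
move=> ha hb h; apply/ler_addgt0Pr => e e0.
have [N hN] := hlim_rdot ha hb e0.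
by have := hN N (leqnn _); rewrite ltr_norml => /andP[]; have := h N; lra.
Qed.

Lemma hlim_rdot_eq u v a b (M : R) : hlim u a -> hlim v b ->
  (forall n, rdot (u n) (v n) = M) -> rdot a b = M.
Proof.
move=> ha hb h; by apply/eqP; rewrite eq_le; apply/andP; split;
  [apply: (hlim_rdot_le ha hb)|apply: (hlim_rdot_ge ha hb)] => n; rewrite h.
Qed.

Lemma hlim_shift u a k : hlim u a -> hlim (fun n => u (n + k)%N) a.
Proof.
by move=> h e /h[N hN]; exists N => n Nn; apply: hN; rewrite (leq_trans Nn) // leq_addr.
Qed.

Lemma closed_seq (x : set (H * H)) (u v : nat -> H) a b : closed x ->
  (forall n, x (u n, v n)) -> hlim u a -> hlim v b -> x (a, b).
Proof.
move=> cx h ha hb; rewrite ((closure_id x).1 cx); apply/closure2P => e e0.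
have [N hN] := ha e e0; have [N' hN'] := hb e e0.
exists (u (maxn N N')), (v (maxn N N')); split=> //.
  by apply: hN; rewrite leq_maxl.
by apply: hN'; rewrite leq_maxr.
Qed.

End hilbert_basics.

Section projections.
Set Implicit Arguments.
Unset Strict Implicit.
Variables (R : realType) (H : hilbertSpace R).
Implicit Types (a b c : H) (r s : R) (f g u : H -> H) (V W : set H).

Lemma bop_lin f : bounded_op f -> linear f. Proof. by case. Qed.

Lemma bop_id : @bounded_op R H id.
Proof. by apply/bounded_opP; split=> //; exists 1 => // a; rewrite mul1r. Qed.

Lemma bop_comp f g : bounded_op f -> bounded_op g -> bounded_op (f \o g).
Proof.
move=> /bounded_opP[lf [C C0 hC]] /bounded_opP[lg [C' C'0 hC']].
apply/bounded_opP; split=> [k a b|]; first by rewrite /= lg lf.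
exists (C * C'); first exact: mulr_ge0.
by move=> a; apply: (le_trans (hC _)); rewrite -mulrA ler_wpM2l.
Qed.

Lemma bop_scaleC (k : R[i]) : bounded_op (fun a : H => k *: a).
Proof.
apply/bounded_opP; split=> [k' c d|]; first by rewrite scalerDr !scalerA mulrC.
exists (complex.Re k ^+ 2 + complex.Im k ^+ 2); first by rewrite addr_ge0 ?sqr_ge0.
by move=> a; rewrite n2Zc.
Qed.

Lemma bop_add f g : bounded_op f -> bounded_op g -> bounded_op (f \+ g).
Proof.
move=> /bounded_opP[lf [C C0 hC]] /bounded_opP[lg [C' C'0 hC']].
apply/bounded_opP; split=> [k a b|]; first by rewrite /= lg lf scalerDr addrACA.
exists (2 * C + 2 * C'); first by rewrite addr_ge0 ?mulr_ge0.
move=> a; apply: (le_trans (n2D_le _ _)).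
by have := hC a; have := hC' a; lra.
Qed.

Lemma bop_opp f : bounded_op f -> bounded_op (fun a => - f a).
Proof.
move=> /bounded_opP[lf [C C0 hC]].
apply/bounded_opP; split=> [k a b|]; first by rewrite lf opprD scalerN.
by exists C => // a; rewrite n2N.
Qed.

Lemma bop_sub f g : bounded_op f -> bounded_op g -> bounded_op (f \- g).
Proof. by move=> hf /bop_opp hg; exact: (bop_add hf hg). Qed.

Lemma bop_scale r f : bounded_op f -> bounded_op (fun a => r%:C%C *: f a).
Proof.
move=> /bounded_opP[lf [C C0 hC]].
apply/bounded_opP; split=> [k a b|].
  by rewrite lf scalerDr !scalerA mulrC.
exists (r ^+ 2 * C); first by rewrite mulr_ge0 ?sqr_ge0.
by move=> a; rewrite n2Z -mulrA ler_wpM2l ?sqr_ge0.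
Qed.

Lemma bop0 : @bounded_op R H (fun=> 0).
Proof.
apply/bounded_opP; split=> [k a b|]; first by rewrite scaler0 addr0.
by exists 0 => // a; rewrite n20 mul0r.
Qed.

Lemma adjP f g : linear f -> linear g ->
  adjoint_pair f g <-> forall a b, rdot (f a) b = rdot a (g b).
Proof.
move=> lf lg; split=> [h a b|h a b]; first by rewrite /rdot h.
by rewrite !hdotE !h (linZ lg).
Qed.

Definition hsym f := forall a b, rdot (f a) b = rdot a (f b).

Lemma pos_boundedP f : bounded_op f -> hsym f ->
  pos_bounded f <-> forall a, 0 <= rdot (f a) a.
Proof.
move=> bf sf; split=> [[_ h] a|h].
  by have := h a; rewrite hdotE lecE => /andP[].
split=> // a; rewrite hdotE lecE /= h andbT; apply/eqP.
have := sf a ('i%C *: a); rewrite (linZ (bop_lin bf)) rdotC rdot_i (rdotC a).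
by rewrite rdotC => ?; lra.
Qed.

Lemma pos_form f a : pos_bounded f -> 0 <= rdot (f a) a.
Proof. by move=> [_ /(_ a)]; rewrite hdotE lecE => /andP[]. Qed.

Record csubspace V : Prop := {
  cs_0 : V 0 ;
  cs_lin : forall (k : R[i]) a b, V a -> V b -> V (k *: a + b) ;
  cs_lim : forall (u : nat -> H) a, (forall n, V (u n)) -> hlim u a -> V a
}.

Section csubspace_theory.
Variables (V : set H) (sV : csubspace V).

Lemma csD a b : V a -> V b -> V (a + b).
Proof. by move=> ha hb; rewrite -[a]scale1r; apply: cs_lin. Qed.
Lemma csZ (k : R[i]) a : V a -> V (k *: a).
Proof. by move=> ha; rewrite -[_ *: _]addr0; apply: cs_lin => //; apply: cs_0. Qed.
Lemma csN a : V a -> V (- a).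
Proof. by rewrite -scaleN1r; exact: csZ. Qed.
Lemma csB a b : V a -> V b -> V (a - b).
Proof. by move=> ha /csN; exact: csD. Qed.

(** A minimising sequence for the distance to [V] is Cauchy by the parallelogram identity. Its limit
    [b] is the projection: minimality along [b + r c] is a quadratic inequality in [r] whose linear
    coefficient must vanish. *)
Lemma proj_ex a : exists b, V b /\ forall c, V c -> rdot (a - b) c = 0.
Proof.
pose S := [set n2 (a - c) | c in V].
have S0 : S !=set0 by exists (n2 (a - 0)); exists 0 => //; apply: cs_0.
have lS : has_lbound S by exists 0 => _ [c _ <-]; apply: n2_ge0.
set d := inf S.
have dle c : V c -> d <= n2 (a - c).
  by move=> Vc; apply: ge_inf => //; exists c.
have /choice[u hu] : forall n : nat, exists c, V c /\ n2 (a - c) < d + n.+1%:R^-1.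
  move=> n; have e0 : 0 < n.+1%:R^-1 :> R by rewrite invr_gt0 ltr0n.
  have [_ [c Vc <-] hc] := inf_adherent e0 (conj S0 lS).
  by exists c.
have key m n : n2 (u m - u n) <= 2 * m.+1%:R^-1 + 2 * n.+1%:R^-1.
  have Vm : V (2^-1%:C%C *: (u m + u n)).
    by apply/csZ/csD; apply: (hu _).1.
  have := dle _ Vm.
  have -> : n2 (u m - u n) = 2 * n2 (a - u m) + 2 * n2 (a - u n) - 4 * n2 (a - 2^-1%:C%C *: (u m + u n)).
    by rewrite !n2B n2Z n2D rdotZr rdotDr; field.
  by have := (hu m).2; have := (hu n).2; move: (m.+1%:R^-1) (n.+1%:R^-1) => x y; lra.
have [|b hb] := @hcomplete R H u.
  move=> e e0; exists (Num.truncn (4 / e)) => m n hm hn; apply: (le_lt_trans (key _ _)).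
  have X k : (Num.truncn (4 / e) <= k)%N -> k.+1%:R^-1 < e / 4.
    move=> hk; rewrite -[e / 4]invrK ltf_pV2 ?posrE ?invr_gt0 ?divr_gt0 // invf_div.
    have := truncnS_gt (4 / e); move=> h; apply: (lt_le_trans h).
    by rewrite ler_nat.
  by have := X _ hm; have := X _ hn; move: (m.+1%:R^-1) (n.+1%:R^-1) => x y; lra.
have Vb : V b by apply: (cs_lim sV) hb => n; apply: (hu n).1.
exists b; split=> // c Vc.
have db : n2 (a - b) <= d.
  apply/ler_addgt0Pr => e e0.
  have hab : hlim (fun n => a - u n) (a - b).
    move=> e' /hb[N hN]; exists N => n /hN.
    have -> : a - u n - (a - b) = b - u n by rewrite opprB [LHS]addrC subrKA.
    by rewrite n2BC.
  have [N hN] := hlim_rdot hab hab (divr_gt0 e0 (ltr0Sn R 1)).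
  pose n := maxn N (Num.truncn (2 / e)).
  have := hN n (leq_maxl _ _); have := (hu n).2.
  have : n.+1%:R^-1 < e / 2.
    rewrite -[e / 2]invrK ltf_pV2 ?posrE ?invr_gt0 ?divr_gt0 // invf_div.
    by apply: (lt_le_trans (truncnS_gt _)); rewrite ler_nat ltnS leq_maxr.
  by move: (n.+1%:R^-1) => x; rewrite ltr_norml /n2 => ? ? /andP[]; lra.
have : (- rdot (a - b) c) ^+ 2 <= 0 * n2 c.
  apply: disc_le; rewrite ?n2_ge0 // => r; rewrite add0r.
  have := dle (b + r%:C%C *: c) (csD Vb (csZ _ Vc)).
  by rewrite opprD addrA n2B n2Z rdotZr; lra.
by rewrite mul0r sqrrN => h; apply/eqP; rewrite -sqrf_eq0 eq_le h sqr_ge0.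
Qed.

End csubspace_theory.

Definition pr V a : H := get [set b | V b /\ forall c, V c -> rdot (a - b) c = 0].

Definition perp V : set H := [set a | forall c, V c -> rdot a c = 0].

Section projection_theory.
Variables (V : set H) (sV : csubspace V).

Lemma pr_in a : V (pr V a).
Proof.
by have [b hb] := proj_ex sV a; have [] := @getI _ [set b | V b /\ forall c, V c -> rdot (a - b) c = 0] b hb.
Qed.

Lemma pr_perp a : perp V (a - pr V a).
Proof.
by have [b hb] := proj_ex sV a; have [] := @getI _ [set b | V b /\ forall c, V c -> rdot (a - b) c = 0] b hb.
Qed.

Lemma pr_uniq a b : V b -> perp V (a - b) -> pr V a = b.
Proof.
move=> Vb h; apply/eqP; rewrite -subr_eq0; apply/eqP/n2_eq0.
have V1 : V (pr V a - b) by apply: csB => //; exact: pr_in.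
have := h _ V1; have := pr_perp a V1.
rewrite /n2 !rdotBl; lra.
Qed.

Lemma pr_id a : V a -> pr V a = a.
Proof. by move=> Va; apply: pr_uniq => // c _; rewrite subrr rdot0l. Qed.

Lemma pr_fix a : pr V a = a <-> V a.
Proof. by split=> [<-|/pr_id //]; exact: pr_in. Qed.

Lemma pr_sym : hsym (pr V).
Proof.
move=> a b; have := @pr_perp a _ (pr_in b); have := @pr_perp b _ (pr_in a).
rewrite !rdotBl (rdotC b) (rdotC (pr V b)); lra.
Qed.

Lemma pr_lin : linear (pr V).
Proof.
move=> k a b; apply: pr_uniq; first by apply: (cs_lin sV); exact: pr_in.
move=> c Vc.
have -> : k *: a + b - (k *: pr V a + pr V b) = k *: (a - pr V a) + (b - pr V b).
  by rewrite scalerBr opprD addrACA.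
rewrite rdotDl (pr_perp b Vc) addr0.
have -> : rdot (k *: (a - pr V a)) c = complex.Re ⟨k *: (a - pr V a), c⟩ by [].
rewrite linearZl_LR /= hdotE (pr_perp a Vc) (pr_perp a (csZ sV _ Vc)).
by case: k => x y /=; rewrite !mulr0 subr0.
Qed.

Lemma pr_n2 a : n2 a = n2 (pr V a) + n2 (a - pr V a).
Proof.
have := @pr_perp a _ (pr_in a); rewrite rdotBl => h.
by rewrite n2B; rewrite /n2 in h *; lra.
Qed.

Lemma pr_le a : n2 (pr V a) <= n2 a.
Proof. by rewrite (pr_n2 a) lerDl n2_ge0. Qed.

Lemma pr_bop : bounded_op (pr V).
Proof.
by apply/bounded_opP; split; [exact: pr_lin|exists 1 => // a; rewrite mul1r pr_le].
Qed.

Lemma pr_projection : projection (pr V).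
Proof.
split; first exact: pr_bop.
  by apply/funext => a /=; apply: pr_id; exact: pr_in.
by apply/adjP; [exact: pr_lin|exact: pr_lin|exact: pr_sym].
Qed.

Lemma pr_form a : rdot (pr V a) a = n2 (pr V a).
Proof. by rewrite -{1}(pr_id (pr_in a)) pr_sym. Qed.

Lemma perp_0 a : perp V a <-> pr V a = 0.
Proof.
split=> [h|h c Vc]; last by have := pr_perp a Vc; rewrite h subr0.
by apply: pr_uniq; [exact: (cs_0 sV)|rewrite subr0].
Qed.

End projection_theory.

Lemma perp_csub V : csubspace V -> csubspace (perp V).
Proof.
move=> sV; split.
- by move=> c _; rewrite rdot0l.
- move=> k a b /(perp_0 sV) ha /(perp_0 sV) hb; apply/(perp_0 sV).
  by rewrite pr_lin // ha hb scaler0 addr0.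
- by move=> u a hu ha c Vc; apply: (hlim_rdot_eq ha (hlim_cst c)) => n; exact: hu.
Qed.

Section abstract_projection.
Variables (P : H -> H) (hP : projection P).

Lemma projectionI a : P (P a) = P a.
Proof. by have [_ /(congr1 (fun f => f a)) + _] := hP. Qed.

Lemma projection_bop : bounded_op P. Proof. by case: hP. Qed.
Lemma projection_lin : linear P. Proof. exact: (bop_lin projection_bop). Qed.

Lemma projection_sym : hsym P.
Proof. by have [bP _ aP] := hP; move/(adjP (bop_lin bP) (bop_lin bP)) : aP. Qed.

Definition fixp : set H := [set a | P a = a].

Lemma fixp_csub : csubspace fixp.
Proof.
split.
- exact: (lin0 projection_lin).
- by move=> k a b /= ha hb; rewrite /fixp /= projection_lin ha hb.
- move=> u a hu ha; apply: (hlim_unique _ ha) => e e0.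
  have [N hN] := hlim_op projection_bop ha e0.
  by exists N => n /hN; rewrite hu.
Qed.

Lemma pr_fixp : pr fixp = P.
Proof.
apply/funext => a; apply: (pr_uniq fixp_csub); first exact: projectionI.
by move=> c /= hc; rewrite rdotBl projection_sym hc subrr.
Qed.

Lemma projection_n2 a : rdot (P a) a = n2 (P a).
Proof. by rewrite -{1}(projectionI a) projection_sym. Qed.

Lemma projection_compl : projection (id \- P).
Proof.
split.
- exact: (bop_sub bop_id projection_bop).
- apply/funext => a /=; rewrite (linB projection_lin) projectionI subrr subr0 //.
- apply/adjP => [||a b]; first exact: (bop_lin (bop_sub bop_id projection_bop)).
    exact: (bop_lin (bop_sub bop_id projection_bop)).
  by rewrite /= rdotBl rdotBr projection_sym.
Qed.

Lemma projection_pos : pos_bounded P.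
Proof.
apply/(pos_boundedP projection_bop projection_sym) => a.
by rewrite projection_n2 n2_ge0.
Qed.

Lemma projection_split a : n2 a = n2 (P a) + n2 (a - P a).
Proof. by rewrite n2B rdotC projection_n2; lra. Qed.

End abstract_projection.

(* Riesz representation of the functionals a |-> <u a, b> . *)
Lemma adjoint_ex u : bounded_op u -> exists2 g, bounded_op g & adjoint_pair u g.
Proof.
move=> bu; have lu := bop_lin bu.
have ex b : exists c, forall a, ⟨u a, b⟩ = ⟨a, c⟩.
  pose V : set H := [set a | ⟨u a, b⟩ = 0].
  have sV : csubspace V.
    split.
    - by rewrite /V /= (lin0 lu) linear0l.
    - by move=> k a a'; rewrite /V /= lu linearPl /= => -> ->; rewrite mulr0 addr0.
    - move=> v a hv ha; rewrite /V /= hdotE.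
      rewrite (hlim_rdot_eq (M := 0) (hlim_op bu ha) (hlim_cst b)); last first.
        by move=> n; rewrite /rdot hv.
      rewrite (hlim_rdot_eq (M := 0) (hlim_op bu ha) (hlim_cst ('i%C *: b))) //.
      by move=> n; have := hv n; rewrite /V /= hdotE => -[].
  have [hV|] := pselect (forall a, V a).
    by exists 0 => a; rewrite hV linear0r.
  move=> /existsNP[z hz]; set w := z - pr V z.
  have pw : perp V w by exact: pr_perp.
  have hw : forall a, V a -> ⟨a, w⟩ = 0.
    move=> a Va; rewrite hdotC hdotE (pw _ Va) (pw _ (csZ sV _ Va)).
    exact: conjC0.
  have Vw : ⟨u w, b⟩ <> 0.
    move=> h0; apply: hz; rewrite -[z](subrK (pr V z)); apply: csD => //.
    exact: pr_in.
  set k := ⟨u w, b⟩ in Vw.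
  have w0 : ⟨w, w⟩ != 0.
    rewrite hdotE; apply/eqP => -[] /n2_eq0 w0 _; apply: Vw.
    by rewrite /k w0 (lin0 lu) linear0l.
  have k0 : k != 0 by apply/eqP.
  exists ((k / ⟨w, w⟩)^* *: w) => a.
  rewrite linearZr_LR /= conjCK.
  have : V (a - (⟨u a, b⟩ / k) *: w).
    rewrite /V /= (linB lu) (linZ lu) linearBl linearZl_LR /= -/k.
    by rewrite divfK // subrr.
  move=> /hw; rewrite linearBl linearZl_LR /= => /subr0_eq ->.
  by field; rewrite k0 w0.
have /choice[g hg] := ex.
have lg : linear g.
  move=> k a b; apply/eqP; rewrite -subr_eq0; apply/eqP/n2_eq0.
  set d := _ - _; rewrite /n2 /rdot.
  have -> : ⟨d, d⟩ = ⟨d, g (k *: a + b)⟩ - (k^* * ⟨d, g a⟩ + ⟨d, g b⟩).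
    by rewrite {2}/d linearBr linearPr.
  by rewrite -!hg linearPr subrr.
exists g; last by move=> a b; rewrite hg.
have [_ [C C0 hC]] := (bounded_opP u).1 bu.
apply/bounded_opP; split=> //; exists C => // b.
have := CS (u (g b)) b; rewrite /rdot hg -/(rdot _ _) -/(n2 _) => h.
have := hC (g b); have := n2_ge0 (g b); have := n2_ge0 b.
have [->|gn] := eqVneq (n2 (g b)) 0; first by move=> *; rewrite mulr_ge0.
move=> b0 g0 h1; have gp : 0 < n2 (g b) by rewrite lt_neqAle eq_sym gn.
rewrite -(ler_pM2l gp) -expr2; apply: (le_trans h); nra.
Qed.

(** Invariance of [V] under the adjoint makes [u] preserve the orthogonal complement too, so [u]
    respects the decomposition of every vector. *)
Lemma comm_pr V u g : csubspace V -> bounded_op u -> bounded_op g ->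
  adjoint_pair u g ->
  (forall a, V a -> V (u a)) -> (forall a, V a -> V (g a)) ->
  u \o pr V = pr V \o u.
Proof.
move=> sV bu bg /(adjP (bop_lin bu) (bop_lin bg)) h hu hg; apply/funext => a /=.
apply/esym/(pr_uniq sV); first by apply: hu; exact: pr_in.
by move=> c Vc; rewrite -(linB (bop_lin bu)) h (pr_perp sV) //; exact: hg.
Qed.

End projections.

(** * Square roots and spectral cuts *)

Section square_roots.
Set Implicit Arguments.
Unset Strict Implicit.
Variables (R : realType) (H : hilbertSpace R).
Implicit Types (a b c : H) (r s : R) (f g u : H -> H) (V W : set H).

Lemma mono_cauchy (y : nat -> R) (M e : R) : {homo y : m n / (m <= n)%N >-> m <= n} ->
  (forall n, y n <= M) -> 0 < e ->
  exists N, forall m n, (N <= m)%N -> (N <= n)%N -> `|y n - y m| < e.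
Proof.
move=> hy hM e0.
have hs : has_sup (range y).
  by split; [exists (y 0%N); exists 0%N|exists M => _ [n _ <-]].
have [_ [N _ <-] hN] := sup_adherent e0 hs.
have yle n : y n <= sup (range y) by apply: sup_ubound; [case: hs|exists n].
exists N => m n /hy h1 /hy h2.
have := yle m; have := yle n => h3 h4; rewrite ltr_norml; apply/andP; split; lra.
Qed.

(** Cauchy-Schwarz for the semi-definite form of [f], at the vectors [a] and [f a], followed by
    division by [n2 (f a)]. The relative version is needed because some operators below are positive
    on an invariant subspace only. *)
Lemma pos_CS_on W f (M : R) a : csubspace W -> linear f -> hsym f ->
  (forall b, W b -> W (f b)) -> (forall b, W b -> 0 <= rdot (f b) b) ->
  (forall b, W b -> rdot (f b) b <= M * n2 b) -> W a -> n2 (f a) <= M * rdot (f a) a.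
Proof.
move=> sW lf sf Wf f0 fM Wa; have Wfa := Wf _ Wa.
have h : n2 (f a) ^+ 2 <= rdot (f a) a * rdot (f (f a)) (f a).
  apply: disc_le => [||r]; [exact: f0|exact: f0|].
  have := f0 (a + r%:C%C *: f a) (csD sW Wa (csZ sW _ Wfa)).
  rewrite (linD lf) (linZ lf) !(rdotDl, rdotDr, rdotZl, rdotZr).
  rewrite (sf (f a) a) -/(n2 (f a)); lra.
have [e0|en] := eqVneq (n2 (f a)) 0.
  have M0 : 0 <= M \/ a = 0.
    have [n0|n0] := eqVneq (n2 a) 0; first by right; exact: n2_eq0.
    left; have np : 0 < n2 a by rewrite lt_neqAle eq_sym n0 n2_ge0.
    by rewrite -(pmulr_lge0 _ np); apply: le_trans (f0 a Wa) (fM a Wa).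
  case: M0 => [M0|->]; last by rewrite (lin0 lf) n20 rdot0l mulr0.
  by rewrite e0 mulr_ge0 ?f0.
have ep : 0 < n2 (f a) by rewrite lt_neqAle eq_sym en n2_ge0.
rewrite -(ler_pM2l ep) -expr2; apply: (le_trans h).
by have := fM _ Wfa; have := f0 _ Wa; nra.
Qed.

Lemma csubT : csubspace [set: H].
Proof. by split. Qed.

Lemma pos_CS f (M : R) a : linear f -> hsym f -> (forall b, 0 <= rdot (f b) b) ->
  (forall b, rdot (f b) b <= M * n2 b) -> n2 (f a) <= M * rdot (f a) a.
Proof. by move=> lf sf f0 fM; apply: (pos_CS_on csubT). Qed.

(** Monotone bounded sequences of symmetric operators converge strongly: an increment [D] lies
    between 0 and 1, so [pos_CS] bounds the square of [|D a|] by its form at [a], an increment of a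
    bounded monotone real sequence. *)
Lemma mono_op_lim (F : nat -> H -> H) :
  (forall n, linear (F n)) -> (forall n, hsym (F n)) ->
  (forall m n a, (m <= n)%N -> 0 <= rdot (F n a - F m a) a) ->
  (forall m n a, (m <= n)%N -> rdot (F n a - F m a) a <= n2 a) ->
  exists G, [/\ linear G, hsym G & forall a, hlim (F ^~ a) (G a)].
Proof.
move=> lF sF F0 F1.
have ex a : exists b, hlim (F ^~ a) b.
  apply: hcomplete => e e0.
  pose y n := rdot (F n a) a.
  have [|n|N hN] := @mono_cauchy y (rdot (F 0%N a) a + n2 a) e _ _ e0.
  - by move=> m n mn; have := F0 _ _ a mn; rewrite rdotBl subr_ge0.
  - by have := F1 _ _ a (leq0n n); rewrite rdotBl /y; lra.
  exists N => m n hm hn; wlog mn : m n hm hn / (m <= n)%N.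
    by move=> W; case/orP: (leq_total m n) => h; [|rewrite n2BC]; exact: W.
  rewrite n2BC; have := hN m n hm hn; rewrite ltr_norml => /andP[_]; apply: le_lt_trans.
  have := @pos_CS (F n \- F m) 1 a; rewrite /= mul1r rdotBl /y; apply.
  - by move=> k b c; rewrite /= !lF scalerBr opprD addrACA.
  - by move=> b c; rewrite /= rdotBl rdotBr !sF.
  - by move=> b; exact: F0.
  - by move=> b; rewrite mul1r; exact: F1.
have /choice[G hG] := ex; exists G; split=> //.
- move=> k a b; apply: (hlim_unique (hG _)).
  have hk : hlim (fun n => k *: F n a) (k *: G a).
    exact: (hlim_op (bop_scaleC H k) (hG a)).
  by move=> e /(hlimD hk (hG b))[N hN]; exists N => n /hN; rewrite lF.
- move=> a b; have := hlim_rdot_eq (hG a) (hlim_cst b).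
  move=> h; apply/eqP; rewrite -subr_eq0; apply/eqP.
  have X (e : R) : 0 < e -> `|rdot (G a) b - rdot a (G b)| <= e.
    move=> e0; have e2 : 0 < e / 2 by rewrite divr_gt0.
    have [N hN] := hlim_rdot (hG a) (hlim_cst b) e2.
    have [N' hN'] := hlim_rdot (hlim_cst a) (hG b) e2.
    have := hN (maxn N N') (leq_maxl _ _); have := hN' (maxn N N') (leq_maxr _ _).
    by rewrite sF !ltr_norml ler_norml => /andP[? ?] /andP[? ?]; apply/andP; split; lra.
  apply/normr0_eq0/eqP; rewrite eq_le normr_ge0 andbT.
  by apply/ler_addgt0Pr => e /X; rewrite add0r.
Qed.

Section sqrt_one_minus.
Variables (C : H -> H) (bC : bounded_op C) (sC : hsym C).
Hypothesis C0 : forall a, 0 <= rdot (C a) a.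
Hypothesis C1 : forall a, rdot (C a) a <= n2 a.

(* Polynomials in C with nonnegative coefficients. The increments of the
   iteration sqY are of this kind, which makes it monotone. *)
Inductive PP : (H -> H) -> Prop :=
| PP_id : PP id
| PP_C f : PP f -> PP (C \o f)
| PP_add f g : PP f -> PP g -> PP (f \+ g)
| PP_sc r f : 0 <= r -> PP f -> PP (fun a => r%:C%C *: f a).

Lemma PP_comp f g : PP f -> PP g -> PP (f \o g).
Proof.
move=> Pf Pg; elim: Pf => //= [f' _ h|f' g' _ hf _ hg|r f' r0 _ h].
- by apply: (PP_C h).
- exact: (PP_add hf hg).
- exact: (PP_sc r0 h).
Qed.

Lemma PP_bop f : PP f -> bounded_op f.
Proof.
elim=> [|f' _ h|f' g' _ hf _ hg|r f' r0 _ h].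
- exact: bop_id.
- exact: bop_comp.
- exact: bop_add.
- exact: bop_scale.
Qed.

Lemma PP_comm f g : PP f -> linear g -> (forall a, g (C a) = C (g a)) ->
  forall a, g (f a) = f (g a).
Proof.
move=> Pf lg gC; elim: Pf => //= [f' _ h|f' g' _ hf _ hg|r f' r0 _ h] a.
- by rewrite gC h.
- by rewrite (linD lg) hf hg.
- by rewrite (linZ lg) h.
Qed.

Lemma PP_comm2 f g : PP f -> PP g -> forall a, g (f a) = f (g a).
Proof.
move=> Pf Pg; apply: PP_comm => //; first exact: bop_lin (PP_bop Pg).
by move=> a; rewrite (PP_comm Pg (bop_lin bC)).
Qed.

Lemma PP_sym f : PP f -> hsym f.
Proof.
elim=> [|f' Pf h|f' g' _ hf _ hg|r f' r0 _ h] a b //=.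
- by rewrite sC h (PP_comm Pf (bop_lin bC)).
- by rewrite rdotDl rdotDr hf hg.
- by rewrite rdotZl rdotZr h.
Qed.

Lemma iterC_sym n : hsym (iter n C).
Proof. by elim: n => [//|n IH a b]; rewrite iterSr IH sC. Qed.

(** The induction requires positivity of all [C^n f]. For [f = id], an even power has the form
    [|C^(n/2) b|^2], and an odd one has the form of [C] at an iterate of [b]. *)
Lemma PP_ge0 f a : PP f -> 0 <= rdot (f a) a.
Proof.
move=> Pf; suff h : forall n a, 0 <= rdot (iter n C (f a)) a by exact: (h 0%N a).
have lC n : linear (iter n C).
  by elim: n => [//|n IH k b c]; rewrite !iterS IH (bop_lin bC).
elim: Pf => [|f' _ h|f' g' _ hf _ hg|r f' r0 _ h] n b.
- have -> : iter n C (id b) = iter (odd n) C (iter n./2 C (iter n./2 C b)).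
    by rewrite -iterD -iterD -?addnA addnn odd_double_half.
  rewrite -iterD addnC iterD iterC_sym; case: (odd n); first exact: C0.
  exact: n2_ge0.
- by rewrite /= -iterSr; exact: h.
- by rewrite /= (linD (lC _)) rdotDl addr_ge0.
- by rewrite /= (linZ (lC _)) rdotZl mulr_ge0.
Qed.

(** Iteration for [Y = 1 - sqrt (1 - C)], the solution of [Y = (C + Y^2) / 2]. *)
Fixpoint sqY n : H -> H := if n is m.+1 then fun a => (2^-1)%:C%C *: (C a + sqY m (sqY m a)) else fun=> 0.

Lemma half_ge0 : 0 <= 2^-1 :> R. Proof. by rewrite invr_ge0. Qed.

Lemma sqY_PP n : PP (sqY n).
Proof.
elim: n => [|n IH] /=.
  have -> : (fun=> 0) = (fun a => (0 : R)%:C%C *: id a) :> (H -> H).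
    by apply/funext => a; rewrite scale0r.
  by apply: PP_sc => //; exact: PP_id.
apply: (@PP_sc _ (fun a => C a + sqY n (sqY n a))); first exact: half_ge0.
by apply: PP_add; [exact: (PP_C PP_id)|exact: (PP_comp IH IH)].
Qed.

(** All terms are polynomials in [C] and commute, so consecutive increments are related by the
    factorisation of a difference of squares: the next one is half of [(Y + Z) (Y - Z)]. *)
Lemma sqY_incr n : PP (sqY n.+1 \- sqY n).
Proof.
elim: n => [|n IH].
  have -> : sqY 1 \- sqY 0 = (fun a => (2^-1)%:C%C *: (C \o id) a).
    by apply/funext => a /=; rewrite subr0 addr0.
  by apply: PP_sc; [exact: half_ge0|exact: (PP_C PP_id)].
have -> : sqY n.+2 \- sqY n.+1 =
    (fun a => (2^-1)%:C%C *: ((sqY n.+1 \+ sqY n) \o (sqY n.+1 \- sqY n)) a).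
  apply/funext => a; set Y := sqY n.+1; set Z := sqY n.
  have -> : (sqY n.+2 \- Y) a = (2^-1)%:C%C *: (C a + Y (Y a)) - (2^-1)%:C%C *: (C a + Z (Z a)) by [].
  rewrite -scalerBr; congr (_ *: _).
  have lY := bop_lin (PP_bop (sqY_PP n.+1)); have lZ := bop_lin (PP_bop (sqY_PP n)).
  rewrite -/Y -/Z in lY lZ.
  have cYZ b : Y (Z b) = Z (Y b) := PP_comm2 (sqY_PP n) (sqY_PP n.+1) b.
  rewrite /= (linB lY) (linB lZ) cYZ.
  by rewrite addrA subrK opprD addrACA subrr add0r.
apply: PP_sc; first exact: half_ge0.
by apply: PP_comp IH; apply: PP_add; exact: sqY_PP.
Qed.

Lemma sqY_mono m n a : (m <= n)%N -> 0 <= rdot (sqY n a - sqY m a) a.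
Proof.
elim: n => [|n IH]; first by rewrite leqn0 => /eqP ->; rewrite subrr rdot0l.
rewrite leq_eqVlt => /orP[/eqP ->|]; first by rewrite subrr rdot0l.
rewrite ltnS => /IH h; rewrite -(subrK (sqY n a) (sqY n.+1 a)) -addrA rdotDl.
by rewrite addr_ge0 //; exact: (PP_ge0 a (sqY_incr n)).
Qed.

Lemma sqY_le1 n a : rdot (sqY n a) a <= n2 a.
Proof.
elim: n a => [|n IH] a; first by rewrite rdot0l n2_ge0.
have hn : n2 (sqY n a) <= n2 a.
  have := @pos_CS (sqY n) 1 a; rewrite mul1r => h.
  apply: le_trans (IH a); apply: h.
  - exact: bop_lin (PP_bop (sqY_PP n)).
  - exact: PP_sym (sqY_PP n).
  - by move=> b; apply: PP_ge0 (sqY_PP n).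
  - by move=> b; rewrite mul1r.
rewrite /= rdotZl rdotDl (PP_sym (sqY_PP n)) -/(n2 _).
by have := C1 a; lra.
Qed.

(** The limit [Y] of [sqY] gives [S = 1 - Y]. The commutation clause is what later places such
    square roots in a von Neumann algebra, through its bicommutant. *)
Lemma sqrt_one_minus : exists S, [/\ bounded_op S, hsym S,
  forall a, 0 <= rdot (S a) a, forall a, S (S a) = a - C a &
  forall g, bounded_op g -> (forall a, g (C a) = C (g a)) ->
    forall a, g (S a) = S (g a)].
Proof.
have [||||Y [lY sY hY]] := @mono_op_lim sqY.
- by move=> n; exact: bop_lin (PP_bop (sqY_PP n)).
- by move=> n; exact: PP_sym (sqY_PP n).
- exact: sqY_mono.
- move=> m n a _; rewrite rdotBl; have := PP_ge0 a (sqY_PP m).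
  by have := sqY_le1 n a; lra.
have Y0 a : 0 <= rdot (Y a) a.
  by apply: (hlim_rdot_ge (hY a) (hlim_cst a)) => n; exact: PP_ge0 (sqY_PP n).
have Y1 a : rdot (Y a) a <= n2 a.
  by apply: (hlim_rdot_le (hY a) (hlim_cst a)) => n; exact: sqY_le1.
have bnd f a : linear f -> hsym f -> (forall a, 0 <= rdot (f a) a) ->
    (forall a, rdot (f a) a <= n2 a) -> n2 (f a) <= n2 a.
  move=> lf sf f0 f1; apply: le_trans (f1 a); rewrite -[leRHS]mul1r.
  by apply: pos_CS => // b; rewrite mul1r.
have bY : bounded_op Y.
  by apply/bounded_opP; split=> //; exists 1 => // a; rewrite mul1r; exact: bnd.
have Y2 a : Y a = (2^-1)%:C%C *: (C a + Y (Y a)).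
  have bh := bop_scale (2^-1) (@bop_id R H).
  apply: (hlim_unique (hlim_shift 1 (hY a))).
  suff h : hlim (fun n => sqY n (sqY n a)) (Y (Y a)).
    move=> e e0; have [N hN] := hlim_op bh (hlimD (hlim_cst (C a)) h) e0.
    by exists N => n /hN; rewrite addn1.
  move=> e e0; have e4 : 0 < e / 4 by rewrite divr_gt0.
  have [N hN] := hY a _ e4; have [N' hN'] := hY (Y a) _ e4.
  exists (maxn N N') => n; rewrite geq_max => /andP[/hN h1 /hN' h2].
  have ln := bop_lin (PP_bop (sqY_PP n)).
  have -> : sqY n (sqY n a) - Y (Y a) = sqY n (sqY n a - Y a) + (sqY n (Y a) - Y (Y a)).
    by rewrite (linB ln) addrA subrK.
  have := bnd (sqY n) (sqY n a - Y a) ln (PP_sym (sqY_PP n)) (fun b => PP_ge0 b (sqY_PP n)) (sqY_le1 n).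
  have := n2D_le (sqY n (sqY n a - Y a)) (sqY n (Y a) - Y (Y a)); lra.
exists (id \- Y : H -> H); split.
- exact: (bop_sub (@bop_id R H) bY).
- by move=> a b; rewrite /= rdotBl rdotBr sY.
- by move=> a; rewrite /= rdotBl subr_ge0.
- move=> a /=; rewrite (linB lY).
  have -> : C a = Y a + Y a - Y (Y a).
    apply/eqP; rewrite -subr_eq0 opprB addrA subr_eq0; apply/eqP.
    rewrite {2 3}(Y2 a) -scalerDl -rmorphD /=.
    have -> : (2^-1 + 2^-1 : R) = 1 by field.
    by rewrite scale1r.
  by rewrite !opprD !opprK !addrA.
- move=> g bg gC a /=; rewrite (linB (bop_lin bg)); congr (_ - _).
  apply: (hlim_unique (hlim_op bg (hY a))) => e /(hY (g a))[N hN].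
  by exists N => n /hN; rewrite (PP_comm (sqY_PP n) (bop_lin bg)).
Qed.

End sqrt_one_minus.

(* N is the kernel of |S| - S. *)
Lemma spectral_cut S : bounded_op S -> hsym S -> (forall a, n2 (S a) <= n2 a) ->
  exists N : set H, [/\ csubspace N, forall a, N a -> N (S a),
    forall a, N a -> 0 <= rdot (S a) a & forall a, perp N a -> rdot (S a) a <= 0].
Proof.
move=> bS sS S1; have lS := bop_lin bS.
(* With [C = 1 - S^2], the square root [T] is the absolute value of [S]. *)
have [||||T [bT sT T0 T2 Tc]] := @sqrt_one_minus (fun a => a - S (S a)).
- exact: (bop_sub (@bop_id R H) (bop_comp bS bS)).
- by move=> a b; rewrite rdotBl rdotBr !sS.
- by move=> a; rewrite rdotBl sS subr_ge0; exact: S1.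
- by move=> a; rewrite rdotBl sS gerBl; exact: n2_ge0.
have lT := bop_lin bT.
have {}T2 a : T (T a) = S (S a) by rewrite T2 opprB addrC subrK.
have TS a : S (T a) = T (S a) by apply: Tc => // b; rewrite (linB lS).
pose N : set H := [set a | T a = S a].
have sN : csubspace N.
  split.
  - by rewrite /N /= (lin0 lT) (lin0 lS).
  - by move=> k a b; rewrite /N /= lT lS => -> ->.
  - move=> u a hu ha; rewrite /N /=; apply: (hlim_unique (hlim_op bT ha)).
    by move=> e /(hlim_op bS ha)[n hn]; exists n => m /hn; rewrite hu.
have NS a : N a -> N (S a) by rewrite /N /= => h; rewrite -TS h.
have NT a : N a -> N (T a) by move=> h; rewrite /N /= -/(N _); rewrite h; exact: NS.
exists N; split=> //; first by move=> a h; rewrite -h.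
move=> a pa.
(* The vector [T a + S a] is always in [N], and is orthogonal to [N] when [a] is; hence it vanishes
   and [S a = - T a], whose form is nonpositive. *)
have V1 : N (T a + S a).
  by rewrite /N /= (linD lT) (linD lS) T2 TS addrC.
have V2 : perp N (T a + S a).
  by move=> c Nc; rewrite rdotDl sT sS !pa ?addr0 //; [exact: NS|exact: NT].
have /eqP := n2_eq0 (V2 _ V1); rewrite addrC addr_eq0 => /eqP ->.
by rewrite rdotNl oppr_le0.
Qed.

End square_roots.

(** * Spectral theorem for positive operators *)

Section positive_operators.
Set Implicit Arguments.
Unset Strict Implicit.
Variables (R : realType) (H : hilbertSpace R).
Implicit Types (a b c d : H) (r s : R) (f g : H -> H) (V : set H).

Lemma pairZD (k : R[i]) a b c d : k *: (a, b) + (c, d) = (k *: a + c, k *: b + d).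
Proof. by []. Qed.

Lemma subDiff a b c : a - b - (a - c) = - (b - c).
Proof. by rewrite !opprB [LHS]addrC addrA subrK. Qed.

(** The third hypothesis says, in terms of real forms, that the adjoint is contained in [x]. It
    implies closedness, while symmetry and density make [x] single-valued; replacing a vector by its
    multiple by [i] turns real identities into complex ones. *)
Lemma mk_positive (x : set (H * H)) :
  (forall (k : R[i]) u v, x u -> x v -> x (k *: u + v)) ->
  (forall a b c d, x (a, b) -> x (c, d) -> rdot b c = rdot a d) ->
  (forall c d, (forall a b, x (a, b) -> rdot b c = rdot a d) -> x (c, d)) ->
  dense (op_dom x) -> (forall a b, x (a, b) -> 0 <= rdot b a) -> positive_op x.
Proof.
move=> xl xs xm dx x0.
have x00 : x (0, 0) by apply: xm => a b _; rewrite !rdot0r.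
have xZ k a b : x (a, b) -> x (k *: a, k *: b).
  by move=> h; have := xl k _ _ h x00; rewrite pairZD !addr0.
split; first split=> //.
- move=> a b c h1 h2; apply/eqP; rewrite -subr_eq0; apply/eqP/n2_eq0.
  have h : x (0, b - c).
    by have := xl (-1) _ _ h2 h1; rewrite pairZD !scaleN1r addNr addrC.
  have hp e : op_dom x e -> rdot (b - c) e = 0.
    by move=> [[e' f] /= hef <-]; rewrite (xs _ _ _ _ h hef) rdot0l.
  apply/eqP; rewrite eq_le n2_ge0 andbT leNgt; apply/negP => n0.
  have [e he ne] := (denseP _).1 dx (b - c) _ n0.
  by move: ne; rewrite n2B (rdotC e) hp //; have := n2_ge0 e; lra.
- apply/closure_id/seteqP; split; first exact: subset_closure.
  move=> [c d] /closure2P h; apply: xm => a b hab.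
  have /choice[u hu] (n : nat) : exists w : H * H,
      [/\ x w, n2 (w.1 - c) < n.+1%:R^-1 & n2 (w.2 - d) < n.+1%:R^-1].
    have [|c' [d' h']] := h n.+1%:R^-1; first by rewrite invr_gt0 ltr0n.
    by exists (c', d').
  have lim (p : H * H -> H) e : (forall n, n2 (p (u n) - e) < n.+1%:R^-1) -> hlim (fun n => p (u n)) e.
    move=> h' e' e0; exists (Num.truncn e'^-1) => n hn; apply: (lt_le_trans (h' n)).
    rewrite -[e']invrK lef_pV2 ?posrE ?invr_gt0 ?ltr0n //.
    by apply: ltW; apply: (lt_le_trans (truncnS_gt _)); rewrite ler_nat.
  have h1 : hlim (fun n => (u n).1) c by apply: lim => n; case: (hu n).
  have h2 : hlim (fun n => (u n).2) d by apply: lim => n; case: (hu n).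
  have X (e : R) : 0 < e -> `|rdot b c - rdot a d| <= e.
    move=> e0; have e2 : 0 < e / 2 by rewrite divr_gt0.
    have [N hN] := hlim_rdot (hlim_cst b) h1 e2.
    have [N' hN'] := hlim_rdot (hlim_cst a) h2 e2.
    have := hN (maxn N N') (leq_maxl _ _); have := hN' (maxn N N') (leq_maxr _ _).
    have [+ _ _] := hu (maxn N N'); case: (u _) => [c' d'] /= hx.
    rewrite (xs _ _ _ _ hab hx) !ltr_norml ler_norml => /andP[? ?] /andP[? ?].
    by apply/andP; split; lra.
  apply/eqP; rewrite -subr_eq0 -normr_eq0 eq_le normr_ge0 andbT.
  by apply/ler_addgt0Pr => e /X; rewrite add0r.
- apply/seteqP; split=> [[c d] h|[c d] h [a b] hab] /=.
    by apply: xm => a b hab; have := h _ hab; rewrite /= /rdot => ->.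
  rewrite !hdotE (xs _ _ _ _ hab h); congr Complex.
  exact: xs (xZ 'i%C _ _ h).
- move=> [a b] h /=; rewrite hdotE lecE /= (x0 _ _ h) andbT; apply/eqP.
  have := xs _ _ _ _ h (xZ 'i%C _ _ h); rewrite -(rdotC ('i%C *: b)) rdot_i.
  by rewrite (rdotC b) => ?; lra.
Qed.

(** A closed relation bounded below has closed range, and a closed subspace with trivial orthogonal
    complement is everything. It serves for the unbounded [1 + x] as well as for bounded maps. *)
Lemma relation_onto (y : set (H * H)) (K : R) :
  (forall (k : R[i]) u v, y u -> y v -> y (k *: u + v)) -> y (0, 0) ->
  (forall u w a b, (forall n, y (u n, w n)) -> hlim u a -> hlim w b -> y (a, b)) ->
  0 <= K -> (forall a b, y (a, b) -> n2 a <= K * n2 b) ->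
  (forall z, (forall a b, y (a, b) -> rdot b z = 0) -> z = 0) ->
  forall c, exists a, y (a, c).
Proof.
move=> yl y0 ycl K0 yK yz c.
pose V := [set b | exists a, y (a, b)].
have sV : csubspace V.
  split; first by exists 0.
    by move=> k b b' [a h] [a' h']; exists (k *: a + a'); apply: (yl k _ _ h h').
  move=> w b /choice[u hu] hb.
  have [|a ha] := @hcomplete R H u; last by exists a; exact: (ycl u w).
  move=> e e0; have K1 : 0 < K + 1 by rewrite ltr_wpDl.
  have [|N hN] := hb (e / (4 * (K + 1))); first by rewrite divr_gt0 // mulr_gt0.
  exists N => m n /hN hm /hN hn.
  have h : y (u m - u n, w m - w n).
    by have := yl (-1) _ _ (hu n) (hu m); rewrite pairZD !scaleN1r [- u n + _]addrC [- w n + _]addrC.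
  apply: (le_lt_trans (yK _ _ h)).
  have -> : w m - w n = (w m - b) - (w n - b) by rewrite opprB addrA subrK.
  rewrite !ltr_pdivlMr ?mulr_gt0 // in hm hn.
  have := n2D_le (w m - b) (- (w n - b)); rewrite n2N.
  have := n2_ge0 (w m - b); have := n2_ge0 (w n - b); have := n2_ge0 (w m - b - (w n - b)).
  nra.
suff : V c by [].
apply/(pr_fix sV)/eqP; rewrite -subr_eq0 -opprB oppr_eq0; apply/eqP/yz => a b h.
by rewrite rdotC (pr_perp sV) //; exists a.
Qed.

Section pos.
Variables (x : set (H * H)) (px : positive_op x).

Lemma pxl (k : R[i]) u v : x u -> x v -> x (k *: u + v).
Proof. by case: px => -[+ _ _ _] _ _ => h; exact: h. Qed.
Lemma px_fun a b c : x (a, b) -> x (a, c) -> b = c.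
Proof. by case: px => -[_ h _ _] _ _; exact: h. Qed.
Lemma px_closed : closed x. Proof. by case: px => -[]. Qed.
Lemma px_dense : dense (op_dom x). Proof. by case: px => -[]. Qed.
Lemma px_sym a b c d : x (a, b) -> x (c, d) -> rdot b c = rdot a d.
Proof.
case: px => _ xs _ h1; rewrite -[in x (c, d)]xs => /(_ _ h1) /=.
by rewrite /rdot => ->.
Qed.
Lemma px_ge0 a b : x (a, b) -> 0 <= rdot b a.
Proof. by case: px => _ _ h /h /=; rewrite hdotE lecE => /andP[]. Qed.
Lemma px0 : x (0, 0).
Proof.
have [a _ _] := (denseP _).1 px_dense 0 1 ltr01.
case: px => _ xs _; rewrite -xs => w _ /=; by rewrite !linear0r.
Qed.
Lemma pxZ (k : R[i]) a b : x (a, b) -> x (k *: a, k *: b).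
Proof. by move=> h; have := pxl k h px0; rewrite pairZD !addr0. Qed.
Lemma pxD a b c d : x (a, b) -> x (c, d) -> x (a + c, b + d).
Proof. by move=> h h'; have := pxl 1 h h'; rewrite pairZD !scale1r. Qed.
Lemma pxB a b c d : x (a, b) -> x (c, d) -> x (a - c, b - d).
Proof. by move=> h /(pxZ (-1)); rewrite !scaleN1r; exact: pxD. Qed.
Lemma px_max c d : (forall a b, x (a, b) -> rdot b c = rdot a d) -> x (c, d).
Proof.
move=> h; case: (px) => _ xs _; rewrite -xs => -[a b] hab /=.
rewrite !hdotE (h _ _ hab); congr Complex.
rewrite -[LHS]opprK -rdot_i (h _ _ (pxZ 'i%C hab)) rdot_i opprK //.
Qed.
Lemma px_lim u w a b : (forall n, x (u n, w n)) -> hlim u a -> hlim w b -> x (a, b).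
Proof. exact: (closed_seq px_closed). Qed.
Lemma px_perp d : (forall a b, x (a, b) -> rdot a d = 0) -> d = 0.
Proof.
move=> h; apply: (px_fun _ px0); apply: px_max => a b hab.
by rewrite rdot0r (h _ _ hab).
Qed.

(** [A] is the resolvent [(1 + x)^-1]. Positivity of [x] bounds [1 + x] below by 1, and a vector [z]
    orthogonal to its range satisfies [x z = - z], so it is 0. *)
Lemma resolvent_ex : exists A, [/\ bounded_op A, hsym A &
  forall b, x (A b, b - A b)].
Proof.
pose y : set (H * H) := [set z | x (z.1, z.2 - z.1)].
have yE a b : y (a, b) = x (a, b - a) by [].
have yb a b : y (a, b) -> n2 a <= 1 * n2 b.
  rewrite yE mul1r => h; have := px_ge0 h; have -> : n2 b = n2 (b - a + a) by rewrite subrK.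
  rewrite n2D.
  by have := n2_ge0 (b - a); have := n2_ge0 a; lra.
have ysym a b c d : y (a, b) -> y (c, d) -> rdot b c = rdot a d.
  by rewrite !yE => h1 h2; have := px_sym h1 h2; rewrite rdotBl rdotBr; lra.
have onto c : exists a, y (a, c).
  apply: (relation_onto (K := 1)) => //.
  - move=> k [a b] [a' b']; rewrite pairZD !yE => h h'; have := pxl k h h'.
    by rewrite pairZD scalerBr addrACA -opprD.
  - by rewrite yE subrr; exact: px0.
  - move=> u w a b h ha hb; rewrite yE; apply: (px_lim h) => //.
    have ha' := hlim_op (bop_opp (@bop_id R H)) ha.
    exact: (hlimD hb ha').
  - move=> z hz.
    have xz : x (z, - z).
      apply: px_max => a b hab; have := hz a (b + a).
      by rewrite yE addrK => /(_ hab); rewrite rdotDl rdotNr; lra.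
    have := px_ge0 xz; rewrite rdotNl => h; apply: n2_eq0.
    by have := n2_ge0 z; rewrite /n2 in h *; lra.
have [A hA] := choice onto.
have lA : linear A.
  move=> k a b; have h : y (k *: A a + A b, k *: a + b).
    have := pxl k (hA a) (hA b).
    by rewrite yE pairZD scalerBr addrACA -opprD.
  have h' : x (A (k *: a + b) - (k *: A a + A b), - (A (k *: a + b) - (k *: A a + A b))).
    by have := pxB (hA (k *: a + b)) h; rewrite subDiff.
  have := px_ge0 h'; rewrite rdotNl => h''; apply/eqP; rewrite -subr_eq0; apply/eqP/n2_eq0.
  by have := n2_ge0 (A (k *: a + b) - (k *: A a + A b)); rewrite /n2 in h'' *; lra.
exists A; split=> //.
  by apply/bounded_opP; split=> //; exists 1 => // a; exact: yb.
by move=> a b; rewrite (ysym _ _ _ _ (hA a) (hA b)).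
Qed.

(** By log-convexity the ratios of consecutive terms increase. If the first one were some [r > w],
    then [c k] would be at least [r ^+ k * c 0], against the growth [O(w^k)]; Bernoulli's inequality
    makes this quantitative. *)
Lemma logconvex (c : nat -> R) (C w : R) : 0 <= w -> (forall k, 0 <= c k) ->
  (forall k, c k.+1 ^+ 2 <= c k * c k.+2) -> (forall k, c k <= C * w ^+ k) ->
  c 1%N <= w * c 0%N.
Proof.
move=> w0 c0 clc cw; rewrite leNgt; apply/negP => h.
have c1 : 0 < c 1%N by apply: le_lt_trans h; rewrite mulr_ge0.
have cp : 0 < c 0%N.
  rewrite lt_neqAle c0 andbT eq_sym; apply/eqP => z.
  by have := clc 0%N; rewrite z mul0r; have := exprn_gt0 2 c1; lra.
set r := c 1%N / c 0%N.
have r0 : 0 < r by rewrite divr_gt0.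
have rw : w < r by rewrite ltr_pdivlMr.
have step k : 0 < c k /\ r * c k <= c k.+1.
  elim: k => [|k [IH1 IH2]]; first by split=> //; rewrite divfK ?gt_eqF.
  have ck : 0 < c k.+1 by apply: lt_le_trans IH2; rewrite mulr_gt0.
  split=> //; rewrite -(ler_pM2l IH1); apply: le_trans (clc k).
  by rewrite mulrA (mulrC (c k)) expr2 ler_pM2r.
have big k : r ^+ k * c 0%N <= C * w ^+ k.
  apply: le_trans (cw k); elim: k => [|k IH]; first by rewrite mul1r.
  by apply: le_trans (step k).2; rewrite exprS -mulrA ler_pM2l.
have [w00|wn] := eqVneq w 0.
  by have := big 1%N; rewrite w00 expr1 expr0n mulr0; have := mulr_gt0 r0 cp; lra.
have wp : 0 < w by rewrite lt_neqAle eq_sym wn.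
pose t := r / w - 1.
have t0 : 0 < t by rewrite subr_gt0 ltr_pdivlMr // mul1r.
have qE : r / w = 1 + t by rewrite /t addrC subrK.
have bern k : 1 + k%:R * t <= (r / w) ^+ k.
  rewrite qE; elim: k => [|k IH]; first by rewrite mul0r addr0 expr0.
  rewrite exprS; have k0 : 0 <= k%:R :> R by rewrite ler0n.
  apply: (@le_trans _ _ ((1 + t) * (1 + k%:R * t))); last by rewrite ler_pM2l // addr_gt0.
  by rewrite -natr1; move: (k%:R) k0 => K k0; nra.
pose k := (Num.truncn (C / c 0%N / t)).+1.
have := bern k; have : (r / w) ^+ k <= C / c 0%N.
  rewrite ler_pdivlMr // exprMn exprVn mulrAC ler_pdivrMr ?exprn_gt0 //.
have : C / c 0%N / t < k%:R by exact: truncnS_gt.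
by rewrite ltr_pdivrMr //; lra.
Qed.

(* The spectral subspace of [0, v]: a belongs to it when every x^k a is defined
   and of norm O(v^k). *)
Definition spV v : set H := [set a | exists (u : nat -> H) (C : R),
  [/\ u 0%N = a, forall k, x (u k, u k.+1) & forall k, n2 (u k) <= C * (v ^+ 2) ^+ k]].

(** The squared norms of the iterates are log-convex by symmetry of [x] and Cauchy-Schwarz, so the
    asymptotic bound in [spV] improves to the exact bound [|x a| <= v |a|]. *)
Lemma spV_step v a : spV v a -> exists b, [/\ x (a, b), spV v b & n2 b <= v ^+ 2 * n2 a].
Proof.
move=> [u [C [<- hu hC]]]; exists (u 1%N); split=> //.
  exists (fun k => u k.+1), (C * v ^+ 2); split=> // k.
  by have := hC k.+1; rewrite exprS mulrA.
apply: (@logconvex (fun k => n2 (u k)) C) => //; first exact: sqr_ge0.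
  by move=> k; exact: n2_ge0.
move=> k; rewrite {1}/n2 (px_sym (hu k) (hu k.+1)); exact: CS.
Qed.

(** Converse of [spV_step], and the usual way to prove membership: iterate a choice of images inside
    [W]. *)
Lemma spV_chain (W : set H) v : (forall a, W a -> exists b, [/\ x (a, b), W b & n2 b <= v ^+ 2 * n2 a]) ->
  W `<=` spV v.
Proof.
move=> hW a Wa.
have /choice[f hf] : forall c, exists b, W c -> [/\ x (c, b), W b & n2 b <= v ^+ 2 * n2 c].
  move=> c; have [Wc|] := pselect (W c); last by exists 0.
  by have [b hb] := hW c Wc; exists b.
have Wi k : W (iter k f a) by elim: k => //= k /hf[].
exists (fun k => iter k f a), (n2 a); split=> // k; first by have [] := hf _ (Wi k).
elim: k => [|k IH]; first by rewrite mulr1.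
rewrite iterS exprS; have [_ _ h] := hf _ (Wi k); apply: (le_trans h).
by rewrite mulrCA ler_wpM2l ?sqr_ge0.
Qed.

(** For closedness, [spV_chain] is applied to the set [W] of limits: the images of a convergent
    sequence are Cauchy by [spV_step], and [x] is closed. *)
Lemma spV_csub v : csubspace (spV v).
Proof.
have lin (k : R[i]) a b : spV v a -> spV v b -> spV v (k *: a + b).
  move=> [u [C [<- hu hC]]] [u' [C' [<- hu' hC']]].
  pose K := complex.Re k ^+ 2 + complex.Im k ^+ 2.
  exists (fun n => k *: u n + u' n), (2 * (K * C) + 2 * C'); split=> // n.
    exact: (pxl k (hu n) (hu' n)).
  apply: (le_trans (n2D_le _ _)); rewrite n2Zc -/K.
  have K0 : 0 <= K by rewrite addr_ge0 ?sqr_ge0.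
  have := hC n; have := hC' n; move: (_ ^+ n) => X; nra.
split=> //.
  exists (fun=> 0), 0; split=> // k; first exact: px0.
  by rewrite n20 mul0r.
move=> u0 a0 hu0 ha0.
pose W := [set a | exists u, (forall n, spV v (u n)) /\ hlim u a].
apply: (@spV_chain W); last by exists u0.
move=> a [u [hu ha]]; have /choice[w hw] := fun n => spV_step (hu n).
have wd m n : n2 (w m - w n) <= v ^+ 2 * n2 (u m - u n).
  have h : spV v (u m - u n).
    by have := lin (-1) _ _ (hu n) (hu m); rewrite scaleN1r addrC.
  have [b [h1 _ h2]] := spV_step h.
  have [xm _ _] := hw m; have [xn _ _] := hw n.
  by rewrite -(px_fun h1 (pxB xm xn)).
have [|b hb] := @hcomplete R H w.
  move=> e e0; have v1 : 0 < v ^+ 2 + 1 by rewrite ltr_wpDl ?sqr_ge0.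
  have [|N hN] := ha (e / (4 * (v ^+ 2 + 1))); first by rewrite divr_gt0 // mulr_gt0.
  exists N => m n /hN hm /hN hn; apply: (le_lt_trans (wd m n)).
  rewrite !ltr_pdivlMr ?mulr_gt0 // in hm hn.
  have -> : u m - u n = (u m - a) - (u n - a) by rewrite opprB addrA subrK.
  have := n2D_le (u m - a) (- (u n - a)); rewrite n2N.
  have := n2_ge0 (u m - a); have := n2_ge0 (u n - a); have := n2_ge0 (u m - a - (u n - a)).
  have := sqr_ge0 v; nra.
exists b; split.
- by apply: (px_lim _ ha hb) => n; case: (hw n).
- by exists w; split=> // n; case: (hw n).
- have X : rdot b b - v ^+ 2 * rdot a a <= 0.
    apply/ler_addgt0Pr => e e0; rewrite add0r.
    have v1 : 0 < v ^+ 2 + 1 by rewrite ltr_wpDl ?sqr_ge0.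
    have e2 : 0 < e / (v ^+ 2 + 1) / 2 by rewrite !divr_gt0.
    have [N hN] := hlim_rdot ha ha e2; have [N' hN'] := hlim_rdot hb hb e2.
    have := hN (maxn N N') (leq_maxl _ _); have := hN' (maxn N N') (leq_maxr _ _).
    have [_ _] := hw (maxn N N'); rewrite !ltr_norml /n2 => h /andP[? ?] /andP[? ?].
    have eE : e = (e / (v ^+ 2 + 1) / 2) * (2 * (v ^+ 2 + 1)) by field; rewrite gt_eqF.
    have := sqr_ge0 v; nra.
  by rewrite /n2; lra.
Qed.

Definition spE v := pr (spV v).

(** [x] maps [spV x v] into itself, so by symmetry it also respects the orthogonal complement; the
    image of the projection of [a] is then the projection of [b]. *)
Lemma spE_comm v a b : x (a, b) -> x (spE v a, spE v b).
Proof.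
move=> hab; have [c [h1 h2 h3]] := spV_step (pr_in (spV_csub v) a).
suff -> : spE v b = c by [].
apply: (pr_uniq (spV_csub v)) => // d Vd.
have [d' [xd Vd' _]] := spV_step Vd.
rewrite rdotBl (px_sym hab xd) (px_sym h1 xd) -[pr _ a]/(spE v a).
by have := pr_perp (spV_csub v) a Vd'; rewrite rdotBl => ->.
Qed.

Lemma spV_form v a b : 0 <= v -> spV v a -> x (a, b) -> rdot b a <= v * n2 a.
Proof.
move=> v0 /spV_step[c [h1 _ h2]] h; rewrite (px_fun h h1).
have := CS c a; have := n2_ge0 a; have := n2_ge0 c; have := px_ge0 h1.
move=> p0 c0 a0 cs; rewrite -(@ler_pXn2r _ 2) ?nnegrE ?mulr_ge0 //.
by apply: (le_trans cs); nra.
Qed.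

Lemma spV_mono v w : 0 <= v -> v <= w -> spV v `<=` spV w.
Proof.
move=> v0 vw; apply: spV_chain => a /spV_step[b [h1 h2 h3]]; exists b; split=> //.
by apply: (le_trans h3); rewrite ler_wpM2r ?n2_ge0 // ler_pXn2r ?nnegrE //; exact: le_trans vw.
Qed.

Lemma spV_rcont v a : 0 <= v -> (forall w, v < w -> spV w a) -> spV v a.
Proof.
move=> v0; pose W := [set a | forall w, v < w -> spV w a].
apply: (@spV_chain W) => {}a Wa.
have [b [h1 _ _]] := spV_step (Wa (v + 1) ltac:(by rewrite ltrDl)).
have hb w : v < w -> spV w b /\ n2 b <= w ^+ 2 * n2 a.
  by move=> /Wa/spV_step[c [h1' h2 h3]]; rewrite (px_fun h1 h1').
exists b; split=> //; first by move=> w /hb[].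
apply/ler_addgt0Pr => e e0; have na := n2_ge0 a.
(* For [d <= 1] the excess of [(v + d)^2] over [v^2] is at most [d * (2 * v + 1)]. *)
pose d := Num.min 1 (e / ((2 * v + 1) * n2 a + 1)).
have p1 : 0 < (2 * v + 1) * n2 a + 1 by nra.
have d0 : 0 < d by rewrite lt_min ltr01 divr_gt0.
have d1 : d <= 1 by rewrite /d ge_min lexx.
have d2 : d * ((2 * v + 1) * n2 a + 1) <= e by rewrite -ler_pdivlMr // /d ge_min lexx orbT.
have [|_ h] := hb (v + d); first by rewrite ltrDl.
apply: (le_trans h); nra.
Qed.

Lemma spV_inv v u : bounded_op u -> (forall a b, x (a, b) -> x (u a, u b)) ->
  forall a, spV v a -> spV v (u a).
Proof.
move=> /bounded_opP[lu [K K0 hK]] ux a [w [C [<- hw hC]]].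
exists (u \o w), (K * C); split=> // k; first exact: ux.
by apply: (le_trans (hK _)); rewrite -mulrA ler_wpM2l.
Qed.

(** The resolvent turns the level [v] of [x] into the level [1 / (1 + v)] of a bounded operator.
    [spectral_cut] for [S = A - 1 / (1 + v)] yields a subspace [N] where [A] is above that level,
    thus [x] below [v]. Hence [N] lies in [spV x v], and orthogonally to [spV x v] the operator [S]
    is nonpositive. *)
Lemma spV_cut v : 0 <= v -> exists A, [/\ bounded_op A, hsym A,
  forall b, x (A b, b - A b) &
  forall b, perp (spV v) b -> (1 + v) * n2 (A b) <= rdot (A b) b /\ (1 + v) * rdot (A b) b <= n2 b].
Proof.
move=> v0; have [A [bA sA xA]] := resolvent_ex; have lA := bop_lin bA.
exists A; split=> //.
have A0 b : 0 <= rdot (A b) b.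
  have := px_ge0 (xA b); rewrite rdotBl rdotC; have := n2_ge0 (A b); rewrite /n2; lra.
have A2 b : n2 (A b) <= rdot (A b) b.
  by have := px_ge0 (xA b); rewrite rdotBl rdotC /n2; lra.
have A1 b : rdot (A b) b <= n2 b.
  have := n2_ge0 (b - A b); rewrite n2B rdotC; have := A2 b; lra.
have v1 : 0 < 1 + v by rewrite ltr_pwDl.
set al := (1 + v)^-1.
have al0 : 0 < al by rewrite invr_gt0.
have al1 : al * (1 + v) = 1 by rewrite mulVf ?gt_eqF.
have all : al <= 1 by rewrite invf_le1 // lerDl.
pose S a := A a - al%:C%C *: a.
have bS : bounded_op S by apply: (bop_sub bA (bop_scale al (@bop_id R H))).
have sS : hsym S by move=> a b; rewrite /S rdotBl rdotBr rdotZl rdotZr sA.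
have [N [sN NS N0 N1]] : exists N : set H, [/\ csubspace N, forall a, N a -> N (S a),
    forall a, N a -> 0 <= rdot (S a) a & forall a, perp N a -> rdot (S a) a <= 0].
  apply: spectral_cut => // a; rewrite /S n2B n2Z rdotZr.
  have := A2 a; have := A1 a; have := A0 a.
  move: (n2 (A a)) (n2 a) (rdot _ a) => P N t t0 t1 t2.
  have e1 : 0 <= (N - t) * ((1 - al) * (1 + al)) by rewrite !mulr_ge0 //; lra.
  have e2 : 0 <= t * (al * (2 - al)) by rewrite !mulr_ge0 //; lra.
  by nra.
have NA a : N a -> N (A a).
  move=> h; rewrite -[A a](subrK (al%:C%C *: a)); apply: csD (NS _ h) _ => //; exact: csZ.
have pNA a : perp N a -> perp N (A a) by move=> h c Nc; rewrite sA h //; exact: NA.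
have SE a : rdot (S a) a = rdot (A a) a - al * n2 a by rewrite rdotBl rdotZl.
have NV : N `<=` spV v.
  apply: spV_chain => a Na.
  (* [A] maps [N] onto [N]: the map [f] equal to [A] on [N] and to the identity on its complement is
     bounded below, hence onto. Writing [a = A y] gives [x a = y - A y]. *)
  have [y Ny Ay] : exists2 y, N y & A y = a.
    pose f b := A (pr N b) + (b - pr N b).
    have bp := pr_bop sN.
    have bf : bounded_op f by apply: bop_add; [exact: bop_comp|exact: (bop_sub (@bop_id R H))].
    have fform b : al * n2 b <= rdot (f b) b.
      rewrite rdotDl; have Np := pr_in sN b.
      have -> : rdot (A (pr N b)) b = rdot (A (pr N b)) (pr N b).
        by rewrite -(pr_sym sN) (pr_id sN (NA _ Np)).
      have -> : rdot (b - pr N b) b = n2 (b - pr N b).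
        by rewrite /n2 rdotBr (pr_perp sN _ Np) subr0.
      have := N0 _ Np; rewrite SE; have := pr_n2 sN b; have := n2_ge0 (b - pr N b); nra.
    have [b hb] : exists b, [set z | z.2 = f z.1] (b, a).
      apply: (relation_onto (K := al ^- 2)) => /=.
      - by move=> k [? ?] [? ?] /= -> ->; rewrite (bop_lin bf).
      - by rewrite (lin0 (bop_lin bf)).
      - move=> u w c d h hc hd; apply: (hlim_unique hd) => e /(hlim_op bf hc)[n hn].
        by exists n => m /hn; rewrite -h.
      - by rewrite invr_ge0 exprn_ge0 // ltW.
      - move=> c _ ->; have := CS (f c) c; have := fform c; have := n2_ge0 c.
        have [->|cn] := eqVneq (n2 c) 0.
          by move=> *; rewrite mulr_ge0 ?n2_ge0 // invr_ge0 exprn_ge0 // ltW.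
        move=> c0 h1 h2; have cp : 0 < n2 c by rewrite lt_neqAle eq_sym cn.
        rewrite ler_pdivlMl ?exprn_gt0 // -(ler_pM2r cp); apply: le_trans h2.
        by rewrite -mulrA -expr2 -exprMn ler_pXn2r ?nnegrE ?mulr_ge0 ?(ltW al0) //; apply: le_trans h1; rewrite mulr_ge0 // ltW.
      - move=> z hz; have := hz z _ erefl => h.
        by apply: n2_eq0; have := fform z; rewrite h; have := n2_ge0 z; nra.
    exists (pr N b); first exact: pr_in.
    rewrite /= /f in hb; have V1 : N (a - A (pr N b)).
      by apply: csB => //; apply: NA; exact: pr_in.
    have := pr_perp sN b V1; rewrite {1}(_ : b - pr N b = a - A (pr N b)).
      by move=> /n2_eq0/eqP; rewrite subr_eq0 => /eqP.
    by rewrite hb [RHS]addrC addKr.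
  exists (y - A y); split; first by rewrite -{1}Ay; exact: xA.
    by apply: csB => //; exact: NA.
  rewrite -Ay.
  (* On [N], [0 <= S <= 1 - al]. Since [A = S + al] and [1 - al = v * al], this inequality is what
     [|y - A y| <= v |A y|] reduces to. *)
  have S1 : n2 (S y) <= (1 - al) * rdot (S y) y.
    apply: (pos_CS_on sN (bop_lin bS) sS) => // b Nb; rewrite SE.
    by have := A1 b; lra.
  have yE : A y = S y + al%:C%C *: y by rewrite subrK.
  rewrite yE opprD addrA addrAC.
  have -> : y - al%:C%C *: y = (1 - al)%:C%C *: y by rewrite rmorphB /= scalerBl scale1r.
  rewrite n2B n2D !n2Z rdotZl rdotZr (rdotC y).
  have -> : 1 - al = v * al by rewrite -al1; ring.
  have := N0 y Ny; have := n2_ge0 y; have := n2_ge0 (S y).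
  rewrite (_ : 1 - al = v * al) in S1; last by rewrite -al1; ring.
  set s := rdot (S y) y in S1 *; set t := n2 (S y) in S1 *.
  move=> t0 y0 s0; rewrite -subr_ge0.
  have -> : v ^+ 2 * (t + 2 * (al * s) + al ^+ 2 * n2 y) -
    ((v * al) ^+ 2 * n2 y - 2 * (v * al * s) + t) = v ^+ 2 * (t + 2 * (al * s)) + (v * al * s - t) + v * al * s by ring.
  have vs : 0 <= v * al * s by rewrite !mulr_ge0 // ltW.
  have v2 : 0 <= v ^+ 2 * (t + 2 * (al * s)).
    by rewrite mulr_ge0 ?sqr_ge0 // addr_ge0 // !mulr_ge0 // ltW.
  by lra.
move=> b pb; have pN : perp N b by move=> c /NV; exact: pb.
have h1 := N1 _ pN; rewrite SE in h1.
have h2 : n2 (A b) <= al * rdot (A b) b.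
  apply: (pos_CS_on (perp_csub sN) lA sA) => // c pc.
  by have := N1 _ pc; rewrite SE; lra.
have := A0 b; split.
  have -> : rdot (A b) b = (1 + v) * (al * rdot (A b) b) by rewrite mulrA (mulrC _ al) al1 mul1r.
  by rewrite ler_pM2l.
have -> : n2 b = (1 + v) * (al * n2 b) by rewrite mulrA (mulrC _ al) al1 mul1r.
by rewrite ler_pM2l //; lra.
Qed.

(** Since [A (a + b) = a], the first bound of [spV_cut] at [a + b] reads
    [(1 + v) |a|^2 <= |a|^2 + rdot b a]. *)
Lemma spV_perp_form v a b : 0 <= v -> perp (spV v) a -> x (a, b) -> v * n2 a <= rdot b a.
Proof.
move=> v0 pa hab; have [A [bA sA xA hA]] := spV_cut v0.
have pb : perp (spV v) b.
  apply/(perp_0 (spV_csub v)); have := spE_comm v hab.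
  by rewrite /spE ((perp_0 (spV_csub v) a).1 pa) => h; rewrite (px_fun h px0).
have AE : A (a + b) = a.
  have h : x (A (a + b) - a, - (A (a + b) - a)).
    by have := pxB (xA (a + b)) hab; rewrite [X in (_, X)]addrAC addrK opprB.
  have := px_ge0 h; rewrite rdotNl => h'; apply/eqP; rewrite -subr_eq0; apply/eqP/n2_eq0.
  by have := n2_ge0 (A (a + b) - a); rewrite /n2 in h' *; lra.
have [|+ _] := hA (a + b); first exact: (csD (perp_csub (spV_csub v))).
by rewrite AE rdotDr (rdotC b) -/(n2 a); lra.
Qed.

(** Equality case of [spV_perp_form]: [a] then minimises the form of [x - v] on the complement, so
    perturbing it gives [x a = v a]. Thus [a] also lies in [spV x v] and is orthogonal to itself. *)
Lemma spV_perp_eq v a b : 0 <= v -> perp (spV v) a -> x (a, b) -> rdot b a <= v * n2 a -> a = 0.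
Proof.
move=> v0 pa hab le.
have sV := spV_csub v.
have eqa : rdot b a = v * n2 a by apply/eqP; rewrite eq_le le spV_perp_form.
have pb : perp (spV v) b.
  apply/(perp_0 sV); have := spE_comm v hab.
  by rewrite /spE ((perp_0 sV a).1 pa) => h; rewrite (px_fun h px0).
have bE : b = v%:C%C *: a.
  apply/eqP; rewrite -subr_eq0; apply/eqP/px_perp => c d hcd.
  pose c' := c - spE v c; pose d' := d - spE v d.
  have x' : x (c', d') by exact: pxB (hcd) (spE_comm v hcd).
  have pc' : perp (spV v) c' by exact: pr_perp.
  have Vc : spV v (spE v c) by exact: pr_in.
  have -> : rdot c (b - v%:C%C *: a) = rdot (b - v%:C%C *: a) c'.
    have e0 : rdot (b - v%:C%C *: a) (spE v c) = 0.
      by rewrite rdotBl rdotZl pb // pa // mulr0 subr0.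
    by rewrite rdotC /c' rdotBr e0 subr0.
  clearbody c' d'; set y := rdot _ c'; have : y ^+ 2 <= 0 * (rdot d' c' - v * n2 c').
    apply: disc_le => //; first by rewrite subr_ge0 spV_perp_form.
    move=> r.
    have p1 : perp (spV v) (a + r%:C%C *: c') by apply: (csD (perp_csub sV)) => //; exact: (csZ (perp_csub sV)).
    have := spV_perp_form v0 p1 (pxD hab (pxZ r%:C%C x')).
    rewrite n2D n2Z !(rdotDl, rdotDr, rdotZl, rdotZr) eqa.
    rewrite [rdot d' a](_ : _ = rdot b c'); last by rewrite (px_sym x' hab) rdotC.
    by rewrite /y rdotBl rdotZl; lra.
  by rewrite mul0r => h; apply/eqP; rewrite -sqrf_eq0 eq_le h sqr_ge0.
apply: n2_eq0; apply: pa.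
exists (fun k => (v ^+ k)%:C%C *: a), (n2 a); split; first by rewrite scale1r.
  move=> k; have := pxZ (v ^+ k)%:C%C hab.
  by rewrite bE scalerA -rmorphM /= -exprSr.
by move=> k; rewrite n2Z mulrC -!exprM mulnC.
Qed.

(** By [spV_cut], the resolvent at [a] has norm [O(1 / (1 + n))] for every [n], so it vanishes and
    so does [a]. Each use of [spV_cut] yields its own resolvent; two of them agree at [a] because
    [x] maps their difference to its opposite. *)
Lemma spV_total a : (forall n : nat, perp (spV n%:R) a) -> a = 0.
Proof.
move=> h.
have key : exists A, bounded_op A /\ x (A a, a - A a) /\ n2 (A a) = 0.
  have [A [bA sA xA hA]] := spV_cut (lexx 0); exists A; split=> //; split=> //.
  apply/eqP; rewrite eq_le n2_ge0 andbT; apply/ler_addgt0Pr => e e0; rewrite add0r.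
  pose n := Num.truncn (n2 a / e).
  have [A' [bA' sA' xA' hA']] := spV_cut (ler0n R n).
  have -> : A a = A' a.
    have hx : x (A a - A' a, - (A a - A' a)).
      have := pxB (xA a) (xA' a).
      by rewrite subDiff.
    have := px_ge0 hx; rewrite rdotNl => h'; apply/eqP; rewrite -subr_eq0; apply/eqP/n2_eq0.
    by have := n2_ge0 (A a - A' a); rewrite /n2 in h' *; lra.
  have [h1 h2] := hA' a (h n).
  have n0 : 0 <= n%:R :> R by rewrite ler0n.
  have : n2 a / e < 1 + n%:R by rewrite addrC natr1; exact: truncnS_gt.
  rewrite ltr_pdivrMr // => h3; have := n2_ge0 (A' a); have := n2_ge0 a; nra.
have [A [_ [xA /n2_eq0 A0]]] := key.
by rewrite A0 subr0 in xA; rewrite (px_fun xA px0).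
Qed.

End pos.

(** The even iterates of [x] are also those of [h]; an odd iterate of [h] is bounded by
    Cauchy-Schwarz between its two even neighbours. Thus [op_abs x] has the spectral subspaces of
    [x] without any appeal to uniqueness of positive square roots. *)
Lemma spV_sq (x h : set (H * H)) v : positive_op x -> positive_op h ->
  (h \; h)%relation = (x \; x)%relation -> spV x v `<=` spV h v.
Proof.
move=> px ph e a [u [C [<- hu hC]]].
have /choice[w hw] : forall k, exists b, h (u k.*2, b) /\ h (b, u k.*2.+2).
  move=> k; have : (x \; x)%relation (u k.*2, u k.*2.+2).
    by exists (u k.*2.+1); exact: hu.
  by rewrite -e => -[b h1 h2]; exists b.
have parity (k : nat) : exists j, k = j.*2 \/ k = j.*2.+1.
  exists k./2; have := odd_double_half k; case: (odd k) => /= e'; [right|left]; exact: esym.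
exists (fun k => if odd k then w k./2 else u k), C; split=> //.
- move=> k; have [j jE] := parity k; case: jE => ->; rewrite /= odd_double /= uphalf_double.
    exact: (hw j).1.
  exact: (hw j).2.
- move=> k; have [j jE] := parity k; case: jE => ->; rewrite /= odd_double /= ?uphalf_double //.
  have [h1 h2] := hw j.
  have C0 : 0 <= C by have := hC 0%N; rewrite expr0 mulr1; apply: le_trans (n2_ge0 _).
  have E : n2 (w j) = rdot (u j.*2) (u j.*2.+2) by rewrite /n2 (px_sym ph h1 h2).
  have := CS (u j.*2) (u j.*2.+2); rewrite -E => cs.
  rewrite -(@ler_pXn2r _ 2) ?nnegrE ?n2_ge0 //; last first.
    by rewrite mulr_ge0 // exprn_ge0 // sqr_ge0.
  apply: (le_trans cs); apply: (le_trans (ler_pM (n2_ge0 _) (n2_ge0 _) (hC _) (hC _))).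
  by rewrite !exprS; move: (_ ^+ j.*2) => X; rewrite le_eqVlt; apply/orP; left; apply/eqP; ring.
Qed.

End positive_operators.

(** * Resolution of the identity of a positive operator and its Stieltjes measures *)

Section spectral_resolution.
Set Implicit Arguments.
Unset Strict Implicit.
Variables (R : realType) (H : hilbertSpace R) (x : set (H * H)) (px : positive_op x).
Implicit Types (a b c d : H) (r s v w : R).

Local Notation E := (spE x).
Let sV v : csubspace (spV x v) := spV_csub px v.

Lemma spE_le v w a : 0 <= v -> v <= w -> E v (E w a) = E v a.
Proof.
move=> v0 vw; apply: (pr_uniq (sV v)); first exact: pr_in.
move=> c Vc; have Vwc := spV_mono px v0 vw Vc.
rewrite rdotBl (pr_sym (sV w)) (pr_id (sV w) Vwc) -rdotBl.
exact: pr_perp.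
Qed.

Lemma spE_ge v w a : 0 <= v -> v <= w -> E w (E v a) = E v a.
Proof. by move=> v0 vw; apply: (pr_id (sV w)); apply: (spV_mono px v0 vw); exact: pr_in. Qed.

Lemma spE_diff v w a : 0 <= v -> v <= w -> n2 (E w a - E v a) = n2 (E w a) - n2 (E v a).
Proof.
move=> v0 vw; rewrite n2B.
have -> : rdot (E w a) (E v a) = n2 (E v a).
  have -> : rdot (E w a) (E v a) = rdot a (E w (E v a)) by exact: (pr_sym (sV w)).
  by rewrite spE_ge // rdotC; exact: (pr_form (sV v)).
by ring.
Qed.

Lemma spE_n2_mono v w a : 0 <= v -> v <= w -> n2 (E v a) <= n2 (E w a).
Proof. by move=> v0 vw; rewrite -subr_ge0 -spE_diff // n2_ge0. Qed.

Lemma spE_lim (w : nat -> R) a : (forall n, 0 <= w n) ->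
  ({homo w : m n / (m <= n)%N >-> m <= n} \/ {homo w : m n / (m <= n)%N >-> n <= m}) ->
  exists b, hlim (fun n => E (w n) a) b.
Proof.
move=> w0 hw.
have cau (s : bool) : {homo w : m n / (m <= n)%N >-> if s then m <= n else n <= m} ->
    exists b, hlim (fun n => E (w n) a) b.
  move=> {}hw; apply: hcomplete => e e0.
  pose y n := (if s then n2 (E (w n) a) else - n2 (E (w n) a)).
  have [||N hN] := @mono_cauchy R y (n2 a) e _ _ e0.
  - move=> m n /hw; rewrite /y; case: s {y hw} => h; first exact: spE_n2_mono.
    by rewrite lerN2; exact: spE_n2_mono.
  - rewrite /y => n; case: s {y hw} => //; first exact: pr_le.
    by apply: (@le_trans _ _ 0); rewrite ?oppr_le0 n2_ge0.
  exists N => m n hm hn; wlog mn : m n hm hn / (m <= n)%N.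
    by move=> W; case/orP: (leq_total m n) => h; [|rewrite n2BC]; exact: W.
  have := hN m n hm hn; have := hw _ _ mn; rewrite /y; case: s {y hw hN} => h.
    by rewrite n2BC spE_diff // ltr_norml => /andP[].
  by rewrite opprK addrC spE_diff // ltr_norml => /andP[].
by case: hw; [exact: (cau true)|exact: (cau false)].
Qed.

Lemma spE_rcont v a e : 0 <= v -> 0 < e ->
  exists n : nat, n2 (E (v + n.+1%:R^-1) a) < n2 (E v a) + e.
Proof.
move=> v0 e0; pose w n : R := v + n.+1%:R^-1.
have w0 n : 0 <= w n by rewrite addr_ge0.
have wd : {homo w : m n / (m <= n)%N >-> n <= m}.
  by move=> m n mn; rewrite lerD2l lef_pV2 ?posrE ?ltr0n // ler_nat ltnS.
have [b hb] := spE_lim a w0 (or_intror wd).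
have wlt z : v < z -> exists N : nat, forall n, (N <= n)%N -> w n <= z.
  move=> vz; exists (Num.truncn (z - v)^-1) => n hn.
  rewrite -lerBrDl -[z - v]invrK lef_pV2 ?posrE ?invr_gt0 ?subr_gt0 ?ltr0n //.
  by apply: ltW; apply: (lt_le_trans (truncnS_gt _)); rewrite ler_nat ltnS.
have Vb : spV x v b.
  apply: (spV_rcont px v0) => z /wlt[N hN].
  apply: (cs_lim (spV_csub px z) _ (hlim_shift N hb)) => n.
  by apply: (spV_mono px (w0 _) (hN _ (leq_addl _ _))); exact: pr_in.
have bE : E v a = b.
  apply: (pr_uniq (sV v)) => // c Vc.
  rewrite rdotBl; apply/eqP; rewrite subr_eq0; apply/eqP/esym.
  apply: (hlim_rdot_eq hb (hlim_cst c)) => n.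
  have Vwc : spV x (w n) c by apply: (spV_mono px v0) Vc; rewrite lerDl.
  by rewrite (pr_sym (sV _)) (pr_id (sV _) Vwc).
have [N hN] := hlim_rdot hb hb e0; exists N; have := hN N (leqnn _).
by rewrite -bE ltr_norml /n2 /w => /andP[_]; lra.
Qed.

Lemma spE_ltotal a e : 0 < e -> exists n : nat, n2 a - e < n2 (E n%:R a).
Proof.
move=> e0; pose w n : R := n%:R.
have w0 n : 0 <= w n by rewrite ler0n.
have wd : {homo w : m n / (m <= n)%N >-> m <= n} by move=> m n; rewrite ler_nat.
have [b hb] := spE_lim a w0 (or_introl wd).
have bE : a = b.
  apply/eqP; rewrite -subr_eq0; apply/eqP/(spV_total px) => n c Vc.
  rewrite rdotBl; apply/eqP; rewrite subr_eq0; apply/eqP/esym.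
  apply: (hlim_rdot_eq (hlim_shift n hb) (hlim_cst c)) => m.
  have Vwc : spV x (w (m + n)%N) c by apply: (spV_mono px (w0 n)) Vc; apply: wd; exact: leq_addl.
  by rewrite (pr_sym (sV _)) (pr_id (sV _) Vwc).
have [N hN] := hlim_rdot hb hb e0; exists N; have := hN N (leqnn _).
by rewrite -bE ltr_norml /n2 /w => /andP[]; lra.
Qed.

(** [spV] depends on [v] only through [v ^+ 2], so negative levels are cut off to obtain a
    distribution function; its jump at 0 comes from the kernel of [x]. *)
Definition spF a v : R := if v < 0 then 0 else n2 (E v a).

Lemma spF_nd a : nondecreasing (spF a).
Proof.
move=> v w vw; rewrite /spF; case: ltP => v0; case: ltP => w0 //.
- exact: n2_ge0.
- by have := le_lt_trans v0 (le_lt_trans vw w0); rewrite ltxx.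
- exact: spE_n2_mono.
Qed.

Lemma spF_rc a : right_continuous (spF a).
Proof.
move=> v; apply/cvgrPdist_lt => e e0.
have [d d0 hd] : exists2 d, 0 < d & spF a (v + d) < spF a v + e.
  have [v0|v0] := ltP v 0.
    exists (- v / 2); first by rewrite divr_gt0 // oppr_gt0.
    by rewrite /spF v0 ifT ?add0r //; lra.
  have [n hn] := spE_rcont a v0 e0; exists n.+1%:R^-1; first by rewrite invr_gt0 ltr0n.
  have e1 : (v < 0) = false by rewrite ltNge v0.
  have e2 : (v + n.+1%:R^-1 < 0) = false by rewrite ltNge addr_ge0.
  by rewrite /spF e1 e2.
near=> w.
have vw : v <= w by apply: ltW; near: w; exact: nbhs_right_gt.
have wd : w <= v + d by near: w; apply: nbhs_right_le; rewrite ltrDl.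
have := spF_nd a vw; have := spF_nd a wd.
by rewrite distrC => h1 h2; rewrite ger0_norm ?subr_ge0 //; lra.
Unshelve. all: end_near. Qed.

HB.instance Definition _ a := isCumulative.Build R _ R (spF a) (@spF_nd a) (@spF_rc a).

Definition spM a : {measure set (measurableTypeR R) -> \bar R} := lebesgue_stieltjes_measure (spF a).

Lemma spM_oc a v w : v <= w -> spM a `]v, w]%classic = (spF a w - spF a v)%:E.
Proof.
move=> vw; rewrite /spM /= /lebesgue_stieltjes_measure /measure_extension.
rewrite measurable_mu_extE; first exact: (wlength_itv_bnd (spF a) false false vw).
exact: is_ocitv.
Qed.

Lemma mTR (i : interval R) : measurable ([set` i] : set (measurableTypeR R)).
Proof. exact: measurable_itv. Qed.

Lemma spM_le a v : 0 <= v -> spM a `]-oo, v]%classic = (n2 (E v a))%:E.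
Proof.
move=> v0; have -> : `]-oo, v]%classic = \bigcup_(n : nat) `](- n.+1%:R), v]%classic :> set R.
  apply/seteqP; split=> [z /= | z [n _]] /=; rewrite !in_itv /=.
    move=> zv; exists (Num.truncn (`|z|)) => //=; rewrite in_itv /= zv andbT.
    rewrite ltrNl; apply: le_lt_trans (truncnS_gt _); rewrite -normrN; exact: ler_norm.
  by move=> /andP[].
have h : (spM a \o (fun n : nat => `](- n.+1%:R), v]%classic)) @ \oo --> (n2 (E v a))%:E.
  rewrite [X in X @ _](_ : _ = fun=> (n2 (E v a))%:E); first exact: cvg_cst.
  apply/funext => n /=; have n0 : 0 < n.+1%:R :> R by rewrite ltr0n.
  rewrite spM_oc; last by apply: le_trans v0; rewrite oppr_le0 ltW.
  by rewrite /spF ltNge v0 /= ifT ?subr0 // oppr_lt0.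
apply/esym/(cvg_unique (@ereal_hausdorff R) h).
apply: nondecreasing_cvg_mu => [n|//|m n mn].
- exact: mTR.
- by apply: bigcup_measurable => n _; exact: mTR.
- apply/subsetPset => z /=; rewrite !in_itv /= => /andP[h1 ->]; rewrite andbT.
  by apply: le_lt_trans h1; rewrite lerN2 ler_nat ltnS.
Qed.

Lemma spM_T a : spM a setT = (n2 a)%:E.
Proof.
have cov : [set: R] = \bigcup_(n : nat) `]-oo, n%:R]%classic.
  apply/seteqP; split=> // z _; exists (Num.truncn `|z|).+1 => //=; rewrite in_itv /=.
  by apply: ltW; apply: le_lt_trans (truncnS_gt _); exact: ler_norm.
rewrite cov.
have h : (spM a \o (fun n : nat => `]-oo, n%:R]%classic)) @ \oo --> (n2 a)%:E.
  rewrite [X in X @ _](_ : _ = fun n : nat => (n2 (E n%:R a))%:E); last first.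
    by apply/funext => n /=; rewrite spM_le.
  apply/cvg_EFin => //; first by near=> n.
  apply/cvgrPdist_lt => e e0; have [N hN] := spE_ltotal a e0.
  exists N => // n /= Nn; have := pr_le (sV n%:R) a; rewrite -/(E n%:R) => h1.
  rewrite ger0_norm ?subr_ge0 //.
  have : n2 (E N%:R a) <= n2 (E n%:R a) by apply: spE_n2_mono; rewrite ?ler0n ?ler_nat.
  by lra.
apply/esym/(cvg_unique (@ereal_hausdorff R) h).
apply: nondecreasing_cvg_mu => [n|//|m n mn].
- exact: mTR.
- by apply: bigcup_measurable => n _; exact: mTR.
- apply/subsetPset => z /=; rewrite !in_itv /= => h1.
  by apply: le_trans h1 _; rewrite ler_nat.
Unshelve. all: end_near. Qed.

(** The measures [spM a] are constructed one vector at a time. This property says that, for fixed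
    [B], their values are the form of a single projection; it passes through the Dynkin operations
    from half-open intervals to all Borel sets. *)
Definition hasproj (B : set (measurableTypeR R)) :=
  exists Q : H -> H, projection Q /\ forall a, spM a B = (rdot (Q a) a)%:E.

Lemma spM_fin a (B : set (measurableTypeR R)) : measurable B -> (spM a B < +oo)%E.
Proof.
move=> mB; apply: (@le_lt_trans _ _ (spM a setT)); last by rewrite spM_T ltry.
by apply: le_measure; rewrite ?inE //.
Qed.

Lemma hasproj_C B : measurable B -> hasproj B -> hasproj (~` B).
Proof.
move=> mB [Q [pQ hQ]]; exists (id \- Q); split; first exact: projection_compl.
move=> a.
have h : spM a (~` B) = (spM a setT - spM a B)%E.
  rewrite -setTD measureD //; first by rewrite setTI.
  by rewrite (spM_fin a).
by rewrite h spM_T hQ -EFinB /= rdotBl.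
Qed.

(** Additivity gives [|P a|^2 + |Q a|^2 <= |a|^2]. At the vector [Q a] this forces [P (Q a) = 0], so
    [P] and [Q] are orthogonal and their sum is a projection. *)
Lemma hasproj_U B C : measurable B -> measurable C -> B `&` C = set0 ->
  hasproj B -> hasproj C -> hasproj (B `|` C).
Proof.
move=> mB mC BC [P [pP hP]] [Q [pQ hQ]].
have hU a : spM a (B `|` C) = (rdot (P a) a + rdot (Q a) a)%:E.
  have -> : spM a (B `|` C) = (spM a B + spM a C)%E by rewrite measureU.
  by rewrite hP hQ.
have le a : n2 (P a) + n2 (Q a) <= n2 a.
  rewrite -!projection_n2 // -lee_fin -hU -spM_T.
  by apply: le_measure; rewrite ?inE //; exact: measurableU.
have PQ a : P (Q a) = 0.
  apply: n2_eq0; have := le (Q a); rewrite projectionI //; have := n2_ge0 (P (Q a)); lra.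
have QP a : Q (P a) = 0.
  apply: n2_eq0; have := le (P a); rewrite projectionI //; have := n2_ge0 (Q (P a)); lra.
have bP := projection_bop pP; have bQ := projection_bop pQ.
exists (P \+ Q); split; last by move=> a; rewrite hU /= rdotDl.
split; first exact: bop_add.
  apply/funext => a /=; rewrite (linD (bop_lin bP)) (linD (bop_lin bQ)) PQ QP.
  by rewrite !projectionI // addr0 add0r.
have lPQ := bop_lin (bop_add bP bQ).
by apply/(adjP lPQ lPQ) => a b; rewrite /= rdotDl rdotDr !projection_sym.
Qed.

Lemma hasproj_lim (U : nat -> set (measurableTypeR R)) : (forall n, measurable (U n)) ->
  {homo U : m n / (m <= n)%N >-> m `<=` n} -> (forall n, hasproj (U n)) ->
  hasproj (\bigcup_n U n).
Proof.
move=> mU ndU /choice[T hT].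
have pT n := (hT n).1; have fT n a := (hT n).2 a.
have le m n a : (m <= n)%N -> rdot (T m a) a <= rdot (T n a) a.
  by move=> mn; rewrite -lee_fin -!fT; apply: le_measure; rewrite ?inE //; exact: ndU.
have le1 n a : rdot (T n a) a <= n2 a.
  rewrite -lee_fin -fT -spM_T; apply: le_measure; rewrite ?inE //.
have absb m n a : (m <= n)%N -> T n (T m a) = T m a.
  move=> mn; have := le m n (T m a) mn; rewrite projectionI // !projection_n2 //.
  rewrite /n2 -/(n2 (T m a)) => h.
  have := projection_split (pT n) (T m a); have := n2_ge0 (T m a - T n (T m a)).
  rewrite /n2 in h * => h1 h2.
  apply/esym/eqP; rewrite -subr_eq0; apply/eqP/n2_eq0; rewrite /n2; lra.
have [||||G [lG sG hG]] := @mono_op_lim R H T.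
- by move=> n; exact: projection_lin.
- by move=> n; exact: projection_sym.
- by move=> m n a /le h; rewrite rdotBl subr_ge0.
- move=> m n a _; rewrite rdotBl; have := le1 n a.
  by have := n2_ge0 (T m a); rewrite -projection_n2 //; lra.
have bG : bounded_op G.
  apply/bounded_opP; split=> //; exists 1 => // a; rewrite mul1r.
  have h : rdot (G a) a <= n2 a by apply: (hlim_rdot_le (hG a) (hlim_cst a)) => n.
  apply: le_trans h; rewrite -[leRHS]mul1r; apply: pos_CS => // b.
    apply: (hlim_rdot_ge (hG b) (hlim_cst b)) => n; rewrite projection_n2 ?n2_ge0 //.
  by rewrite mul1r; apply: (hlim_rdot_le (hG b) (hlim_cst b)) => n.
have GT n a : G (T n a) = T n a.
  apply: (hlim_unique (hlim_shift n (hG (T n a)))) => e e0; exists 0%N => m _.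
  by rewrite absb ?leq_addl // subrr n20.
exists G; split.
  split=> //.
    apply/funext => a /=; apply: (hlim_unique (hlim_op bG (hG a))) => e /(hG a)[N hN].
    by exists N => n /hN; rewrite GT.
  exact/adjP.
move=> a; have h : (spM a \o U) @ \oo --> (rdot (G a) a)%:E.
  rewrite [X in X @ _](_ : _ = fun n => (rdot (T n a) a)%:E); last first.
    by apply/funext => n /=; rewrite fT.
  apply/cvg_EFin => //; first by near=> n.
  apply/cvgrPdist_lt => e e0; have [N hN] := hlim_rdot (hG a) (hlim_cst a) e0.
  by exists N => // n /= /hN; rewrite distrC.
apply/esym/(cvg_unique (@ereal_hausdorff R) h).
apply: nondecreasing_cvg_mu => [n|//|m n mn]; first exact: mU.
- by apply: bigcup_measurable => n _; exact: mU.
- by apply/subsetPset; exact: ndU.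
Unshelve. all: end_near. Qed.

Lemma projection0 : projection (fun _ : H => 0).
Proof.
have b0 := @bop0 R H; split=> //.
by apply/(adjP (bop_lin b0) (bop_lin b0)) => a b; rewrite rdot0l rdot0r.
Qed.

Lemma hasproj_0 : hasproj set0.
Proof.
by exists (fun=> 0); split; [exact: projection0|move=> a; rewrite measure0 rdot0l].
Qed.

Lemma hasproj_oc v w : hasproj `]v, w]%classic.
Proof.
have [wv|vw] := leP w v; first by rewrite set_itv_ge ?bnd_simp -?leNgt //; exact: hasproj_0.
have [w0|w0] := ltP w 0.
  exists (fun=> 0); split; first exact: projection0.
  by move=> a; rewrite spM_oc ?(ltW vw) // /spF w0 (lt_trans vw w0) subr0 rdot0l.
have [v0|v0] := ltP v 0.
  exists (E w); split; first exact: pr_projection.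
  move=> a; rewrite spM_oc ?(ltW vw) // /spF v0 ltNge w0 /= subr0.
  by rewrite /spE pr_form.
have vw' := ltW vw.
exists (fun a => E w a - E v a); split; last first.
  move=> a; rewrite spM_oc // /spF !ltNge v0 w0 /= rdotBl.
  by rewrite /spE !pr_form.
have b1 : bounded_op (E w) := pr_bop (sV w).
have b2 : bounded_op (E v) := pr_bop (sV v).
have lb := bop_lin (bop_sub b1 b2).
split; first exact: bop_sub.
  apply/funext => a /=; rewrite !(linB (bop_lin b1)) !(linB (bop_lin b2)).
  rewrite (spE_le a v0 vw') (spE_ge a v0 vw').
  have EE z c : E z (E z c) = E z c by apply: (pr_id (sV z)); exact: pr_in.
  by rewrite !EE subrr subr0.
by apply/(adjP lb lb) => a b; rewrite rdotBl rdotBr (pr_sym (sV _)) (pr_sym (sV _)).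
Qed.

Lemma hasproj_all B : measurable B -> hasproj B.
Proof.
move=> mB; apply: (@dynkin_induction _ (measurableTypeR R) (@ocitv R) hasproj) => //.
- exact: ocitvI.
- exists id; split; last by move=> a; rewrite spM_T.
  by split; [exact: bop_id| |].
- by move=> _ [[v w] _ <-]; exact: hasproj_oc.
- by move=> S mS; exact: hasproj_C.
- move=> F mF tF hF; rewrite -bigcup_bigsetU_bigcup.
  apply: hasproj_lim => [n|m n mn|n].
  + by apply: bigsetU_measurable => i _; exact: mF.
  + by apply: subset_bigsetU; rewrite ltnS.
  + elim: n.+1 => [|k IH]; first by rewrite big_ord0; exact: hasproj_0.
    rewrite big_ord_recr /=; apply: hasproj_U => //.
      by apply: bigsetU_measurable => i _; exact: mF.
    rewrite -bigcup_mkord; apply/seteqP; split=> // z [[i /= ik Fi] Fk].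
    by have := tF i k Logic.I Logic.I (ex_intro _ z (conj Fi Fk)) => ii; rewrite ii ltnn in ik.
Qed.

End spectral_resolution.

(** * Existence of the spectral measure *)

Section spectral_measures.
Set Implicit Arguments.
Unset Strict Implicit.
Variables (R : realType) (H : hilbertSpace R) (x : set (H * H)) (px : positive_op x).
Implicit Types (a b c d : H) (r s v w : R).

(** Over [N] equal steps the increments of [D] add up to at most [K * W * (F W - F 0) / N], which
    tends to 0. *)
Lemma riemann_const (D F : R -> R) (K W : R) : 0 <= K -> 0 <= W ->
  (forall v w, 0 <= v -> v <= w -> w <= W -> `|D w - D v| <= K * (w - v) * (F w - F v)) ->
  D W = D 0.
Proof.
move=> K0 W0 h; apply/eqP; rewrite -subr_eq0 -normr_eq0 eq_le normr_ge0 andbT.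
apply/ler_addgt0Pr => e e0; rewrite add0r.
pose N := (Num.truncn (K * W * (F W - F 0) / e)).+1.
have N0 : 0 < N%:R :> R by rewrite ltr0n.
have step k : (k <= N)%N -> `|D (k%:R * (W / N%:R)) - D 0| <= K * (W / N%:R) * (F (k%:R * (W / N%:R)) - F 0).
  elim: k => [|k IH] kN; first by rewrite mul0r !subrr normr0 mulr0.
  have {}IH := IH (ltnW kN).
  have hk : 0 <= k%:R * (W / N%:R) :> R by rewrite mulr_ge0 // divr_ge0.
  have hk1 : k%:R * (W / N%:R) <= k.+1%:R * (W / N%:R).
    by rewrite ler_wpM2r ?divr_ge0 // ler_nat.
  have hk2 : k.+1%:R * (W / N%:R) <= W.
    by rewrite mulrCA -[leRHS]mulr1 ler_wpM2l // ler_pdivrMr // mul1r ler_nat.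
  have := h _ _ hk hk1 hk2.
  have -> : k.+1%:R * (W / N%:R) - k%:R * (W / N%:R) = W / N%:R.
    by rewrite -mulrBl -natrB // subSnn mul1r.
  move: (k.+1%:R * _) (k%:R * _) IH => y z IH; move: (K * (W / N%:R)) IH => L IH h1.
  rewrite -(subrK (D z) (D y)) -addrA; apply: (le_trans (ler_normD _ _)).
  by move: h1 IH; lra.
have := step N (leqnn _).
have -> : N%:R * (W / N%:R) = W by field; rewrite gt_eqF.
move=> hs; apply: (le_trans hs).
have : K * W * (F W - F 0) / e < N%:R by exact: truncnS_gt.
rewrite ltr_pdivrMr // => hN.
have -> : K * (W / N%:R) * (F W - F 0) = K * W * (F W - F 0) / N%:R by field; rewrite gt_eqF.
by rewrite ler_pdivrMr //; lra.
Qed.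

(** The truncation at 0 keeps all integrands nonnegative; it is removed by [int_gk], the negative
    half-line being null. *)
Definition gk (k : nat) (l : R) : \bar R := ((Num.max l 0) ^+ k)%:E.

Lemma gk_ge0 k l : (0 <= gk k l)%E.
Proof. by rewrite lee_fin exprn_ge0 // le_max lexx orbT. Qed.

Lemma gk_meas k (D : set (measurableTypeR R)) : measurable D ->
  measurable_fun D (gk k : measurableTypeR R -> \bar R).
Proof.
move=> mD; apply/measurable_EFinP; apply: measurable_funX.
apply: measurable_maxr; [exact: measurable_id|exact: measurable_cst].
Qed.

Local Notation E := (spE x).
Local Notation m := (spM px).
Let F a v := n2 (E v a).

Let xex v a : exists b, x (E v a, b).
Proof. by have [b [h _ _]] := spV_step px (pr_in (spV_csub px v) a); exists b. Qed.

Definition xop v a : H := get [set b | x (E v a, b)].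

Lemma xopP v a : x (E v a, xop v a).
Proof. by have [b hb] := xex v a; exact: (@getI _ [set b | x (E v a, b)] b hb). Qed.

Lemma xop_E v w a : 0 <= v -> v <= w -> E v (xop w a) = xop v a.
Proof.
move=> v0 vw; have := spE_comm px v (xopP w a).
by rewrite (spE_le px) // => h; rewrite (px_fun px h (xopP v a)).
Qed.

(** For [k = 1] and [k = 2], the quantities that the integral of [l ^+ k] up to [v] has to
    represent: the form of [x] at [E v a], and the squared norm of its image. *)
Definition phi (k : nat) v a : R := if k == 1%N then rdot (xop v a) (E v a) else n2 (xop v a).

Let sV v : csubspace (spV x v) := spV_csub px v.

Lemma EE v a : E v (E v a) = E v a.
Proof. by apply: (pr_id (sV v)); exact: pr_in. Qed.

Lemma E_sym v : hsym (E v). Proof. exact: pr_sym. Qed.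

Lemma xop_n2D v w a : 0 <= v -> v <= w -> n2 (xop w a - xop v a) = n2 (xop w a) - n2 (xop v a).
Proof.
move=> v0 vw; rewrite n2B -{1}(xop_E a v0 vw) -E_sym.
have -> : rdot (E v (xop w a)) (xop w a) = n2 (E v (xop w a)).
  by rewrite -{1}EE E_sym.
by rewrite xop_E //; ring.
Qed.

(** The increment is that of the vector [E w a - E v a], which lies in [spV x w] and is orthogonal
    to [spV x v]. For [k = 2] the lower bound follows from the one on the form by Cauchy-Schwarz. *)
Lemma phi_bound k v w a : (k == 1%N) || (k == 2%N) -> 0 <= v -> v <= w ->
  v ^+ k * (F a w - F a v) <= phi k w a - phi k v a <= w ^+ k * (F a w - F a v).
Proof.
move=> hk v0 vw; set d := E w a - E v a.
have w0 := le_trans v0 vw.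
have nd : F a w - F a v = n2 d by rewrite (spE_diff px).
have xd : x (d, xop w a - xop v a) := pxB px (xopP w a) (xopP v a).
have Vd : spV x w d.
  apply: (csB (sV w)); first exact: pr_in.
  by apply: (spV_mono px v0 vw); exact: pr_in.
have pd : perp (spV x v) d.
  apply/(perp_0 (sV v)); rewrite (linB (pr_lin (sV v))).
  by rewrite -/(E v) (spE_le px) // EE subrr.
have lo : v * n2 d <= rdot (xop w a - xop v a) d by apply: spV_perp_form xd.
rewrite nd; case/orP: hk => /eqP -> {k}; rewrite /phi /=.
  rewrite !expr1.
  have -> : rdot (xop w a) (E w a) - rdot (xop v a) (E v a) = rdot (xop w a - xop v a) d.
    rewrite /d rdotBl !rdotBr -(xop_E a v0 vw) !E_sym EE (spE_le px) //; ring.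
  by rewrite lo /=; apply: spV_form xd.
rewrite -xop_n2D //; apply/andP; split.
  have := CS (xop w a - xop v a) d; have := n2_ge0 (xop w a - xop v a).
  have := n2_ge0 d; move: lo; move: (n2 (xop w a - xop v a)) (n2 d) (rdot _ d) => X D y h1 D0 X0 h2.
  have [->|Dn] := eqVneq D 0; first by rewrite mulr0.
  have Dp : 0 < D by rewrite lt_neqAle eq_sym Dn.
  rewrite -(ler_pM2r Dp); apply: le_trans h2.
  by rewrite -mulrA -expr2 -exprMn ler_pXn2r ?nnegrE ?mulr_ge0 //; apply: le_trans h1; rewrite mulr_ge0.
by have [b [h1 _ h2]] := spV_step px Vd; rewrite (px_fun px xd h1).
Qed.

Lemma spM_ocF a v w : 0 <= v -> v <= w -> m a `]v, w]%classic = (F a w - F a v)%:E.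
Proof.
move=> v0 vw; rewrite spM_oc // /spF !ifF //; first by rewrite ltNge v0.
by rewrite ltNge (le_trans v0 vw).
Qed.

Definition Ik k v a : \bar R := (\int[m a]_(l in `]-oo, v]%classic) gk k l)%E.

Lemma Ik_U k v w a : v <= w ->
  Ik k w a = (Ik k v a + \int[m a]_(l in `]v, w]%classic) gk k l)%E.
Proof.
move=> vw; rewrite /Ik -ge0_integral_setU.
- congr (integral _ _ _); apply/seteqP; split=> [z|z [|]] /=; rewrite !in_itv /=.
  + by move=> zw; case: (leP z v) => h; [left|right; rewrite zw].
  + by move=> /le_trans; exact.
  + by case/andP.
- exact: mTR.
- exact: mTR.
- by apply: gk_meas; apply: measurableU; exact: mTR.
- by move=> l _; exact: gk_ge0.
- apply/disj_setPS => z [] /=; rewrite !in_itv /= => h /andP[h' _].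
  by have := lt_le_trans h' h; rewrite ltxx.
Qed.

Lemma Ik_0 k a : (0 < k)%N -> Ik k 0 a = 0.
Proof.
move=> k0; apply: integral0_eq => l /=; rewrite in_itv /= => l0.
by rewrite /gk max_r // expr0n gtn_eqF.
Qed.

Lemma Ik_bound k v w a : 0 <= v -> v <= w ->
  ((v ^+ k * (F a w - F a v))%:E <= \int[m a]_(l in `]v, w]%classic) gk k l)%E /\
  (\int[m a]_(l in `]v, w]%classic) gk k l <= (w ^+ k * (F a w - F a v))%:E)%E.
Proof.
move=> v0 vw; have w0 := le_trans v0 vw.
have mI : measurable (`]v, w]%classic : set (measurableTypeR R)) by exact: mTR.
rewrite !EFinM -spM_ocF // -!integral_cst //; split; apply: ge0_le_integral => //.
- by move=> l _; rewrite lee_fin exprn_ge0.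
- exact: gk_meas.
- move=> l /=; rewrite in_itv /= => /andP[vl lw].
  have l0 := le_trans v0 (ltW vl).
  by rewrite lee_fin max_l // lerXn2r ?nnegrE // ltW.
- by move=> l _; exact: gk_ge0.
- exact: gk_meas.
- move=> l /=; rewrite in_itv /= => /andP[vl lw].
  have l0 := le_trans v0 (ltW vl).
  by rewrite lee_fin max_l // lerXn2r ?nnegrE.
Qed.

(** By [Ik_bound] and [phi_bound] both sides have increments between [y ^+ k] and [z ^+ k] times
    that of [F]; their difference then has increments of second order and [riemann_const] applies.
    The constant [2 * v + 1] is a Lipschitz bound for [l] and [l ^+ 2] on [[0, v]]. *)
Lemma Ik_phi k v a : (k == 1%N) || (k == 2%N) -> 0 <= v -> Ik k v a = (phi k v a)%:E.
Proof.
move=> hk v0.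
have k0 : (0 < k)%N by case/orP: hk => /eqP ->.
have Ifin w : 0 <= w -> Ik k w a \is a fin_num.
  move=> w0; rewrite (Ik_U k a w0) Ik_0 // add0e fin_numE.
  have [h1 h2] := Ik_bound k a (lexx 0) w0.
  apply/andP; split; first by rewrite -ltNye; apply: lt_le_trans h1; rewrite ltNyr.
  by rewrite -ltey; apply: le_lt_trans h2 _; rewrite ltry.
have phi0 : phi k 0 a = 0.
  have [b [h1 _ h2]] := spV_step px (pr_in (sV 0) a).
  have b0 : b = 0.
    by apply: n2_eq0; apply/eqP; rewrite eq_le n2_ge0 andbT; move: h2; rewrite expr0n mul0r.
  have x0 : xop 0 a = 0 by rewrite (px_fun px (xopP 0 a) h1).
  by rewrite /phi x0; case: ifP => _; rewrite ?rdot0l ?n20.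
pose D w := phi k w a - fine (Ik k w a).
suff : D v = D 0.
  rewrite /D Ik_0 // phi0 subrr => /eqP; rewrite subr_eq0 => /eqP ->.
  by rewrite fineK // Ifin.
have hw : 0 <= 2 * v + 1 by rewrite addr_ge0 // mulr_ge0.
apply: (riemann_const (K := 2 * v + 1) (F := fun w => F a w)) => // y z y0 yz zv.
have z0 := le_trans y0 yz.
have [h1 h2] := Ik_bound k a y0 yz.
have := phi_bound a hk y0 yz => /andP[h3 h4].
have DF : 0 <= F a z - F a y by rewrite subr_ge0 spE_n2_mono.
have e1 : fine (Ik k z a) - fine (Ik k y a) = fine (\int[m a]_(l in `]y, z]%classic) gk k l)%E.
  rewrite (Ik_U k a yz) fineD ?Ifin //; first by rewrite addrC addKr.
  by have := Ifin z z0; rewrite (Ik_U k a yz) fin_numD => /andP[].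
have f1 : (\int[m a]_(l in `]y, z]%classic) gk k l)%E \is a fin_num.
  by have := Ifin z z0; rewrite (Ik_U k a yz) fin_numD => /andP[].
move: h1 h2; rewrite -(fineK f1) !lee_fin -e1 => h1 h2.
have kz : z ^+ k - y ^+ k <= (2 * v + 1) * (z - y).
  case/orP: hk => /eqP ->; rewrite ?expr1; first by nra.
  by rewrite subr_sqr; nra.
have kD : (z ^+ k - y ^+ k) * (F a z - F a y) <= (2 * v + 1) * (z - y) * (F a z - F a y).
  by rewrite ler_wpM2r.
rewrite mulrBl in kD.
by rewrite ler_norml /D; apply/andP; split; lra.
Qed.

Lemma spM_neg a : m a `]-oo, 0[%classic = 0.
Proof.
have cov : `]-oo, 0[%classic = \bigcup_(n : nat) `](- n.+1%:R), (- n.+1%:R^-1)]%classic :> set R.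
  apply/seteqP; split=> [z /= | z [n _]] /=; rewrite !in_itv /=.
    move=> z0; have z1 : 0 < - z by rewrite oppr_gt0.
    exists (maxn (Num.truncn (- z)) (Num.truncn (- z)^-1)) => //=; rewrite in_itv /=.
    apply/andP; split.
      rewrite ltrNl; apply: lt_le_trans (truncnS_gt _) _.
      by rewrite ler_nat ltnS leq_maxl.
    rewrite lerNr -[leRHS]invrK lef_pV2 ?posrE ?invr_gt0 ?ltr0n //.
    by apply: ltW; apply: lt_le_trans (truncnS_gt _) _; rewrite ler_nat ltnS leq_maxr.
  by move=> /andP[_ h]; apply: le_lt_trans h _; rewrite oppr_lt0 invr_gt0 ltr0n.
rewrite cov.
have h : (m a \o (fun n : nat => `](- n.+1%:R), (- n.+1%:R^-1)]%classic)) @ \oo --> (0 : \bar R).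
  rewrite [X in X @ _](_ : _ = fun=> 0); first exact: cvg_cst.
  apply/funext => n /=; have n0 : 0 < n.+1%:R :> R by rewrite ltr0n.
  have n1 : 1 <= n.+1%:R :> R by rewrite ler1n.
  have n2' : - n.+1%:R <= - n.+1%:R^-1 :> R by rewrite lerN2 (le_trans _ n1) // invf_le1.
  rewrite spM_oc //.
  by rewrite /spF !oppr_lt0 invr_gt0 n0 subrr.
apply/esym/(cvg_unique (@ereal_hausdorff R) h).
apply: nondecreasing_cvg_mu => [n|//|p n pn].
- exact: mTR.
- by apply: bigcup_measurable => n _; exact: mTR.
- apply/subsetPset => z /=; rewrite !in_itv /= => /andP[h1 h2]; apply/andP; split.
    by apply: le_lt_trans h1; rewrite lerN2 ler_nat ltnS.
  by apply: (le_trans h2); rewrite lerN2 lef_pV2 ?posrE ?ltr0n // ler_nat ltnS.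
Qed.

Lemma int_gk k a : (\int[m a]_l gk k l = \int[m a]_l (l ^+ k)%:E)%E.
Proof.
apply: ae_eq_integral => //.
- exact: gk_meas.
- by apply/measurable_EFinP; apply: measurable_funX; exact: measurable_id.
- exists `]-oo, 0[%classic; split; [exact: mTR|exact: spM_neg|].
  move=> z /= hz; rewrite in_itv /= ltNge; apply/negP => z0; apply: hz => _.
  by rewrite /gk max_l.
Qed.

Lemma Ik_cvg k a : Ik k n%:R a @[n --> \oo] --> (\int[m a]_l gk k l)%E.
Proof.
have cov : [set: R] = \bigcup_(n : nat) `]-oo, n%:R]%classic.
  apply/seteqP; split=> // z _; exists (Num.truncn `|z|).+1 => //=; rewrite in_itv /=.
  by apply: ltW; apply: le_lt_trans (truncnS_gt _); exact: ler_norm.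
rewrite cov; apply: ge0_nondecreasing_set_cvg_integral.
- move=> i j ij; apply/subsetPset => z /=; rewrite !in_itv /= => h1.
  by apply: le_trans h1 _; rewrite ler_nat.
- by move=> i; exact: mTR.
- by move=> i; apply: gk_meas; exact: mTR.
- by move=> i z _; exact: gk_ge0.
Qed.

Lemma E_cvg a : hlim (fun n => E n%:R a) a.
Proof.
move=> e e0; have [N hN] := spE_ltotal px a e0; exists N => n Nn.
rewrite n2BC; have := pr_n2 (sV n%:R) a; rewrite -/(E n%:R) => h.
have : n2 (E N%:R a) <= n2 (E n%:R a) by apply: spE_n2_mono => //; rewrite ler_nat.
by lra.
Qed.

Lemma dom_sq a b : x (a, b) -> (\int[m a]_l gk 2 l <= (n2 b)%:E)%E.
Proof.
move=> hab; apply: (cvge_to_le (@Ik_cvg 2 a)); apply: nearW => n.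
rewrite Ik_phi // lee_fin /phi /=.
have -> : xop n%:R a = E n%:R b by apply: (px_fun px (xopP _ a)); exact: spE_comm.
exact: pr_le.
Qed.

(** The vectors [xop n a] have increasing squared norms bounded by the integral, and orthogonal
    increments, so they converge; [x] is closed. *)
Lemma sq_dom a : (\int[m a]_l gk 2 l < +oo)%E -> exists b, x (a, b).
Proof.
move=> fin.
have i0 : (0 <= \int[m a]_l gk 2 l)%E by apply: integral_ge0 => l _; exact: gk_ge0.
have f : (\int[m a]_l gk 2 l)%E \is a fin_num by rewrite ge0_fin_numE.
pose L := fine (\int[m a]_l gk 2 l)%E.
have mono (i j : nat) : (i <= j)%N -> n2 (xop i%:R a) <= n2 (xop j%:R a).
  by move=> ij; rewrite -subr_ge0 -xop_n2D ?n2_ge0 // ler_nat.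
have bound (n : nat) : n2 (xop n%:R a) <= L.
  rewrite -lee_fin /L fineK // -[n2 _]/(phi 2 n%:R a) -Ik_phi //.
  apply: ge0_subset_integral => //; first exact: gk_meas.
  by move=> l _; exact: gk_ge0.
have [|b hb] := @hcomplete R H (fun n => xop n%:R a).
  move=> e e0.
  have [N hN] := @mono_cauchy R (fun n => n2 (xop n%:R a)) L e mono bound e0.
  exists N => i j hi hj; wlog ij : i j hi hj / (i <= j)%N.
    by move=> W; case/orP: (leq_total i j) => h; [|rewrite n2BC]; exact: W.
  rewrite n2BC xop_n2D // ?ler_nat //.
  by have := hN i j hi hj; rewrite ltr_norml => /andP[].
by exists b; apply: (px_lim px _ (E_cvg a) hb) => n; exact: xopP.
Qed.

Lemma form_int a b : x (a, b) -> (\int[m a]_l gk 1 l = (rdot b a)%:E)%E.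
Proof.
move=> hab; apply: (cvg_unique (@ereal_hausdorff R) (@Ik_cvg 1 a)).
rewrite [X in X @ _](_ : _ = fun n : nat => (rdot (E n%:R b) (E n%:R a))%:E); last first.
  apply/funext => n /=; rewrite Ik_phi // /phi /=.
  by have -> : xop n%:R a = E n%:R b by apply: (px_fun px (xopP _ a)); exact: spE_comm.
apply/cvg_EFin => //; first by near=> n.
apply/cvgrPdist_lt => e e0; have [N hN] := hlim_rdot (E_cvg b) (E_cvg a) e0.
by exists N => // n /= /hN; rewrite distrC.
Unshelve. all: end_near. Qed.

Lemma px_real a b : x (a, b) -> ⟨b, a⟩ = (rdot b a)%:C%C.
Proof.
move=> hab; rewrite hdotE; congr Complex.
have := px_sym px hab (pxZ px 'i%C hab); rewrite (rdotC a) rdot_i; lra.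
Qed.

Lemma spectral_measure_ex : exists P, is_spectral_measure x P.
Proof.
have ex (B : set (measurableTypeR R)) : exists Q : H -> H, measurable B ->
    projection Q /\ forall a, m a B = (rdot (Q a) a)%:E.
  have [mB|nB] := pselect (measurable B); last by exists id.
  by have [Q hQ] := hasproj_all px mB; exists Q.
have /choice[P hP] := ex; exists P; split.
- by move=> B /hP[].
- have [pT fT] := hP setT measurableT.
  apply/funext => a; apply/eqP; rewrite eq_sym -subr_eq0; apply/eqP/n2_eq0.
  have := fT a; rewrite spM_T projection_n2 // => -[h].
  by have := projection_split pT a; lra.
- move=> a; exists (m a); split.
  + by move=> B /hP[_ ->].
  + rewrite -int_gk; split=> [[[a' b] /= hab <-]|/sq_dom[b hb]].
      by apply: le_lt_trans (dom_sq hab) _; rewrite ltry.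
    by exists (a, b).
  + move=> b hab; rewrite (px_real hab) /Rintegral; congr (_%:C%C).
    have := form_int hab; rewrite int_gk => ->.
    by [].
Qed.

End spectral_measures.

(** * First and second moments of finite measures on the line *)

Section finite_measure_integrals.
Set Implicit Arguments.
Unset Strict Implicit.
Variables (R : realType) (m : {measure set (measurableTypeR R) -> \bar R}).
Implicit Types (a b : R).
Hypothesis mfin : (m setT < +oo)%E.
Local Notation idE := (fun l : measurableTypeR R => (l : R)%:E).
Local Notation sqE := (fun l : measurableTypeR R => ((l : R) ^+ 2)%:E).

Lemma id_meas (D : set (measurableTypeR R)) : measurable_fun D idE.
Proof. by apply/measurable_EFinP; exact: measurable_id. Qed.

Lemma sq_meas (D : set (measurableTypeR R)) : measurable_fun D sqE.
Proof. by apply/measurable_EFinP; apply: measurable_funX; exact: measurable_id. Qed.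

Lemma cst_integrable (c : R) : m.-integrable setT (fun=> c%:E).
Proof.
apply/integrableP; split; first exact: measurable_cst.
rewrite (_ : (fun=> `|c%:E|)%E = cst `|c|%:E) // integral_cst // -(@fineK _ (m setT)).
  by rewrite -EFinM ltry.
by rewrite ge0_fin_numE.
Qed.

Lemma sq_integrable : (\int[m]_l (sqE l) < +oo)%E -> m.-integrable setT idE.
Proof.
move=> h; have h2 : m.-integrable setT sqE.
  apply/integrableP; split; first exact: sq_meas.
  under eq_integral do rewrite gee0_abs ?lee_fin ?sqr_ge0 //.
  exact: h.
apply: (le_integrable measurableT _ _ (integrableD measurableT (cst_integrable 1) h2)).
  exact: id_meas.
move=> l _ /=; rewrite lee_fin [leRHS]ger0_norm ?addr_ge0 ?sqr_ge0 //.
rewrite ler_norml; apply/andP; split; have := sqr_ge0 (l + 1 :> R); have := sqr_ge0 (l - 1 :> R); nra.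
Qed.

Lemma int_lower (c : R) : m.-integrable setT idE -> m [set l | (l : R) < c] = 0 ->
  c * fine (m setT) <= fine (\int[m]_l idE l).
Proof.
move=> il m0; have ic := cst_integrable c.
have mT : m setT \is a fin_num by rewrite ge0_fin_numE.
have mS : measurable ([set l | (l : R) < c] : set (measurableTypeR R)).
  by rewrite -[X in measurable X]set_itvNyo; exact: mTR.
have E : (\int[m]_l (idE l - c%:E) = \int[m]_l `|idE l - c%:E|)%E.
  apply: ae_eq_integral => //.
  - exact: measurable_int (integrableB measurableT il ic).
  - by apply: measurableT_comp => //; exact: measurable_int (integrableB measurableT il ic).
  - exists [set l | (l : R) < c]; split=> // l /= hl; rewrite ltNge; apply/negP => cl.
    by apply: hl => _ /=; rewrite ger0_norm ?subr_ge0.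
have : (0 <= \int[m]_l (idE l - c%:E))%E by rewrite E; apply: integral_ge0.
rewrite integralB //.
have -> : (\int[m]_l c%:E = (c * fine (m setT))%:E)%E by rewrite integral_cst // EFinM fineK.
have f := integrable_fin_num measurableT il.
by rewrite -(fineK f) -EFinB lee_fin subr_ge0.
Qed.

Lemma int_upper (c : R) : m.-integrable setT idE -> m [set l | c < (l : R)] = 0 ->
  fine (\int[m]_l idE l) <= c * fine (m setT).
Proof.
move=> il m0; have ic := cst_integrable c.
have mT : m setT \is a fin_num by rewrite ge0_fin_numE.
have mS : measurable ([set l | c < (l : R)] : set (measurableTypeR R)).
  by rewrite -[X in measurable X]set_itvoy; exact: mTR.
have E : (\int[m]_l (c%:E - idE l) = \int[m]_l `|c%:E - idE l|)%E.
  apply: ae_eq_integral => //.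
  - exact: measurable_int (integrableB measurableT ic il).
  - by apply: measurableT_comp => //; exact: measurable_int (integrableB measurableT ic il).
  - exists [set l | c < (l : R)]; split=> // l /= hl; rewrite ltNge; apply/negP => cl.
    by apply: hl => _ /=; rewrite ger0_norm ?subr_ge0.
have : (0 <= \int[m]_l (c%:E - idE l))%E by rewrite E; apply: integral_ge0.
rewrite integralB //.
have -> : (\int[m]_l c%:E = (c * fine (m setT))%:E)%E by rewrite integral_cst // EFinM fineK.
have f := integrable_fin_num measurableT il.
by rewrite -(fineK f) -EFinB lee_fin subr_ge0.
Qed.

Lemma sq_upper (c : R) : m [set l | c < `|l : R|] = 0 -> (\int[m]_l (sqE l) < +oo)%E.
Proof.
move=> m0.
have mS : measurable ([set l | c < `|l : R|] : set (measurableTypeR R)).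
  rewrite [X in measurable X](_ : _ = `]-oo, (- c)[%classic `|` `]c, +oo[%classic).
    by apply: measurableU; exact: mTR.
  apply/seteqP; split=> l /=; rewrite !in_itv /= andbT lter_normr.
    by case/orP => h; [right|left; rewrite ltrNr].
  by case=> h; rewrite ?h // ltrNr h orbT.
have -> : (\int[m]_l (sqE l) = \int[m]_l (Num.min (l ^+ 2) (c ^+ 2))%:E)%E.
  apply: ae_eq_integral => //.
  - exact: sq_meas.
  - apply/measurable_EFinP; apply: measurable_minr; last exact: measurable_cst.
    by apply: measurable_funX; exact: measurable_id.
  - exists [set l | c < `|l : R|]; split=> // l /= hl; rewrite ltNge; apply/negP => cl.
    apply: hl => _; congr EFin; rewrite min_l //.
    by rewrite -(real_normK (num_real (l : R))) lerXn2r ?nnegrE ?normr_ge0 // (le_trans (normr_ge0 _) cl).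
apply: (@le_lt_trans _ _ (\int[m]_l (c ^+ 2)%:E)%E); last first.
  rewrite integral_cst // -(@fineK _ (m setT)) ?ge0_fin_numE // -EFinM ltry //.
apply: ge0_le_integral => //.
- by move=> l _; rewrite lee_fin le_min !sqr_ge0.
- apply/measurable_EFinP; apply: measurable_minr; last exact: measurable_cst.
  by apply: measurable_funX; exact: measurable_id.
- by move=> l _; rewrite lee_fin ge_min lexx orbT.
Qed.

End finite_measure_integrals.

(** * Uniqueness of the spectral measure on half-lines *)

Section uniqueness.
Set Implicit Arguments.
Unset Strict Implicit.
Variables (R : realType) (H : hilbertSpace R).
Implicit Types (a b c d : H).

Lemma sym_form_eq (f g : H -> H) : linear f -> linear g -> hsym f -> hsym g ->
  (forall a, rdot (f a) a = rdot (g a) a) -> f =1 g.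
Proof.
move=> lf lg sf sg h a; apply/eqP; rewrite -subr_eq0; apply/eqP/n2_eq0.
have key d : rdot (f a) d = rdot (g a) d.
  have := h (a + d); have := h a; have := h d.
  rewrite !(linD lf) !(linD lg) !(rdotDl, rdotDr) (sf d a) (sg d a) (rdotC d) (rdotC d (g a)).
  by lra.
by rewrite /n2 rdotBl key subrr.
Qed.

Variables (h : set (H * H)) (ph : positive_op h) (Q : set R -> H -> H).
Hypothesis sQ : is_spectral_measure h Q.

Local Notation measT B := (measurable (B : set (measurableTypeR R))).

Let pQ B : measT B -> projection (Q B).
Proof. by case: sQ => + _ _; apply. Qed.

Let mex a : exists m : {measure set (measurableTypeR R) -> \bar R},
  [/\ (forall B, measT B -> m B = (n2 (Q B a))%:E),
      (op_dom h a <-> (\int[m]_l (l ^+ 2)%:E < +oo)%E) &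
      forall b : H, h (a, b) -> rdot b a = fine (\int[m]_l l%:E)%E].
Proof.
case: sQ => _ _ /(_ a)[m [h1 h2 h3]]; exists m; split=> //.
  by move=> B mB; rewrite h1 // -projection_n2 //; exact: pQ.
by move=> b /h3; rewrite hdotE => -[].
Qed.

Let QT a : Q setT a = a.
Proof. by case: sQ => _ -> _. Qed.

Let Qlin B : measT B -> linear (Q B).
Proof. by move=> mB; exact: projection_lin (pQ mB). Qed.
Let Qsym B : measT B -> hsym (Q B).
Proof. by move=> mB; exact: projection_sym (pQ mB). Qed.
Let QQ B a : measT B -> Q B (Q B a) = Q B a.
Proof. by move=> mB; exact: projectionI (pQ mB) a. Qed.

Let Q_le B C a : measT B -> measT C -> B `<=` C -> n2 (Q B a) <= n2 (Q C a).
Proof.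
move=> mB mC BC; have [m [hm _ _]] := mex a.
by rewrite -lee_fin -!hm //; apply: le_measure; rewrite ?inE.
Qed.

Let Q_U B C a : measT B -> measT C -> B `&` C = set0 ->
  Q (B `|` C) a = Q B a + Q C a.
Proof.
move=> mB mC BC.
have mU : measT (B `|` C) by exact: measurableU.
have bB := projection_bop (pQ mB); have bC := projection_bop (pQ mC).
apply: (sym_form_eq (Qlin mU) (bop_lin (bop_add bB bC)) (Qsym mU)) => [c d|c].
  by rewrite /= rdotDl rdotDr !Qsym.
rewrite /= rdotDl !projection_n2; try exact: pQ.
have [m [hm _ _]] := mex c; apply: EFin_inj; rewrite EFinD -!hm //.
by rewrite measureU.
Qed.

Let Q_disj B C a : measT B -> measT C -> B `&` C = set0 -> Q B (Q C a) = 0.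
Proof.
move=> mB mC BC; have mU : measT (B `|` C) by exact: measurableU.
have := Q_le (Q C a) mU measurableT (@subsetT _ _).
rewrite QT Q_U // QQ // n2D => le.
apply: n2_eq0; have := n2_ge0 (Q B (Q C a)).
rewrite -projection_n2 in le *; last exact: pQ.
have e : rdot (Q B (Q C a)) (Q C a) = n2 (Q B (Q C a)) by rewrite projection_n2 //; exact: pQ.
by rewrite e in le *; lra.
Qed.

(** Multiplicativity is not part of [is_spectral_measure]. Disjoint sets have orthogonal projections
    because total masses are bounded by [n2 a]; the general case splits [B] and [C] along their
    intersection. *)
Let Q_I B C a : measT B -> measT C -> Q C (Q B a) = Q (B `&` C) a.
Proof.
move=> mB mC; have mI : measT (B `&` C) by exact: measurableI.
have mD : measT (B `\` C) by exact: measurableD.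
have mD' : measT (C `\` B) by exact: measurableD.
have eB : B = (B `&` C) `|` (B `\` C) by rewrite setUIDK.
have eC : C = (B `&` C) `|` (C `\` B) by rewrite setIC setUIDK.
have d1 : (B `&` C) `&` (B `\` C) = set0 by apply/seteqP; split=> // z [[_ ?] [_ ?]].
have d2 : C `&` (B `\` C) = set0 by apply/seteqP; split=> // z [? [_ ?]].
have d3 : (C `\` B) `&` (B `&` C) = set0 by apply/seteqP; split=> // z [[_ ?] [? ?]].
have d4 : (B `&` C) `&` (C `\` B) = set0 by apply/seteqP; split=> // z [[? _] [_ ?]].
have hB c : Q B c = Q (B `&` C) c + Q (B `\` C) c by rewrite {1}eB Q_U.
have hC c : Q C c = Q (B `&` C) c + Q (C `\` B) c by rewrite {1}eC Q_U.
rewrite hB (linD (Qlin mC)) (Q_disj _ mC mD d2) addr0 hC QQ //.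
by rewrite (Q_disj _ mD' mI d3) addr0.
Qed.

Let Q_C B a : measT B -> Q (~` B) a = a - Q B a.
Proof.
move=> mB; have mC : measT (~` B) by exact: measurableC.
have := @Q_U B (~` B) a mB mC (setICr B).
by rewrite setUv QT => e; apply/eqP; rewrite eq_sym subr_eq addrC; apply/eqP.
Qed.

Let Q_comm B C a : measT B -> measT C -> Q C (Q B a) = Q B (Q C a).
Proof. by move=> mB mC; rewrite !Q_I // setIC. Qed.

Let dom_int a b (m : {measure set (measurableTypeR R) -> \bar R}) : h (a, b) ->
  (op_dom h a <-> (\int[m]_l (l ^+ 2)%:E < +oo)%E) -> (\int[m]_l (l ^+ 2)%:E < +oo)%E.
Proof. by move=> hab [+ _]; apply; exists (a, b). Qed.

Let Q_split B a : measT B -> forall (m m1 m2 : {measure set (measurableTypeR R) -> \bar R}),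
  (forall C, measT C -> m C = (n2 (Q C a))%:E) ->
  (forall C, measT C -> m1 C = (n2 (Q C (Q B a)))%:E) ->
  (forall C, measT C -> m2 C = (n2 (Q C (Q (~` B) a)))%:E) ->
  forall C, measT C -> m C = measure_add m1 m2 C.
Proof.
move=> mB m m1 m2 hm h1 h2 C mC; have mB' : measT (~` B) by exact: measurableC.
rewrite measure_addE hm // h1 // h2 // -EFinD; congr EFin.
rewrite !(Q_comm _ _ mC) // Q_C //.
exact: projection_split (pQ mB) (Q C a).
Qed.

Let Q_dom B a b : measT B -> h (a, b) -> exists b1, h (Q B a, b1).
Proof.
move=> mB hab; have mB' : measT (~` B) by exact: measurableC.
have [m [hm dm _]] := mex a; have [m1 [hm1 dm1 _]] := mex (Q B a).
have [m2 [hm2 _ _]] := mex (Q (~` B) a).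
have := dom_int hab dm; rewrite (eq_measure_integral (measure_add m1 m2)); last first.
  by move=> C mC _; exact: Q_split hm hm1 hm2 _ mC.
rewrite ge0_integral_measure_add //; last exact: sq_meas.
- move=> fin; have : op_dom h (Q B a).
    apply/dm1; apply: le_lt_trans fin; rewrite leeDl //.
    by apply: integral_ge0 => l _; rewrite lee_fin sqr_ge0.
  by move=> [[a' b1] /= h1 e]; exists b1; rewrite -e.
- by move=> l _; rewrite lee_fin sqr_ge0.
Qed.

Let mfinT a (m : {measure set (measurableTypeR R) -> \bar R}) :
  (forall C, measT C -> m C = (n2 (Q C a))%:E) -> (m setT < +oo)%E.
Proof. by move=> ->; rewrite ?ltry. Qed.

Let Q_form B a b b1 b2 : measT B -> h (a, b) -> h (Q B a, b1) -> h (Q (~` B) a, b2) ->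
  rdot b a = rdot b1 (Q B a) + rdot b2 (Q (~` B) a).
Proof.
move=> mB hab h1 h2; have mB' : measT (~` B) by exact: measurableC.
have [m [hm dm fm]] := mex a; have [m1 [hm1 dm1 fm1]] := mex (Q B a).
have [m2 [hm2 dm2 fm2]] := mex (Q (~` B) a).
have i1 := sq_integrable (mfinT hm1) (dom_int h1 dm1).
have i2 := sq_integrable (mfinT hm2) (dom_int h2 dm2).
rewrite (fm _ hab) (fm1 _ h1) (fm2 _ h2) -fineD; last 2 first.
  exact: (integrable_fin_num measurableT i1).
  exact: (integrable_fin_num measurableT i2).
rewrite (eq_measure_integral (measure_add m1 m2)); last first.
  by move=> C mC _; exact: Q_split hm hm1 hm2 _ mC.
by rewrite integral_measure_add //; exact: id_meas.
Qed.

(** Polarisation: the integral formula only concerns diagonal terms, but [Q_form] at [a + c] kills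
    the sum of the two cross terms, which are equal by symmetry of [h]. *)
Let Q_cross B a b c d : measT B -> h (a, b) -> h (c, d) -> Q B a = a -> Q B c = 0 ->
  rdot b c = 0.
Proof.
move=> mB hab hcd Qa Qc.
have hs := pxD ph hab hcd.
have e1 : Q B (a + c) = a by rewrite (linD (Qlin mB)) Qa Qc addr0.
have e2 : Q (~` B) (a + c) = c by rewrite Q_C // e1 addrC addKr.
have := @Q_form B (a + c) (b + d) b d mB hs; rewrite e1 e2 => /(_ hab hcd).
rewrite !(rdotDl, rdotDr) (px_sym ph hcd hab) (rdotC c); lra.
Qed.

Let Q_red B a b : measT B -> h (a, b) -> h (Q B a, Q B b).
Proof.
move=> mB hab; have mB' : measT (~` B) by exact: measurableC.
have [b1 h1] := Q_dom mB hab; have [b2 h2] := Q_dom mB' hab.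
have Qb1 : Q (~` B) b1 = 0.
  apply: (px_perp ph) => c d hcd; rewrite rdotC Qsym //.
  have [d' h'] := Q_dom mB' hcd.
  apply: (Q_cross mB h1 h'); first exact: QQ.
  by rewrite Q_disj // setICr.
have Qb2 : Q B b2 = 0.
  apply: (px_perp ph) => c d hcd; rewrite rdotC Qsym //.
  have [d' h'] := Q_dom mB hcd.
  apply: (Q_cross mB' h2 h'); first exact: QQ.
  by rewrite Q_disj // setICl.
have : h (a, b1 + b2).
  by have := pxD ph h1 h2; rewrite Q_C // addrC subrK.
move=> /(px_fun ph hab) ->; rewrite (linD (Qlin mB)) Qb2 addr0.
by move/eqP : Qb1; rewrite Q_C // subr_eq0 => /eqP <-.
Qed.

Let Q_lower B (v : R) a b : measT B -> (forall l, B l -> v <= l) -> h (a, b) -> Q B a = a ->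
  v * n2 a <= rdot b a.
Proof.
move=> mB hB hab Qa; have [m [hm dm fm]] := mex a.
have i := sq_integrable (mfinT hm) (dom_int hab dm).
have mN : measT [set l | l < v] by rewrite -set_itvNyo; exact: mTR.
have := int_lower (mfinT hm) i; rewrite (fm _ hab) hm // QT /=; apply.
rewrite hm // -Qa Q_disj ?n20 //.
by apply/seteqP; split=> // l /= [lv /hB vl]; have := lt_le_trans lv vl; rewrite ltxx.
Qed.

Let Q_upper B (v : R) a b : measT B -> (forall l, B l -> l <= v) -> h (a, b) -> Q B a = a ->
  rdot b a <= v * n2 a.
Proof.
move=> mB hB hab Qa; have [m [hm dm fm]] := mex a.
have i := sq_integrable (mfinT hm) (dom_int hab dm).
have mN : measT [set l | v < l] by rewrite -set_itvoy; exact: mTR.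
have := int_upper (mfinT hm) i; rewrite (fm _ hab) hm // QT /=; apply.
rewrite hm // -Qa Q_disj ?n20 //.
by apply/seteqP; split=> // l /= [lv /hB vl]; have := lt_le_trans lv vl; rewrite ltxx.
Qed.

Let Q_bdd B (v : R) a : measT B -> (forall l, B l -> `|l| <= v) -> Q B a = a -> exists b, h (a, b).
Proof.
move=> mB hB Qa; have [m [hm dm fm]] := mex a.
have mN : measT [set l | v < `|l|].
  rewrite (_ : [set l | v < `|l|] = `]-oo, (- v)[%classic `|` `]v, +oo[%classic).
    by apply: measurableU; exact: mTR.
  apply/seteqP; split=> l /=; rewrite !in_itv /= andbT lter_normr.
    by case/orP => h'; [right|left; rewrite ltrNr].
  by case=> h'; rewrite ?h' // ltrNr h' orbT.
have : op_dom h a.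
  apply/dm; apply: (sq_upper (mfinT hm) (c := v)).
  rewrite hm // -Qa Q_disj ?n20 //.
  by apply/seteqP; split=> // l /= [lv /hB vl]; have := lt_le_trans lv vl; rewrite ltxx.
by move=> [[a' b] /= hab <-]; exists b.
Qed.

Let Q_lim0 (U : nat -> set R) a : (forall n, measT (U n)) ->
  {homo U : m n / (m <= n)%N >-> m `<=` n} -> (forall n, Q (U n) a = 0) ->
  Q (\bigcup_n U n) a = 0.
Proof.
move=> mU ndU Q0; have [m [hm _ _]] := mex a.
have mB : measT (\bigcup_n U n) by apply: bigcup_measurable => n _.
suff : m (\bigcup_n U n) = 0 by rewrite hm // => -[] /n2_eq0.
have hl : (m \o U) @ \oo --> (0 : \bar R).
  rewrite [X in X @ _](_ : _ = fun=> 0); first exact: cvg_cst.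
  by apply/funext => n /=; rewrite hm // Q0 n20.
apply/esym/(cvg_unique (@ereal_hausdorff R) hl).
by apply: nondecreasing_cvg_mu => // i j ij; apply/subsetPset; exact: ndU.
Qed.

(** On the bands [](- n.+1), - 1 / n.+1]] the form of [h] would be negative, against positivity. *)
Let Q_neg a : Q `]-oo, 0[%classic a = 0.
Proof.
have cov : `]-oo, 0[%classic = \bigcup_(n : nat) `](- n.+1%:R), (- n.+1%:R^-1)]%classic :> set R.
  apply/seteqP; split=> [z /= | z [n _]] /=; rewrite !in_itv /=.
    move=> z0; have z1 : 0 < - z by rewrite oppr_gt0.
    exists (maxn (Num.truncn (- z)) (Num.truncn (- z)^-1)) => //=; rewrite in_itv /=.
    apply/andP; split.
      rewrite ltrNl; apply: lt_le_trans (truncnS_gt _) _.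
      by rewrite ler_nat ltnS leq_maxl.
    rewrite lerNr -[leRHS]invrK lef_pV2 ?posrE ?invr_gt0 ?ltr0n //.
    by apply: ltW; apply: lt_le_trans (truncnS_gt _) _; rewrite ler_nat ltnS leq_maxr.
  by move=> /andP[_ h']; apply: le_lt_trans h' _; rewrite oppr_lt0 invr_gt0 ltr0n.
rewrite cov; apply: Q_lim0 => [n|p n pn|n].
- exact: mTR.
- move=> z /=; rewrite !in_itv /= => /andP[h1 h2]; apply/andP; split.
    by apply: le_lt_trans h1; rewrite lerN2 ler_nat ltnS.
  by apply: (le_trans h2); rewrite lerN2 lef_pV2 ?posrE ?ltr0n // ler_nat ltnS.
- set B := `]_, _]%classic; have mB : measT B by exact: mTR.
  have n0 : 0 < n.+1%:R^-1 :> R by rewrite invr_gt0 ltr0n.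
  have [|b hb] := @Q_bdd B n.+1%:R (Q B a) mB _ (QQ a mB).
    move=> l; rewrite /B /= in_itv /= ler_norml => /andP[/ltW -> h2] /=.
    by apply: (le_trans h2); apply: (@le_trans _ _ 0); rewrite ?oppr_le0 ?ltW // ltr0n.
  have := @Q_upper B (- n.+1%:R^-1) (Q B a) b mB _ hb (QQ a mB).
  have h1 l : B l -> l <= - n.+1%:R^-1 by rewrite /B /= in_itv /= => /andP[].
  move=> /(_ h1); have := px_ge0 ph hb => h2 h3.
  apply: n2_eq0; apply/eqP; rewrite eq_le n2_ge0 andbT -(pmulr_rle0 _ n0) -oppr_ge0 -mulNr.
  exact: le_trans h2 h3.
Qed.

(** On the range of this projection [h] is everywhere defined, and the composite [f] is symmetric
    with [0 <= f <= v], so that [|f a|^2 <= v rdot (f a) a <= v^2 |a|^2]. *)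
Lemma spectral_fix v : 0 <= v -> fixp (Q `]-oo, v]%classic) `<=` spV h v.
Proof.
move=> v0; set L := `]-oo, v]%classic; have mL : measT L by exact: mTR.
have Qpos a : Q L a = a -> Q `[0, v]%classic a = a.
  move=> Qa; have : Q (`]-oo, 0[%classic `|` `[0, v]%classic) a = a.
    rewrite -[RHS]Qa; congr (Q _ a); apply/seteqP; split=> [z [|]|z] /=; rewrite !in_itv /=.
    - by move=> /ltW/le_trans; exact.
    - by case/andP.
    - by move=> zv; case: (ltP z 0) => h'; [left|right].
  rewrite Q_U; [by rewrite Q_neg add0r|exact: mTR|exact: mTR|].
  by apply/seteqP; split=> // z [] /=; rewrite !in_itv /= => z0 /andP[z1 _]; have := lt_le_trans z0 z1; rewrite ltxx.
have dom a : Q L a = a -> exists b, h (a, b).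
  move=> /Qpos; apply: (@Q_bdd _ v); first exact: mTR.
  by move=> l /=; rewrite in_itv /= => /andP[l0 lv]; rewrite ger0_norm.
have /choice[f hf] : forall a, exists b, h (Q L a, b) by move=> a; apply: dom; exact: QQ.
have lf : linear f.
  move=> k a b; have := hf (k *: a + b); rewrite (Qlin mL).
  by move=> h1; apply: (px_fun ph h1); exact: pxl ph k _ _ (hf a) (hf b).
have Qf a : Q L (f a) = f a.
  by have := Q_red mL (hf a); rewrite QQ // => h1; rewrite (px_fun ph h1 (hf a)).
have sf : hsym f.
  by move=> a b; rewrite -(Qf a) Qsym // (px_sym ph (hf a) (hf b)) Qsym // Qf.
have fform a : rdot (f a) a = rdot (f a) (Q L a) by rewrite -Qsym // Qf.
apply: spV_chain => a /= Qa; exists (f a); split; [by have := hf a; rewrite Qa|exact: Qf|].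
have up c : rdot (f c) c <= v * n2 c.
  rewrite fform; apply: (@le_trans _ _ (v * n2 (Q L c))).
    apply: (Q_upper mL _ (hf c) (QQ _ mL)) => l; by rewrite /L /= in_itv.
  by rewrite ler_wpM2l //; have := projection_split (pQ mL) c; have := n2_ge0 (c - Q L c); lra.
have := pos_CS a lf sf _ up; rewrite expr2 -mulrA => h1.
apply: le_trans (h1 _) _; last by rewrite ler_wpM2l // up.
by move=> c; rewrite fform; exact: (px_ge0 ph (hf c)).
Qed.

(** The part of [a] over []v + 1 / n.+1, +oo[] stays in [spV h v], since [Q] commutes with [h].
    There the form is both at most [v] and at least [v + 1 / n.+1], so this part is 0. *)
Lemma spectral_above v a : 0 <= v -> spV h v a -> Q `]v, +oo[%classic a = 0.
Proof.
move=> v0 Va.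
have cov : `]v, +oo[%classic = \bigcup_(n : nat) `](v + n.+1%:R^-1), +oo[%classic :> set R.
  apply/seteqP; split=> [z /= | z [n _]] /=; rewrite !in_itv /= !andbT.
    move=> vz; exists (Num.truncn (z - v)^-1).+1 => //=; rewrite in_itv /= andbT.
    rewrite -ltrBrDl -[ltRHS]invrK ltf_pV2 ?posrE ?invr_gt0 ?subr_gt0 ?ltr0n //.
    by apply: lt_trans (truncnS_gt _) _; rewrite ltr_nat.
  by apply: lt_trans; rewrite ltrDl invr_gt0 ltr0n.
rewrite cov; apply: Q_lim0 => [n|p n pn|n].
- exact: mTR.
- move=> z /=; rewrite !in_itv /= !andbT; apply: le_lt_trans.
  by rewrite lerD2l lef_pV2 ?posrE ?ltr0n // ler_nat ltnS.
- set B := `](v + n.+1%:R^-1), +oo[%classic; have mB : measT B by exact: mTR.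
  have n0 : 0 < n.+1%:R^-1 :> R by rewrite invr_gt0 ltr0n.
  have VQ : spV h v (Q B a).
    apply: (spV_inv _ _ Va); first exact: projection_bop (pQ mB).
    by move=> c d; exact: Q_red.
  have [b [hb _ _]] := spV_step ph VQ.
  have h1 := spV_form ph v0 VQ hb.
  have h2 : (v + n.+1%:R^-1) * n2 (Q B a) <= rdot b (Q B a).
    apply: (Q_lower mB _ hb (QQ _ mB)) => l; rewrite /B /= in_itv /= andbT; exact: ltW.
  apply: n2_eq0; apply/eqP; rewrite eq_le n2_ge0 andbT -(pmulr_rle0 _ n0).
  by rewrite -(lerD2l (v * n2 (Q B a))) -mulrDl addr0; exact: le_trans h2 h1.
Qed.

Lemma spectral_measure_above v a : 0 <= v -> Q `]v, +oo[%classic a = a - spE h v a.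
Proof.
move=> v0; set L := `]-oo, v]%classic; have mL : measT L by exact: mTR.
have mU : measT `]v, +oo[%classic by exact: mTR.
have UE : `]v, +oo[%classic = ~` L.
  by apply/seteqP; split=> z /=; rewrite !in_itv /= andbT ltNge => /negP.
have LE : Q L = spE h v.
  rewrite -(pr_fixp (pQ mL)) /spE; congr pr; apply/seteqP; split; first exact: spectral_fix.
  move=> c Vc; rewrite /fixp /=; have := spectral_above v0 Vc.
  by rewrite UE Q_C // => /eqP; rewrite subr_eq0 => /eqP <-.
by rewrite UE Q_C // LE.
Qed.

End uniqueness.

(** Both choices made by [get] are resolved here: a positive [x] is itself a witness for [op_abs x],
    whichever one is chosen has the spectral subspaces of [x] by [spV_sq], and any spectral measure
    takes the same value on []v, +oo[]. *)
Lemma op_distrE (R : realType) (H : hilbertSpace R) (tau : (H -> H) -> \bar R)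
  (x : set (H * H)) (v : R) : positive_op x -> 0 <= v ->
  op_distr tau x v = tau (id \- spE x v).
Proof.
move=> px v0; rewrite /op_distr.
have px2 := px; case: px2 => _ xs _.
have [ph hh] : positive_op (op_abs x) /\
    (op_abs x \; op_abs x)%relation = (op_adj x \; x)%relation.
  exact: (@getI _ [set h | positive_op h /\ (h \; h)%relation = (op_adj x \; x)%relation] x (conj px (congr1 (fun y => (y \; x)%relation) (esym xs)))).
rewrite xs in hh.
have [P hP] := spectral_measure_ex ph.
have hQ : is_spectral_measure (op_abs x) (spectral_measure (op_abs x)) := getI hP.
congr tau; apply/funext => a; rewrite (spectral_measure_above ph hQ) //=.
congr (_ - pr _ _); apply/seteqP; split; first exact: (spV_sq ph px).
exact: (spV_sq px ph).
Qed.

(** * Traces of projections and singular values *)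

Section von_Neumann.
Set Implicit Arguments.
Unset Strict Implicit.
Variables (R : realType) (H : hilbertSpace R).
Variables (M : set (H -> H)) (vM : von_Neumann_algebra M).
Implicit Types (a b c d : H) (f g u e p q : H -> H).

Lemma M_bop f : M f -> bounded_op f. Proof. by case: vM => + _ _; apply. Qed.

Lemma M_comm f u : M f -> commutant M u -> forall a, f (u a) = u (f a).
Proof. by move=> Mf [_ /(_ _ Mf)] h a; have := congr1 (fun k => k a) h. Qed.

Lemma M_in f : bounded_op f -> (forall u, commutant M u -> forall a, f (u a) = u (f a)) -> M f.
Proof.
move=> bf h; have [_ _ e] := vM; rewrite -e; split=> // u hu.
by apply/funext => a /=; exact: h.
Qed.

Lemma com_bop u : commutant M u -> bounded_op u. Proof. by case. Qed.
Lemma com_lin u : commutant M u -> linear u. Proof. by move=> /com_bop/bop_lin. Qed.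

Lemma M_id : M id. Proof. by apply: M_in => //; exact: bop_id. Qed.
Lemma M_comp f g : M f -> M g -> M (f \o g).
Proof.
move=> Mf Mg; apply: M_in => [|u hu a]; first exact: bop_comp (M_bop Mf) (M_bop Mg).
by rewrite /= (M_comm Mg hu) (M_comm Mf hu).
Qed.
Lemma M_add f g : M f -> M g -> M (f \+ g).
Proof.
move=> Mf Mg; apply: M_in => [|u hu a]; first exact: bop_add (M_bop Mf) (M_bop Mg).
by rewrite /= (M_comm Mg hu) (M_comm Mf hu) (linD (com_lin hu)).
Qed.
Lemma M_sub f g : M f -> M g -> M (f \- g).
Proof.
move=> Mf Mg; apply: M_in => [|u hu a]; first exact: bop_sub (M_bop Mf) (M_bop Mg).
by rewrite /= (M_comm Mg hu) (M_comm Mf hu) (linB (com_lin hu)).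
Qed.
Lemma M_0 : M (fun=> 0).
Proof.
apply: M_in => [|u hu a]; first exact: bop0.
by rewrite (lin0 (com_lin hu)).
Qed.
Lemma M_iter n f : M f -> M (iter n f).
Proof. by move=> Mf; elim: n => [|n IH]; [exact: M_id|exact: (M_comp Mf IH)]. Qed.

Lemma adj_sym f g : adjoint_pair f g -> adjoint_pair g f.
Proof. by move=> h a b; rewrite hdotC -h -hdotC. Qed.

Lemma com_adj u : commutant M u -> exists2 g, commutant M g & adjoint_pair u g.
Proof.
move=> hu; have [g bg ug] := adjoint_ex (com_bop hu); exists g => //; split=> // m Mm.
case: vM => _ /(_ _ Mm)[m' Mm' mm'] _.
apply/funext => b /=; apply/eqP; rewrite -subr_eq0; apply/eqP/n2_eq0.
set d := _ - _; rewrite /n2 /rdot.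
have -> : ⟨d, d⟩ = ⟨d, g (m b)⟩ - ⟨d, m (g b)⟩ by rewrite -linearBr.
have e1 := ug d (m b); have e2 := adj_sym mm' d (g b); have e3 := ug (m' d) b.
have e4 := adj_sym mm' (u d) b.
by rewrite -e1 -e2 -e3 -e4 (M_comm Mm' hu) subrr.
Qed.

(** The commutant is stable under adjoints, so its elements commute with [pr V], which therefore
    lies in the bicommutant. *)
Lemma M_pr V : csubspace V -> (forall u, commutant M u -> forall a, V a -> V (u a)) -> M (pr V).
Proof.
move=> sV h; apply: M_in => [|u hu a]; first exact: pr_bop.
have [g hg ug] := com_adj hu.
have := comm_pr sV (com_bop hu) (com_bop hg) ug (h _ hu) (h _ hg).
by move=> /(congr1 (fun k => k a)) /= ->.
Qed.

Lemma vN_posI f : M f -> hsym f -> (forall a, 0 <= rdot (f a) a) -> vN_pos M f.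
Proof. by move=> Mf sf f0; split; [exact: Mf|exact: ((pos_boundedP (M_bop Mf) sf).2 f0)]. Qed.

Lemma vN_pos_proj p : M p -> projection p -> vN_pos M p.
Proof. by move=> Mp pp; split=> //; exact: projection_pos. Qed.

Lemma pos_diff f g : pos_bounded f -> pos_bounded g ->
  (forall a, rdot (g a) a <= rdot (f a) a) -> pos_bounded (f \- g).
Proof.
move=> [bf pf] [bg pg] h; split; first exact: bop_sub.
move=> a; have := pf a; have := pg a; rewrite /= !hdotE !lecE /= !rdotBl.
by move=> /andP[/eqP -> _] /andP[/eqP -> _]; rewrite subr0 eqxx subr_ge0 /=.
Qed.

Variables (tau : (H -> H) -> \bar R) (tr : normal_semifinite_faithful_trace M tau).

Lemma tau_mono f g : vN_pos M f -> vN_pos M g ->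
  (forall a, rdot (f a) a <= rdot (g a) a) -> (tau f <= tau g)%E.
Proof.
move=> hf hg h; have hd : vN_pos M (g \- f).
  by split; [exact: M_sub hg.1 hf.1|exact: pos_diff hg.2 hf.2 h].
have -> : g = f \+ (g \- f) by apply/funext => a /=; rewrite addrC subrK.
by rewrite (tr_add tr) // leeDl // (tr_ge0 tr).
Qed.

Lemma tau_0 : tau (fun=> 0) = 0.
Proof.
have h0 : vN_pos M (fun=> 0).
  by apply: vN_posI => [|a b|a]; rewrite ?rdot0l ?rdot0r //; exact: M_0.
have := tr_homo tr (lexx 0) h0; rewrite mul0e => <-.
by congr tau; apply/funext => a /=; rewrite scaler0.
Qed.

Section comparison.
Variables (p q : H -> H) (Mp : M p) (Mq : M q) (pp : projection p) (pq : projection q).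
Hypothesis hpq : forall a, p a = a -> q a = 0 -> a = 0.

Let lp := projection_lin pp.
Let lq := projection_lin pq.
Let sp := projection_sym pp.
Let sq := projection_sym pq.
Let pI := projectionI pp.
Let qI := projectionI pq.

Lemma sqrt_compl (s t : H -> H) : M s -> M t -> projection s -> projection t ->
  exists r, [/\ M r, hsym r, forall a, 0 <= rdot (r a) a & forall a, r (r a) = a - s (t (s a))].
Proof.
move=> Ms Mt ps pt.
have ss := projection_sym ps; have st := projection_sym pt.
have Mc : M (s \o (t \o s)) by apply: M_comp => //; exact: M_comp.
have [||||r [br sr r0 r2 rc]] := @sqrt_one_minus _ _ (s \o (t \o s)).
- exact: M_bop.
- by move=> a b; rewrite /= ss st ss.
- by move=> a; rewrite /= ss projection_n2 // n2_ge0.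
- move=> a; rewrite /= ss projection_n2 //.
  have := projection_split pt (s a); have := projection_split ps a.
  by have := n2_ge0 (s a - t (s a)); have := n2_ge0 (a - s a); lra.
exists r; split=> //; apply: M_in => // u hu a.
by rewrite rc //; [exact: com_bop hu|move=> b; rewrite -(M_comm Mc hu)].
Qed.

(* The positive elements z_n^* z_n, with z_n = r^n q p and r^2 = 1 - q p q,
   telescope to p - (1 - p q p)^n p, which increases to p; the elements
   z_n z_n^* telescope to an operator below q and have the same traces. *)
Lemma tau_compare : (tau p <= tau q)%E.
Proof.
have [r [Mr sr r0 r2]] := sqrt_compl Mq Mp pq pp.
have [w [Mw sw w0 w2]] := sqrt_compl Mp Mq pp pq.
pose z n := iter n r \o (q \o p).
pose zs n := p \o (q \o iter n r).
have Mz n : M (z n) by apply: M_comp; [exact: M_iter|exact: M_comp].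
have Mzs n : M (zs n) by apply: M_comp => //; apply: M_comp => //; exact: M_iter.
have siter (f : H -> H) n : hsym f -> hsym (iter n f).
  by move=> sf; elim: n => [//|n IH a b]; rewrite iterSr IH sf.
have zadj n a b : rdot (z n a) b = rdot a (zs n b).
  by rewrite /z /zs /= (siter _ _ sr) sq sp.
have zadjP n : adjoint_pair (z n) (zs n).
  by apply/adjP; [exact: bop_lin (M_bop (Mz n))|exact: bop_lin (M_bop (Mzs n))|exact: zadj].
pose G := fix G n := if n is m.+1 then G m \+ (zs m \o z m) else (fun=> 0).
pose F := fix F n := if n is m.+1 then F m \+ (z m \o zs m) else (fun=> 0).
have h0 : vN_pos M (fun=> 0).
  by apply: vN_posI => [|a b|a]; rewrite ?rdot0l ?rdot0r //; exact: M_0.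
have pzz n : vN_pos M (zs n \o z n).
  apply: vN_posI => [|a b|a]; first exact: M_comp.
    by rewrite /= -zadj (rdotC (zs n _)) -zadj rdotC.
  by rewrite /= rdotC -zadj n2_ge0.
have pzz' n : vN_pos M (z n \o zs n).
  apply: vN_posI => [|a b|a]; first exact: M_comp.
    by rewrite /= zadj [RHS]rdotC zadj rdotC.
  by rewrite /= zadj n2_ge0.
have padd f g : vN_pos M f -> vN_pos M g -> vN_pos M (f \+ g).
  move=> hf hg; split; first exact: M_add hf.1 hg.1.
  split; first exact: bop_add (M_bop hf.1) (M_bop hg.1).
  by move=> a; rewrite /= linearDl addr_ge0 //; [exact: hf.2.2|exact: hg.2.2].
have pG n : vN_pos M (G n) by elim: n => //= n IH; exact: padd.
have pF n : vN_pos M (F n) by elim: n => //= n IH; exact: padd.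
have tGF n : tau (G n) = tau (F n).
  elim: n => //= n IH; rewrite (tr_add tr) // (tr_add tr) // IH; congr (_ + _)%E.
  exact: (tr_trace tr).
pose D a := a - p (q (p a)).
have lD : linear D.
  move=> k a b; rewrite /D lp lq lp scalerBr opprD addrACA //.
have wD n a : iter n D a = iter n.*2 w a.
  by elim: n => //= n ->; rewrite w2.
have rd n a : iter n r (iter n r a) = iter n (fun a => a - q (p (q a))) a.
  rewrite -iterD addnn; elim: n => //= n ->; by rewrite r2.
have GE n a : G n a = p a - iter n D (p a).
  elim: n => [|n IH]; first by rewrite /= subrr.
  have key m c : iter m D (p (q c)) = p (q (iter m (fun a => a - q (p (q a))) c)).
    by elim: m => //= m ->; rewrite /D (linB lq) (linB lp) qI pI.
  rewrite /= IH /zs /z /= rd -key qI.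
  have liter : linear (iter n D) by elim: (n) => [//|m IH' k c d]; rewrite !iterS IH' lD.
  have Dp : D (p a) = p a - p (q (p a)) by rewrite /D pI.
  rewrite -iterS iterSr Dp (linB liter) opprB -addrA; congr (_ + _); exact: addrC.
have FE n a : F n a = a - iter n (fun a => a - q (p (q a))) a.
  elim: n => [|n IH]; first by rewrite /= subrr.
  rewrite /= IH /zs /z /= pI.
  have cr c : iter n r (q (p (q c))) = q (p (q (iter n r c))).
    have c1 (b : H) : r (q (p (q b))) = q (p (q (r b))).
      have := r2 (r b); rewrite (r2 b).
      have lr := bop_lin (M_bop Mr).
      by rewrite (linB lr) => /(addrI _) /oppr_inj.
    by elim: (n) => //= m ->; rewrite c1.
  rewrite cr rd opprB -addrA; congr (_ + _); exact: addrC.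
have itW n a : rdot (iter n.*2 w a) a = n2 (iter n w a).
  by rewrite -addnn iterD (siter _ _ sw).
have wle a : n2 (w a) <= n2 a.
  rewrite /n2 sw w2 rdotBr -(sp a) (rdotC (p a)) projection_n2 //.
  by rewrite gerBl n2_ge0.
(* The limit [z0] is fixed by [D] and by [p], hence [p (q z0) = 0] and [q z0 = 0]; then [hpq] gives
   [z0 = 0]. *)
have lim0 a : hlim (fun n => iter n D (p a)) 0.
  set c := p a.
  pose y n := - n2 (iter n w c).
  have ymono : {homo y : m n / (m <= n)%N >-> m <= n}.
    move=> m n /subnK <-; elim: (n - m)%N => [|k IH] //.
    by apply: (le_trans IH); rewrite lerN2 addSn iterS wle.
  (* As [D = w^2], inner products of iterates depend only on [i + j], and the monotone sequence [y]
     controls their differences. *)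
  have yD i j : rdot (iter i D c) (iter j D c) = n2 (iter (i + j) w c).
    by rewrite !wD (siter _ _ sw) -iterD -doubleD -itW rdotC.
  have [z0 hz0] : exists z0, hlim (fun n => iter n D c) z0.
    apply: hcomplete => ep ep0.
    have [||N hN] := @mono_cauchy R y 0 (ep / 2) ymono _ _.
    - by move=> n; rewrite oppr_le0 n2_ge0.
    - by rewrite divr_gt0.
    exists N => i j hi hj; rewrite n2B yD /n2 !yD.
    have := hN (i + i)%N (i + j)%N (leq_trans hi (leq_addr _ _)) (leq_trans hi (leq_addr _ _)).
    have := hN (j + j)%N (i + j)%N (leq_trans hj (leq_addr _ _)) (leq_trans hi (leq_addr _ _)).
    by rewrite /y !ltr_norml => /andP[? ?] /andP[? ?]; lra.
  have bD : bounded_op D.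
    apply: (@bop_sub _ _ id (p \o (q \o p))); first exact: bop_id.
    by apply: bop_comp; [exact: M_bop|apply: bop_comp; exact: M_bop].
  have Dz : D z0 = z0.
    apply: (hlim_unique (hlim_op bD hz0)) => ep ep0.
    have [N hN] := hz0 ep ep0; exists N => n Nn; rewrite -iterS; apply: hN; exact: leqW.
  have pD n : p (iter n D c) = iter n D c.
    have pDX X : p X = X -> p (D X) = D X by move=> hX; rewrite /D (linB lp) hX pI.
    by elim: n => [|n IH] /=; [exact: pI|exact: pDX].
  have pz : p z0 = z0.
    apply: (hlim_unique (hlim_op (M_bop Mp) hz0)) => ep ep0.
    by have [N hN] := hz0 ep ep0; exists N => n Nn; rewrite pD; exact: hN.
  have qz : q z0 = 0.
    have e0 : p (q (p z0)) = 0.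
      by have := congr1 (fun b => z0 - b) Dz; rewrite /D subKr subrr.
    apply: n2_eq0; have := congr1 (fun b => rdot b z0) e0.
    by rewrite rdot0l pz sp pz projection_n2.
  by rewrite -(hpq pz qz).
pose D' a := a - q (p (q a)).
have lD' : linear D'.
  by move=> k a b; rewrite /D' lq lp lq scalerBr opprD addrACA.
have liter' n : linear (iter n D').
  by elim: n => [//|m IH' k c d]; rewrite !iterS IH' lD'.
(* On the range of [q], which [D'] preserves, [D' ^ n] is the square of [r ^ n], hence positive;
   this form shows [F n <= q]. *)
have FEq n a : F n a = q a - iter n D' (q a).
  have fixD c : q c = 0 -> iter n D' c = c.
    by move=> qc; elim: (n) => //= m ->; rewrite /D' qc (lin0 lp) (lin0 lq) subr0.
  rewrite FE -[X in X - _](subrK (q a) a) -[in X in _ - X](subrK (q a) a).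
  rewrite -/D' (linD (liter' n)) fixD; last by rewrite (linB lq) qI subrr.
  by rewrite opprD addrACA subrr add0r.
have qD n c : q c = c -> q (iter n D' c) = iter n D' c.
  move=> qc; have qDX X : q X = X -> q (D' X) = D' X by move=> hX; rewrite /D' (linB lq) hX qI.
  by elim: n => [|n IH] //=; exact: qDX.
have GFle n : (tau (G n) <= tau q)%E.
  rewrite tGF; apply: tau_mono => // [|a]; first exact: vN_pos_proj.
  have rd' k c : iter k r (iter k r c) = iter k D' c := rd k c.
  rewrite FEq rdotBl -(qD n (q a)) ?qI // (sq (iter n D' _)) -rd' (siter _ _ sr) projection_n2 //.
  by rewrite gerBl n2_ge0.
have sup : is_sup_in M (range G) p.
  split; first exact: vN_pos_proj.
  - move=> _ [n _ <-]; apply: pos_diff; [exact: projection_pos|exact: (pG n).2|move=> a].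
    rewrite GE rdotBl gerBl wD -addnn iterD.
    have pw : iter n w (iter n w (p a)) = p (iter n w (iter n w (p a))).
      rewrite -iterD addnn -wD.
      have pDX X : X = p X -> D X = p (D X) by move=> hX; rewrite /D (linB lp) -hX pI.
      by elim: (n) => [|k IH] /=; [rewrite pI|exact: pDX].
    by rewrite pw sp (siter _ _ sw) n2_ge0.
  - move=> h hh hG; apply: pos_diff; [exact: hh.2|exact: projection_pos|move=> a].
    apply/ler_addgt0Pr => ep ep0.
    have [N hN] := hlim_rdot (lim0 a) (hlim_cst a) ep0.
    have := hN N (leqnn _); rewrite rdot0l subr0 ltr_norml => /andP[_ h1].
    have := pos_form a (hG (G N) (ex_intro2 _ _ N Logic.I erefl)).
    by rewrite /= GE !rdotBl; lra.
rewrite (tr_normal tr _ _ _ sup).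
- by apply: ge_ereal_sup => _ [_ [n _ <-] <-].
- by exists (G 0%N); exists 0%N.
- by move=> _ [n _ <-].
- move=> _ _ [i _ <-] [j _ <-]; exists (G (maxn i j)).
  have mono k l a : (k <= l)%N -> rdot (G k a) a <= rdot (G l a) a.
    move=> /subnK <-; elim: (l - k)%N => [|m IH] //; apply: (le_trans IH).
    rewrite addSn /= rdotDl lerDl.
    by have := pos_form a (pzz (m + k)%N).2.
  split; first by exists (maxn i j).
  + apply: pos_diff; [exact: (pG _).2|exact: (pG _).2|move=> a].
    by apply: mono; rewrite leq_maxl.
  + apply: pos_diff; [exact: (pG _).2|exact: (pG _).2|move=> a].
    by apply: mono; rewrite leq_maxr.
Qed.

End comparison.

Definition meetp (e f : H -> H) : H -> H := pr (fixp e `&` fixp f).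

Lemma fixp_meet_csub e f : projection e -> projection f -> csubspace (fixp e `&` fixp f).
Proof.
move=> pe pf; have [e0 el elim] := fixp_csub pe; have [f0 fl flim] := fixp_csub pf.
split; first by split.
  by move=> k a b [? ?] [? ?]; split; [exact: el|exact: fl].
by move=> u a hu ha; split; [apply: elim ha => n|apply: flim ha => n]; case: (hu n).
Qed.

Lemma M_meetp e f : M e -> M f -> projection e -> projection f -> M (meetp e f).
Proof.
move=> Me Mf pe pf; apply: M_pr; first exact: fixp_meet_csub.
by move=> u hu a [/= ea fa]; split; rewrite /fixp /= (M_comm _ hu) // ?ea ?fa.
Qed.

Lemma meetp_projection e f : projection e -> projection f -> projection (meetp e f).
Proof. by move=> pe pf; apply: pr_projection; exact: fixp_meet_csub. Qed.

Lemma meetp_fix e f a : projection e -> projection f -> meetp e f a = a -> e a = a /\ f a = a.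
Proof. by move=> pe pf /(pr_fix (fixp_meet_csub pe pf)). Qed.

Lemma vN_pos_compl e : M e -> projection e -> vN_pos M (id \- e).
Proof.
move=> Me pe; apply: vN_pos_proj; last exact: projection_compl.
by apply: M_sub => //; exact: M_id.
Qed.

(** Split [1 - g] as [(1 - f) + (f - g)]. The last projection is comparable to [1 - e]: a vector of
    its range killed by [1 - e] is fixed by [e] and [f], hence by [g], so it is 0. *)
Lemma tau_meetp e f : M e -> M f -> projection e -> projection f ->
  (tau (id \- meetp e f)%R <= tau (id \- e)%R + tau (id \- f)%R)%E.
Proof.
move=> Me Mf pe pf; set g := meetp e f.
have sV := fixp_meet_csub pe pf.
have Mg : M g := M_meetp Me Mf pe pf; have pg : projection g := meetp_projection pe pf.
have fg a : f (g a) = g a by have [] := meetp_fix pe pf (projectionI pg a).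
have gf a : g (f a) = g a.
  apply: (pr_uniq sV); first exact: pr_in.
  move=> c [ec fc]; rewrite rdotBl (projection_sym pf) fc -rdotBl.
  by apply: (pr_perp sV a); split.
have lf := projection_lin pf; have lg := projection_lin pg.
have pd : projection (f \- g).
  split; first exact: bop_sub (M_bop Mf) (M_bop Mg).
    apply/funext => a /=; rewrite (linB lf) (linB lg) fg gf !projectionI //.
    by rewrite subrr subr0.
  have bfg := bop_sub (M_bop Mf) (M_bop Mg).
  by apply/(adjP (bop_lin bfg) (bop_lin bfg)) => a b; rewrite /= rdotBl rdotBr !projection_sym.
have Md : M (f \- g) by exact: M_sub.
have Me' : M (id \- e) by apply: M_sub => //; exact: M_id.
have le : (tau (f \- g)%R <= tau (id \- e)%R)%E.
  apply: tau_compare => //; first exact: projection_compl.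
  move=> a /= h1 h2.
  have ea : e a = a by move/eqP : h2; rewrite subr_eq0 => /eqP.
  have fa : f a = a by rewrite -h1 (linB lf) projectionI // fg.
  have ga : g a = a by apply: (pr_id sV); split.
  by have := h1; rewrite fa ga subrr.
have -> : id \- g = (id \- f) \+ (f \- g).
  by apply/funext => a /=; rewrite addrA subrK.
rewrite (tr_add tr); [|exact: vN_pos_compl|exact: vN_pos_proj].
by rewrite addeC leeD2r.
Qed.

End von_Neumann.

(** * Singular values of positive measurable operators *)

Section singular_values.
Set Implicit Arguments.
Unset Strict Implicit.
Variables (R : realType) (H : hilbertSpace R).
Variables (M : set (H -> H)) (vM : von_Neumann_algebra M).
Variables (tau : (H -> H) -> \bar R) (tr : normal_semifinite_faithful_trace M tau).
Implicit Types (a b c d : H) (x y z : set (H * H)) (s t v w : R).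

Lemma subr_id0 a b : a - b = a -> b = 0.
Proof. by move=> /eqP; rewrite -subr_eq0 addrAC subrr add0r oppr_eq0 => /eqP. Qed.

Lemma M_spE x v : affiliated M x -> positive_op x -> M (spE x v).
Proof.
move=> [_ ax] px; apply: (M_pr vM); first exact: spV_csub.
by move=> u hu a; apply: spV_inv; [exact: (com_bop hu)|exact: ax].
Qed.

Lemma spE_projection x v : positive_op x -> projection (spE x v).
Proof. by move=> px; apply: pr_projection; exact: spV_csub. Qed.

(** On the range of [e] the form is at most [v], whereas orthogonally to [spV x v] this forces the
    vector to be 0 by [spV_perp_eq]; so [tau_compare] applies. *)
Lemma distr_le x v (e : H -> H) : affiliated M x -> positive_op x -> 0 <= v -> M e -> projection e ->
  (forall a, e a = a -> exists2 b, x (a, b) & rdot b a <= v * n2 a) ->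
  (op_distr tau x v <= tau (id \- e)%R)%E.
Proof.
move=> ax px v0 Me pe h; rewrite op_distrE //.
have ME := M_spE v ax px; have pE := spE_projection v px.
apply: (tau_compare vM tr).
- by apply: M_sub => //; exact: M_id.
- by apply: M_sub => //; exact: M_id.
- exact: projection_compl.
- exact: projection_compl.
move=> a /= h1 h2.
have ea : e a = a by move/eqP : h2; rewrite subr_eq0 => /eqP.
have [b hab hb] := h a ea.
apply: (spV_perp_eq px v0 _ hab hb); apply/(perp_0 (spV_csub px v)).
exact: subr_id0 h1.
Qed.

(* Gliding hump: a vector of ran P outside dom x would be obtained as a series
   of vectors of ran P orthogonal to spV (16 ^ k). *)
Lemma dom_proj_bdd x (P : H -> H) : positive_op x -> projection P -> range P `<=` op_dom x ->
  exists n : nat, forall a, P a = a -> spE x n%:R a = 0 -> a = 0.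
Proof.
move=> px pP hP; apply: contrapT => /forallNP hn.
have bad n : exists a, [/\ P a = a, spE x n%:R a = 0 & n2 a = 1].
  have /existsNP[a] := hn n; move=> /not_implyP[Pa] /not_implyP[Ea] /eqP an.
  have na : 0 < n2 a.
    by rewrite lt_neqAle n2_ge0 andbT eq_sym; apply/eqP => /n2_eq0/eqP; exact/negP.
  exists ((Num.sqrt (n2 a))^-1%:C%C *: a); split.
  - by rewrite (linZ (projection_lin pP)) Pa.
  - by rewrite (linZ (projection_lin (spE_projection _ px))) Ea scaler0.
  - by rewrite n2Z exprVn sqr_sqrtr ?ltW // mulVf // gt_eqF.
have /choice[f hf] := fun k : nat => bad (16 ^ k)%N.
pose p k a := a - spE x (16 ^ k)%:R a.
have lp k : linear (p k).
  exact: projection_lin (projection_compl (spE_projection _ px)).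
pose th k : R := 16 ^- k.
have thS k : th k.+1 = th k / 16 by rewrite /th exprS invfM mulrC.
have th0 k : 0 < th k by rewrite /th invr_gt0 exprn_gt0.
pose g k : H := (4 ^- k)%:C%C *: f k.
have ng k : n2 (g k) = th k.
  have [_ _ e] := hf k; rewrite /g n2Z e mulr1 exprVn -exprM mulnC exprM.
  by rewrite /th; congr ((_ ^+ k)^-1); ring.
have pg k : p k (g k) = g k.
  have [_ e _] := hf k; rewrite /p /g (linZ (projection_lin (spE_projection _ px))) e.
  by rewrite scaler0 subr0.
have Pg k : P (g k) = g k.
  by have [e _ _] := hf k; rewrite /g (linZ (projection_lin pP)) e.
(* The sign is chosen by the parallelogram identity: one of [a + g k] and [a - g k] has a component
   of squared norm at least [th k] orthogonal to [spV x (16 ^ k)]. *)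
pose nxt k a := if n2 (p k (a + g k)) >= th k then a + g k else a - g k.
have nxtP k a : th k <= n2 (p k (nxt k a)).
  rewrite /nxt; case: ifP => // /negbT; rewrite -ltNge => h; rewrite (linB (lp k)) pg.
  move: h; rewrite (linD (lp k)) pg n2D n2B ng.
  by have := n2_ge0 (p k a); lra.
pose u := fix u k : H := if k is m.+1 then nxt m (u m) else 0.
have ud k : n2 (u k.+1 - u k) = th k.
  rewrite /= /nxt; case: ifP => _; first by rewrite addrAC subrr add0r ng.
  by rewrite addrAC subrr add0r n2N ng.
have Pu k : P (u k) = u k.
  elim: k => [|k IH]; first exact: (lin0 (projection_lin pP)).
  rewrite /= /nxt; case: ifP => _.
    by rewrite (linD (projection_lin pP)) IH Pg.
  by rewrite (linB (projection_lin pP)) IH Pg.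
have tail k m : n2 (u (m + k)%N - u k) <= 3 * th k.
  elim: m k => [|m IH] k; first by rewrite add0n subrr n20 mulr_ge0 // ltW.
  have -> : u (m.+1 + k)%N - u k = (u k.+1 - u k) + (u (m + k.+1)%N - u k.+1).
    by rewrite addSnnS [RHS]addrC addrA subrK.
  apply: (le_trans (n2D_le _ _)); rewrite ud.
  by have := IH k.+1; have := th0 k; rewrite thS; lra.
have thsmall (ep : R) : 0 < ep -> exists N, forall k, (N <= k)%N -> th k < ep.
  move=> ep0; exists (Num.truncn ep^-1).+1 => k hk.
  rewrite /th -[ep]invrK ltf_pV2 ?posrE ?invr_gt0 ?exprn_gt0 //.
  apply: (lt_le_trans (truncnS_gt _)); rewrite -natrX ler_nat.
  by apply: (leq_trans hk); apply: ltnW; exact: ltn_expl.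
have [a ha] : exists a, hlim u a.
  apply: hcomplete => ep ep0; have [N hN] := thsmall (ep / 16) ltac:(by rewrite divr_gt0).
  exists N => i j hi hj.
  have -> : u i - u j = (u i - u N) - (u j - u N) by rewrite opprB addrA subrK.
  have h1 := tail N (i - N)%N; have h2 := tail N (j - N)%N.
  rewrite !subnK // in h1 h2; have := n2D_le (u i - u N) (- (u j - u N)).
  by rewrite n2N; have := hN N (leqnn _); lra.
have Pa : P a = a.
  apply: (hlim_unique (hlim_op (projection_bop pP) ha)) => ep ep0.
  by have [N hN] := ha ep ep0; exists N => n Nn; rewrite Pu; exact: hN.
have [[a' b] /= hab ea] := hP a (ex_intro2 _ _ a Logic.I Pa); rewrite ea in hab.
have close k : n2 (a - u k) <= 3 * th k.
  have hl : hlim (fun m => u (m + k)%N - u k) (a - u k).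
    exact: (hlimD (hlim_shift k ha) (hlim_cst (- u k))).
  exact: (hlim_rdot_le hl hl (tail k)).
(* The terms after [k] move this component by at most [3 * th k.+1 = 3 / 16 * th k] in squared norm,
   and [th k <= 2 n2 (p k a) + 3 / 8 * th k]. *)
have low k : 5 / 16 * th k <= n2 (p k a).
  have h1 := nxtP k (u k); rewrite -/(u k.+1) in h1.
  have e1 : p k (u k.+1) = p k a - p k (a - u k.+1) by rewrite -(linB (lp k)) subKr.
  have h2 : n2 (p k (a - u k.+1)) <= n2 (a - u k.+1).
    have := pr_n2 (spV_csub px (16 ^ k)%:R) (a - u k.+1); rewrite -/(spE x _) -/(p k _).
    by have := n2_ge0 (spE x (16 ^ k)%:R (a - u k.+1)); lra.
  have := close k.+1; rewrite thS; rewrite e1 in h1.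
  by have := n2D_le (p k a) (- p k (a - u k.+1)); rewrite n2N; lra.
(* Beyond level [N = 16 ^ k] the operator expands by at least [N], and [N ^+ 2 * th k = 16 ^+ k] is
   unbounded. *)
have up k : 16 ^+ k * (5 / 16) <= n2 b.
  pose N : R := (16 ^ k)%:R; have N0 : 0 <= N by rewrite ler0n.
  have xe := spE_comm px N hab.
  have xp := pxB px hab xe.
  have pp : perp (spV x N) (a - spE x N a) := pr_perp (spV_csub px N) a.
  have h1 := spV_perp_form px N0 pp xp.
  rewrite -/(p k a) in h1.
  have h2 : n2 (b - spE x N b) <= n2 b.
    have := pr_n2 (spV_csub px N) b; rewrite -/(spE x N).
    by have := n2_ge0 (spE x N b); lra.
  have h3 := CS (b - spE x N b) (p k a).
  have hp : 0 < n2 (p k a) by apply: lt_le_trans (low k); rewrite mulr_gt0 ?divr_gt0.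
  have h4 : N ^+ 2 * n2 (p k a) <= n2 b.
    apply: le_trans h2; rewrite -(ler_pM2r hp); apply: le_trans h3.
    have hr := le_trans (mulr_ge0 N0 (n2_ge0 (p k a))) h1.
    by rewrite -mulrA -expr2 -exprMn ler_pXn2r ?nnegrE ?mulr_ge0 ?n2_ge0.
  apply: le_trans h4; have := low k.
  have e2 : N ^+ 2 * th k = 16 ^+ k.
    by rewrite /N /th natrX expr2 -mulrA divff ?mulr1 // expf_neq0.
  have := sqr_ge0 N; move=> N2 hl.
  have : N ^+ 2 * (5 / 16 * th k) <= N ^+ 2 * n2 (p k a) by rewrite ler_wpM2l.
  have -> : N ^+ 2 * (5 / 16 * th k) = 16 ^+ k * (5 / 16) by rewrite mulrCA e2 mulrC.
  by [].
have [k hk] : exists k, n2 b * (16 / 5) < 16 ^+ k.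
  exists (Num.truncn (n2 b * (16 / 5))).+1.
  apply: (lt_le_trans (truncnS_gt _)); rewrite -natrX ler_nat.
  by apply: ltnW; exact: ltn_expl.
by have := up k; move: (16 ^+ k) hk => X; lra.
Qed.

(** Measurability only provides a projection with range in the domain; [dom_proj_bdd] separates this
    range from high spectral subspaces, and the traces are then compared. *)
Lemma distr_fin x t : S_tau M tau x -> positive_op x -> 0 < t ->
  exists2 v, 0 < v & (op_distr tau x v <= t%:E)%E.
Proof.
move=> [ax hS] px t0; have [P [MP pP hP tP]] := hS t t0.
have [n hn] := dom_proj_bdd px pP hP.
exists n.+1%:R; first by rewrite ltr0n.
apply: le_trans tP; rewrite op_distrE //.
have ME := M_spE n.+1%:R ax px; have pE := spE_projection n.+1%:R px.
apply: (tau_compare vM tr).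
- by apply: M_sub => //; exact: M_id.
- by apply: M_sub => //; exact: M_id.
- exact: projection_compl.
- exact: projection_compl.
move=> a /= h1 h2.
have Pa : P a = a by move/eqP : h2; rewrite subr_eq0 => /eqP.
have Ea : spE x n.+1%:R a = 0 by exact: subr_id0 h1.
apply: hn => //; rewrite -(spE_le px a (ler0n R n) (w := n.+1%:R)) ?ler_nat //.
by rewrite Ea (lin0 (projection_lin (spE_projection _ px))).
Qed.

Lemma op_mu_ge0 x t : 0 <= op_mu tau x t.
Proof.
rewrite /op_mu; set S := [set v | _]; have [->|S0] := eqVneq S set0; first by rewrite inf0.
by apply: lb_le_inf; [exact/set0P|move=> v [/ltW]].
Qed.

Lemma op_mu_le x v t : 0 < v -> (op_distr tau x v <= t%:E)%E -> op_mu tau x t <= v.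
Proof.
by move=> v0 h; apply: ge_inf; [exists 0 => w [/ltW]|split].
Qed.

Lemma op_mu_lt x u t : S_tau M tau x -> positive_op x -> 0 < t -> op_mu tau x t < u ->
  exists v, [/\ 0 < v, v < u & (op_distr tau x v <= t%:E)%E].
Proof.
move=> Sx px t0 h; have [v v0 hv] := distr_fin Sx px t0.
have e0 : 0 < u - op_mu tau x t by rewrite subr_gt0.
have [|w [w0 hw] wu] := inf_adherent e0 (E := [set v | 0 < v /\ (op_distr tau x v <= t%:E)%E]).
  by split; [exists v|exists 0 => z [/ltW]].
by exists w; split=> //; move: wu; rewrite -/(op_mu tau x t) addrC subrK.
Qed.

Lemma op_mu_nincr x s t : S_tau M tau x -> positive_op x -> 0 < s -> s <= t ->
  op_mu tau x t <= op_mu tau x s.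
Proof.
move=> Sx px s0 st; rewrite leNgt; apply/negP => /(op_mu_lt Sx px s0)[v [v0 vu hv]].
have := op_mu_le v0 (le_trans hv (_ : (s%:E <= t%:E)%E)); rewrite lee_fin => /(_ st).
by rewrite leNgt vu.
Qed.

(** The level [v = 0] is allowed although [op_mu] is an infimum over positive levels, hence the
    passage through [v + ep]. *)
Lemma op_mu_bound x v t (e : H -> H) : affiliated M x -> positive_op x -> 0 <= v -> M e -> projection e ->
  (forall a, e a = a -> exists2 b, x (a, b) & rdot b a <= v * n2 a) ->
  (tau (id \- e)%R <= t%:E)%E -> op_mu tau x t <= v.
Proof.
move=> ax px v0 Me pe h te; apply/ler_addgt0Pr => ep ep0.
apply: op_mu_le; first by rewrite ltr_wpDl.
apply: le_trans te; apply: distr_le => //; first by rewrite addr_ge0 // ltW.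
move=> a /h[b hab hb]; exists b => //; apply: (le_trans hb).
by rewrite ler_wpM2r ?n2_ge0 // lerDl ltW.
Qed.

(** On the meet of the spectral projections of [x] and [y] both forms are bounded, but [z] need not
    be defined there. Meeting also with a projection [P] into the domain of [z] costs an arbitrarily
    small trace; on those vectors [op_le] is evaluated on the algebraic sums, before closure. *)
Lemma op_mu_midpoint x y z s t : S_tau_pos M tau x -> S_tau_pos M tau y -> S_tau_pos M tau z ->
  op_le z (midpoint x y) -> 0 < s -> 0 < t ->
  op_mu tau z (s + t) <= 2^-1 * (op_mu tau x s + op_mu tau y t).
Proof.
move=> [Sx px] [Sy py] [Sz pz] le s0 t0; apply/ler_addgt0Pr => ep ep0.
have [|v1 [v10 v1u h1]] := op_mu_lt Sx px s0 (u := op_mu tau x s + ep); first by rewrite ltrDl.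
have [|v2 [v20 v2u h2]] := op_mu_lt Sy py t0 (u := op_mu tau y t + ep); first by rewrite ltrDl.
apply: (@le_trans _ _ (2^-1 * (v1 + v2))); last by lra.
have w0 : 0 < 2^-1 * (v1 + v2) by rewrite mulr_gt0 ?invr_gt0 // addr_gt0.
apply: op_mu_le => //; apply/lee_addgt0Pr => de de0.
have [P [MP pP hP tP]] := Sz.2 de de0.
rewrite (op_distrE tau px (ltW v10)) in h1; rewrite (op_distrE tau py (ltW v20)) in h2.
have Me := M_spE v1 Sx.1 px; have pe := spE_projection v1 px.
have Mf := M_spE v2 Sy.1 py; have pf := spE_projection v2 py.
set e := spE x v1 in h1 Me pe; set f := spE y v2 in h2 Mf pf.
have Mef := M_meetp vM Me Mf pe pf; have pef := meetp_projection pe pf.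
pose g := meetp (meetp e f) P.
have Mg : M g := M_meetp vM Mef MP pef pP.
have pg : projection g := meetp_projection pef pP.
apply: (@le_trans _ _ (tau (id \- g)%R)).
  apply: distr_le => //; [exact: Sz.1|exact: ltW|move=> a /(meetp_fix pef pP)[ef Pa]].
  have [ea fa] := meetp_fix pe pf ef.
  have Va : spV x v1 a by rewrite -ea; exact: (pr_in (spV_csub px v1)).
  have Vb : spV y v2 a by rewrite -fa; exact: (pr_in (spV_csub py v2)).
  have [b1 [x1 _ _]] := spV_step px Va; have [b2 [x2 _ _]] := spV_step py Vb.
  have [[a' b] /= zb ea'] := hP a (ex_intro2 _ _ a Logic.I Pa); rewrite ea' in zb.
  exists b => //.
  have := spV_form px (ltW v10) Va x1; have := spV_form py (ltW v20) Vb x2.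
  have : 0 <= rdot (2^-1%:C%C *: b1 + 2^-1%:C%C *: b2 + (- 1) *: b) a.
    apply: (px_ge0 le); apply: subset_closure; exists (2^-1%:C%C *: b1 + 2^-1%:C%C *: b2), ((- 1) *: b).
    split=> //; last by exists b.
    have two : (2^-1 : R[i]) = 2^-1%:C%C by rewrite rmorphV ?unitfE //= rmorph_nat.
    apply: subset_closure; exists (2^-1%:C%C *: b1), (2^-1%:C%C *: b2); rewrite -two.
    by split=> //; [exists b1|exists b2].
  by rewrite scaleN1r !rdotDl !rdotZl rdotNl; lra.
apply: (le_trans (tau_meetp vM tr Mef MP pef pP)).
rewrite !EFinD; apply: leeD => //.
exact: (le_trans (tau_meetp vM tr Me Mf pe pf) (leeD h1 h2)).
Qed.

Lemma op_norm_form x (C : R) a b : positive_op x -> (op_norm x <= C%:E)%E -> x (a, b) ->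
  rdot b a <= C * n2 a.
Proof.
move=> px h hab; apply/ler_addgt0Pr => ep ep0.
have na := n2_ge0 a; have e0 : 0 < ep / (n2 a + 1) by rewrite divr_gt0 // ltr_wpDl.
have : (op_norm x < (C + ep / (n2 a + 1))%:E)%E.
  by apply: (le_lt_trans h); rewrite lte_fin ltrDl.
move=> /ereal_inf_lt[_ [C' [C'0 hC'] <-]]; rewrite lte_fin => lt.
have := hC' _ hab => /=; rewrite !normE -rmorphM /= lecR => h1.
have h2 : n2 b <= C' ^+ 2 * n2 a.
  rewrite -[n2 b]sqr_sqrtr ?n2_ge0 // -[n2 a in leRHS]sqr_sqrtr // -exprMn.
  by rewrite ler_pXn2r ?nnegrE ?sqrtr_ge0 ?mulr_ge0 ?sqrtr_ge0.
have h3 : rdot b a <= C' * n2 a.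
  rewrite -(@ler_pXn2r _ 2) ?nnegrE ?mulr_ge0 ?(px_ge0 px hab) //.
  by apply: (le_trans (CS b a)); nra.
have h4 : ep / (n2 a + 1) * n2 a <= ep.
  by rewrite mulrAC ler_pdivrMr ?ltr_wpDl // ler_wpM2l ?ltW // ltrDl.
by nra.
Qed.

Lemma op_mu_op_norm x (C : R) t : S_tau_pos M tau x -> 0 <= C -> (op_norm x <= C%:E)%E -> 0 < t ->
  op_mu tau x t <= C.
Proof.
move=> [Sx px] C0 h t0; have [P [MP pP hP tP]] := Sx.2 t t0.
apply: op_mu_bound tP => //; first exact: Sx.1.
move=> a Pa; have [[a' b] /= hab ea] := hP a (ex_intro2 _ _ a Logic.I Pa); rewrite ea in hab.
by exists b => //; exact: (op_norm_form px h hab).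
Qed.

End singular_values.

(** * Cutting a positive operator *)

Section cut_operators.
Set Implicit Arguments.
Unset Strict Implicit.
Variables (R : realType) (H : hilbertSpace R).
Variables (M : set (H -> H)) (vM : von_Neumann_algebra M).
Variables (tau : (H -> H) -> \bar R) (tr : normal_semifinite_faithful_trace M tau).
Implicit Types (a b c d : H) (s t v w : R) (Q : H -> H).

(** The operator [r x Q] on its full domain, the preimage of that of [x] under [Q]; when [Q]
    commutes with [x] it is already closed. *)
Definition cutop (x : set (H * H)) Q (r : R) : set (H * H) :=
  [set z | exists2 b, x (Q z.1, b) & z.2 = r%:C%C *: b].

Lemma strong_add_eq (x y z : set (H * H)) : closed z -> op_add x y = z -> strong_add x y = z.
Proof. by move=> cz e; rewrite /strong_add e -((closure_id z).1 cz). Qed.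

Section fixed.
Variables (x : set (H * H)) (px : positive_op x) (Sx : S_tau M tau x).

Section generic.
Variables (Q : H -> H) (r : R).
Hypotheses (MQ : M Q) (pQ : projection Q) (r0 : 0 < r).
Hypothesis (xQ : forall a b, x (a, b) -> x (Q a, Q b)).

Let lQ := projection_lin pQ.
Let sQ := projection_sym pQ.
Let QQ a : Q (Q a) = Q a := projectionI pQ a.

Let Qb a b : x (Q a, b) -> Q b = b.
Proof. by move=> h; have := xQ h; rewrite QQ => h'; rewrite (px_fun px h' h). Qed.

Lemma cutopI a b : x (a, b) -> cutop x Q r (a, r%:C%C *: Q b).
Proof. by move=> /xQ h; exists (Q b). Qed.

Lemma cutop_pos : positive_op (cutop x Q r).
Proof.
apply: mk_positive.
- move=> k [a b] [a' b'] [b1 /= h1 e1] [b2 /= h2 e2].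
  exists (k *: b1 + b2); first by rewrite /= lQ; exact: (pxl px k h1 h2).
  by rewrite /= e1 e2 scalerDr !scalerA mulrC.
- move=> a b c d [b1 /= h1 ->] [b2 /= h2 ->]; rewrite rdotZl rdotZr; congr (_ * _).
  by rewrite -(Qb h1) sQ (px_sym px h1 h2) sQ (Qb h2).
- move=> c d h.
  have Qd : Q d = d.
    apply/eqP; rewrite eq_sym -subr_eq0; apply/eqP/n2_eq0.
    have hz : cutop x Q r (d - Q d, 0).
      exists 0; last by rewrite scaler0.
      by rewrite /= (linB lQ) QQ subrr; exact: px0.
    have e := h _ _ hz; rewrite rdot0l in e.
    have : rdot (d - Q d) (Q d) = 0 by rewrite -sQ (linB lQ) QQ subrr rdot0l.
    by rewrite /n2 rdotBr -e; move=> ->; rewrite subr0.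
  exists (r^-1%:C%C *: d); last by rewrite /= scalerA -rmorphM /= divff ?gt_eqF // scale1r.
  apply: (px_max px) => a b hab; have := h _ _ (cutopI hab).
  by rewrite rdotZl rdotZr sQ => <-; rewrite mulrA mulVf ?mul1r // gt_eqF.
- apply/denseP => a e e0; have [b [[b' c] /= hb <-] hbe] := (denseP _).1 (px_dense px) a e e0.
  by exists b' => //; exists (b', r%:C%C *: Q c) => //; exact: cutopI.
- move=> a b [b1 /= h1 ->]; rewrite rdotZl mulr_ge0 ?(ltW r0) // -(Qb h1) sQ.
  exact: (px_ge0 px h1).
Qed.

Lemma cutop_aff : affiliated M (cutop x Q r).
Proof.
split; first by case: cutop_pos.
move=> u hu a b [b1 /= h1 ->]; exists (u b1).
  by rewrite /= (M_comm MQ hu); exact: (Sx.1.2 u hu).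
by rewrite /= (linZ (com_lin hu)).
Qed.

Lemma cutop_S : S_tau_pos M tau (cutop x Q r).
Proof.
split; last exact: cutop_pos.
split; first exact: cutop_aff.
move=> e e0; have [P [MP pP hP tP]] := Sx.2 e e0; exists P; split=> //.
by move=> a /hP[[a' b] /= hab <-]; exists (a', r%:C%C *: Q b) => //; exact: cutopI.
Qed.

Lemma cutop_mu t : 0 < t -> op_mu tau (cutop x Q r) t <= r * op_mu tau x t.
Proof.
move=> t0; apply/ler_addgt0Pr => e e0.
have [|v [v0 vu hv]] := op_mu_lt vM tr Sx px t0 (u := op_mu tau x t + e / r).
  by rewrite ltrDl divr_gt0.
have rv : r * v <= r * op_mu tau x t + e.
  have -> : r * op_mu tau x t + e = r * (op_mu tau x t + e / r) by field; rewrite gt_eqF.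
  by rewrite ler_pM2l // ltW.
apply: le_trans rv.
rewrite (op_distrE tau px (ltW v0)) in hv.
apply: (op_mu_bound vM tr _ _ _ _ _ _ hv).
- exact: cutop_aff.
- exact: cutop_pos.
- by rewrite mulr_ge0 // ltW.
- exact: (M_spE vM v Sx.1 px).
- exact: spE_projection.
move=> a Ea; have Va : spV x v a by rewrite -Ea; exact: (pr_in (spV_csub px v)).
have [b [hab _ _]] := spV_step px Va.
exists (r%:C%C *: Q b); first exact: cutopI.
rewrite rdotZl -mulrA ler_pM2l // -(QQ b) sQ.
have VQ : spV x v (Q a) by apply: (spV_inv (projection_bop pQ) _ Va).
apply: (le_trans (spV_form px (ltW v0) VQ (xQ hab))).
rewrite ler_wpM2l ?(ltW v0) //.
by have := projection_split pQ a; have := n2_ge0 (a - Q a); lra.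
Qed.

End generic.

Variables (v : R) (v0 : 0 <= v).
Local Notation E := (spE x v).

Let ME : M E := M_spE vM v Sx.1 px.
Let pE : projection E := spE_projection v px.
Let xE a b : x (a, b) -> x (E a, E b) := @spE_comm _ _ _ px v a b.
Let ME' : M (id \- E)%R.
Proof. by apply: M_sub => //; exact: M_id. Qed.
Let pE' : projection (id \- E)%R := projection_compl pE.
Let xE' a b : x (a, b) -> x ((id \- E)%R a, (id \- E)%R b).
Proof. by move=> h; exact: (pxB px h (xE h)). Qed.

Definition upper_cut r := cutop x (id \- E)%R r.
Definition lower_cut r := cutop x E r.

Lemma upper_cut_S r : 0 < r -> S_tau_pos M tau (upper_cut r).
Proof. by move=> r0; exact: (cutop_S ME' pE' r0 xE'). Qed.
Lemma lower_cut_S r : 0 < r -> S_tau_pos M tau (lower_cut r).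
Proof. by move=> r0; exact: (cutop_S ME pE r0 xE). Qed.
Lemma upper_cut_mu r t : 0 < r -> 0 < t -> op_mu tau (upper_cut r) t <= r * op_mu tau x t.
Proof. by move=> r0; exact: (cutop_mu ME' pE' r0 xE'). Qed.
Lemma lower_cut_mu r t : 0 < r -> 0 < t -> op_mu tau (lower_cut r) t <= r * op_mu tau x t.
Proof. by move=> r0; exact: (cutop_mu ME pE r0 xE). Qed.

(** The spectral projection [E] itself is the test projection: the upper cut vanishes on its
    range. *)
Lemma upper_cut_mu0 r t : 0 < r -> (op_distr tau x v <= t%:E)%E -> op_mu tau (upper_cut r) t = 0.
Proof.
move=> r0 hv; apply/eqP; rewrite eq_le op_mu_ge0 andbT.
have [[ax _] pu] := upper_cut_S r0.
rewrite (op_distrE tau px v0) in hv.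
apply: (op_mu_bound vM tr ax pu (lexx 0) ME pE _ hv) => a Ea.
exists 0; last by rewrite rdot0l mul0r.
exists 0; last by rewrite scaler0.
by rewrite /= Ea subrr; exact: px0.
Qed.

Lemma lower_cut_form r a : 0 < r -> exists2 b, lower_cut r (a, b) & rdot b a <= r * v * n2 a.
Proof.
move=> r0; have Va := pr_in (spV_csub px v) a.
have [b [hb Vb _]] := spV_step px Va.
exists (r%:C%C *: b); first by exists b.
have Eb : E b = b by exact: (pr_id (spV_csub px v)).
rewrite rdotZl -mulrA ler_pM2l // -Eb (projection_sym pE).
apply: (le_trans (spV_form px v0 Va hb)).
rewrite ler_wpM2l // -/(spE x v).
by have := projection_split pE a; have := n2_ge0 (a - E a); lra.
Qed.

Lemma lower_cut_mu_le r t : 0 < r -> 0 < t -> op_mu tau (lower_cut r) t <= r * v.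
Proof.
move=> r0 t0; have [[ax _] pl] := lower_cut_S r0.
apply: (op_mu_bound vM tr (e := id) ax pl) => //.
- by rewrite mulr_ge0 // ltW.
- exact: M_id.
- by split; [exact: bop_id| |].
- by move=> a _; exact: lower_cut_form.
- have -> : (id \- id)%R = (fun=> 0) :> (H -> H) by apply/funext => a /=; rewrite subrr.
  by rewrite (tau_0 vM tr) lee_fin ltW.
Qed.

Lemma lower_cut_bounded r : 0 < r -> (@graph_of R H @` M) (lower_cut r).
Proof.
move=> r0; have [[ax _] pl] := lower_cut_S r0.
have /choice[f hf] : forall a, exists b, lower_cut r (a, b).
  by move=> a; have [b hb _] := lower_cut_form a r0; exists b.
have fE a b : lower_cut r (a, b) -> b = f a by move=> h; exact: (px_fun pl h (hf a)).
have lf : linear f.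
  by move=> k a b; apply/esym/fE; exact: (pxl pl k (hf a) (hf b)).
exists f; last first.
  apply/seteqP; split=> [[a b] e|[a b] /fE] //.
  by have -> : b = f a := e; exact: hf.
apply: (M_in vM).
  apply/bounded_opP; split=> //; exists ((r * v) ^+ 2); first exact: sqr_ge0.
  have sf : hsym f by move=> a b; exact: (px_sym pl (hf a) (hf b)).
  have f0 a : 0 <= rdot (f a) a by exact: (px_ge0 pl (hf a)).
  have f1 a : rdot (f a) a <= r * v * n2 a.
    by have [b /fE -> h] := lower_cut_form a r0.
  move=> a; apply: (le_trans (pos_CS a lf sf f0 f1)).
  by rewrite expr2 -[leRHS]mulrA ler_wpM2l // mulr_ge0 // ltW.
by move=> u hu a; apply/esym/fE; exact: (ax.2 u hu _ _ (hf a)).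
Qed.

Lemma lower_cut_norm r : 0 < r -> (op_norm (lower_cut r) <= (r * v)%:E)%E.
Proof.
move=> r0; have rv : 0 <= r * v by rewrite mulr_ge0 // ltW.
apply: ereal_inf_lbound; exists (r * v) => //; split=> // -[a b] [b1 /= h1 ->].
have Va := pr_in (spV_csub px v) a; have [b2 [h2 _ le]] := spV_step px Va.
rewrite -(px_fun px h1 h2) in le.
rewrite !normE -rmorphM /= lecR n2Z.
rewrite -[X in X * Num.sqrt _]ger0_norm // -sqrtr_sqr -sqrtrM ?sqr_ge0 //; apply: ler_wsqrtr.
have -> : (r * v) ^+ 2 * n2 a = r ^+ 2 * (v ^+ 2 * n2 a) by ring.
apply: ler_wpM2l; first exact: sqr_ge0.
apply: (le_trans le).
apply: ler_wpM2l; [exact: sqr_ge0|exact: (pr_le (spV_csub px v))].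
Qed.

Lemma cut_add : strong_add (upper_cut 1) (lower_cut 1) = x.
Proof.
apply: strong_add_eq; first exact: px_closed px.
apply/seteqP; split=> [[a b] /= [b1 [b2 [[c1 /= h1 ->] [c2 /= h2 ->] ->]]]|[a b] h].
  rewrite !scale1r; have := pxD px h1 h2; by rewrite subrK.
exists (b - E b), (E b); split; last by rewrite /= subrK.
  by exists (b - E b); [exact: xE'|rewrite /= scale1r].
by exists (E b); [exact: xE|rewrite /= scale1r].
Qed.

Lemma cut_midpoint : midpoint (upper_cut 2) (lower_cut 2) = x.
Proof.
have two : (2^-1 : R[i]) * 2%:C%C = 1 by rewrite rmorph_nat mulVf.
apply: strong_add_eq; first exact: px_closed px.
apply/seteqP; split=> [[a b] /= [b1 [b2 [[c1 /= [d1 /= h1 /= ->] ->] [c2 /= [d2 /= h2 /= ->] ->] ->]]]|[a b] h].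
  by rewrite !scalerA two !scale1r; have := pxD px h1 h2; rewrite subrK.
exists (b - E b), (E b); split; last by rewrite /= subrK.
  exists (2%:C%C *: (b - E b)); last by rewrite /= scalerA two scale1r.
  by exists (b - E b) => //; exact: xE'.
exists (2%:C%C *: E b); last by rewrite /= scalerA two scale1r.
by exists (E b) => //; exact: xE.
Qed.

(** The zero operator, obtained from [x] so that the results on [cutop] apply. It completes an
    element of one Lorentz cone to an element of [sum_cone]. *)
Definition zero_cut := cutop x (fun=> 0) 1.

Lemma zero_cut_S : S_tau_pos M tau zero_cut.
Proof.
apply: cutop_S => //; first exact: M_0.
  exact: projection0.
by move=> a b _; exact: px0.
Qed.

Lemma zero_cutE a b : zero_cut (a, b) <-> b = 0.
Proof.
split=> [[b1 /= h1 ->]|->]; first by rewrite (px_fun px h1 (px0 px)) scaler0.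
by exists 0; [exact: px0|rewrite scaler0].
Qed.

Lemma zero_cut_mu t : 0 < t -> op_mu tau zero_cut t = 0.
Proof.
move=> t0; apply/eqP; rewrite eq_le op_mu_ge0 andbT.
have [[ax _] pz] := zero_cut_S.
apply: (op_mu_bound vM tr (e := id) ax pz) => //.
- exact: M_id.
- by split; [exact: bop_id| |].
- by move=> a _; exists 0; [exact/zero_cutE|rewrite rdot0l mul0r].
- have -> : (id \- id)%R = (fun=> 0) :> (H -> H) by apply/funext => a /=; rewrite subrr.
  by rewrite (tau_0 vM tr) lee_fin ltW.
Qed.

Lemma add_zero_cut (y : set (H * H)) : closed y -> strong_add y zero_cut = y.
Proof.
move=> cy; apply: strong_add_eq => //.
apply/seteqP; split=> [[a b] /= [b1 [b2 [h1 /zero_cutE -> /= ->]]]|[a b] h]; first by rewrite addr0.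
by exists b, 0; split=> //; [exact/zero_cutE|rewrite /= addr0].
Qed.

Lemma zero_add_cut (y : set (H * H)) : closed y -> strong_add zero_cut y = y.
Proof.
move=> cy; apply: strong_add_eq => //.
apply/seteqP; split=> [[a b] /= [b1 [b2 [/zero_cutE -> h1 /= ->]]]|[a b] h]; first by rewrite add0r.
by exists 0, b; split=> //; [exact/zero_cutE|rewrite /= add0r].
Qed.

Lemma zero_cut_graph : (@graph_of R H @` M) zero_cut.
Proof.
exists (fun=> 0); first exact: M_0.
by apply/seteqP; split=> [[a b] e|[a b] /zero_cutE] //; exact/zero_cutE.
Qed.

End fixed.
End cut_operators.

(** * Rearrangements and dilations *)

Section function_space_basics.
Set Implicit Arguments.
Unset Strict Implicit.
Variable R : realType.
Implicit Types (f g : R -> R) (t v u s : R).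
Local Notation lambda := (@lebesgue_measure R).

Lemma Rpos_itv : @Rpos R = `]0, +oo[%classic.
Proof. by apply/seteqP; split=> t; rewrite /Rpos /= in_itv /= andbT. Qed.

Lemma measurable_Rpos : measurable (@Rpos R).
Proof. by rewrite Rpos_itv; exact: measurable_itv. Qed.

Lemma fset_meas f v : measurable_fun (@Rpos R) f ->
  measurable (@Rpos R `&` [set t | v < `|f t|]).
Proof.
move=> mf; have mn : measurable_fun (@Rpos R) (fun t => `|f t|) by exact: measurableT_comp.
have := mn measurable_Rpos _ (measurable_itv `]v, +oo[).
by congr measurable; apply/seteqP; split=> t [? /=]; rewrite ?in_itv /= ?andbT.
Qed.

Lemma nonincr_measurable f : (forall s t, 0 < s -> s <= t -> f t <= f s) ->
  measurable_fun (@Rpos R) f.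
Proof.
move=> h; apply: (measurability (@RGenCInfty.G R)) => [|/= _ [_] [r] -> <-].
  exact: RGenCInfty.measurableE.
apply: is_interval_measurable => s t /= [s0 fs] [t0 ft] w /andP[sw wt].
rewrite /Rpos /= in fs ft s0 t0 *; rewrite !in_itv /= !andbT in fs ft *.
have w0 : 0 < w by apply: lt_le_trans s0 sw.
by split=> //; apply: (le_trans ft); exact: h.
Qed.

Lemma fdistr_nincr f v w : measurable_fun (@Rpos R) f -> v <= w ->
  (fdistr f w <= fdistr f v)%E.
Proof.
move=> mf vw; apply: le_measure; rewrite ?inE; [exact: fset_meas|exact: fset_meas|].
by move=> t [? /= h]; split=> //=; exact: le_lt_trans h.
Qed.

Lemma fdistr_small f t : S_Rplus f -> 0 < t -> exists2 v, 0 < v & (fdistr f v <= t%:E)%E.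
Proof.
move=> [mf [v0 v00 fin]] t0.
pose F n := @Rpos R `&` [set s | v0 + n%:R < `|f s|].
have F0 : \bigcap_n F n = set0.
  apply/seteqP; split=> // s h.
  have [_ /=] := h (Num.truncn (`|f s|)).+1 Logic.I.
  have := truncnS_gt `|f s|; move=> h1 h2.
  by have := lt_trans h2 (ltr_wpDl (ltW v00) h1); rewrite ltxx.
have : (lambda \o F) @ \oo --> lambda (\bigcap_n F n).
  apply: nonincreasing_cvg_mu.
  - by rewrite /F addr0.
  - by move=> n; exact: fset_meas.
  - by rewrite F0.
  - apply/nonincreasing_seqP => n; apply/subsetPset => s [? /= h]; split=> //=.
    by apply: le_lt_trans h; rewrite lerD2l ler_nat.
rewrite F0 measure0 => /fine_cvgP[fn /cvgrPdist_le /(_ _ t0)].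
move=> ht; near \oo => n.
exists (v0 + n%:R); first by rewrite ltr_wpDr.
have fi : (lambda \o F) n \is a fin_num by near: n.
have : `|0 - fine ((lambda \o F) n)| <= t by near: n; exact: ht.
rewrite sub0r normrN => h; rewrite -[fdistr _ _]/((lambda \o F) n) -(fineK fi) lee_fin.
exact: le_trans (ler_norm _) h.
Unshelve. all: end_near. Qed.

Lemma fmu_ge0 f t : 0 <= fmu f t.
Proof.
rewrite /fmu; set S := [set v | _]; have [->|S0] := eqVneq S set0; first by rewrite inf0.
by apply: lb_le_inf; [exact/set0P|move=> v [/ltW]].
Qed.

Lemma fmu_le_v f t v : 0 < v -> (fdistr f v <= t%:E)%E -> fmu f t <= v.
Proof. by move=> v0 h; apply: ge_inf; [exists 0 => w [/ltW]|split]. Qed.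

Lemma fmu_gt f t v : 0 < v -> v < fmu f t -> (t%:E < fdistr f v)%E.
Proof. by move=> v0 h; rewrite ltNge; apply/negP => /(fmu_le_v v0); rewrite leNgt h. Qed.

Lemma fmu_ge f t v : S_Rplus f -> 0 < t -> (t%:E < fdistr f v)%E -> v <= fmu f t.
Proof.
move=> Sf t0 h; apply: lb_le_inf.
  by have [w w0 hw] := fdistr_small Sf t0; exists w.
move=> w [w0 hw]; rewrite leNgt; apply/negP => wv.
have := le_lt_trans hw h; rewrite ltNge fdistr_nincr //; [by case: Sf|exact: ltW].
Qed.

Lemma fmu_le f g t : S_Rplus g -> (forall v, 0 < v -> (fdistr f v <= fdistr g v)%E) ->
  0 < t -> fmu f t <= fmu g t.
Proof.
move=> Sg h t0; apply: lb_le_inf.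
  by have [w w0 hw] := fdistr_small Sg t0; exists w.
by move=> v [v0 hv]; apply: fmu_le_v => //; apply: le_trans (h _ v0) hv.
Qed.

Lemma fmu_nincr f s t : S_Rplus f -> 0 < s -> s <= t -> fmu f t <= fmu f s.
Proof.
move=> Sf s0 st; apply: lb_le_inf.
  by have [w w0 hw] := fdistr_small Sf s0; exists w.
by move=> v [v0 hv]; apply: fmu_le_v => //; apply: (le_trans hv); rewrite lee_fin.
Qed.

Lemma lebesgue_scale u (A : set R) : 0 < u -> measurable A ->
  lambda ((fun s => u^-1 * s) @^-1` A) = (u%:E * lambda A)%E.
Proof.
move=> u0 mA.
have ui : 0 <= u^-1 by rewrite invr_ge0 ltW.
have mh : measurable_fun [set: measurableTypeR R] ((fun s => u^-1 * s) : measurableTypeR R -> measurableTypeR R).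
  by apply: measurable_funM; [exact: measurable_cst|exact: measurable_id].
pose m := mscale (NngNum ui) (pushforward lambda ((fun s => u^-1 * s) : measurableTypeR R -> measurableTypeR R)).
have e : lambda A = m mh A.
  apply: (@lebesgue_measure_unique R (m mh)) => // _ [[a b] _ <-].
  transitivity (u^-1%:E * lambda `](u * a)%R, (u * b)%R]%classic)%E; last first.
    rewrite /m /mscale /pushforward; congr (_ * lambda _)%E; apply/seteqP; split=> x /=; rewrite !in_itv /= ltr_pdivlMl // ler_pdivrMl //.
  rewrite !lebesgue_measure_itv /= !lte_fin ltr_pM2l //.
  case: ifP => _; last by rewrite mule0.
  by rewrite -!EFinB -EFinM; congr EFin; field; rewrite gt_eqF.
rewrite e /m /mscale /pushforward /= muleA -EFinM divff ?gt_eqF // mul1e //.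
Qed.

Lemma dil_meas u f : 0 < u -> measurable_fun (@Rpos R) f ->
  measurable_fun (@Rpos R) (dilation u^-1 f).
Proof.
move=> u0 mf; apply: (@measurable_comp _ _ _ R R R (@Rpos R) f (@Rpos R) (fun s => u^-1 * s)) => //.
    exact: measurable_Rpos.
  by move=> _ [s s0 <-]; rewrite /Rpos /= mulr_gt0 // invr_gt0.
by apply: measurable_funM; [exact: measurable_cst|exact: measurable_id].
Qed.

Lemma fdistr_dil u f v : 0 < u -> measurable_fun (@Rpos R) f ->
  fdistr (dilation u^-1 f) v = (u%:E * fdistr f v)%E.
Proof.
move=> u0 mf; rewrite /fdistr -lebesgue_scale //; last exact: fset_meas.
congr (lambda _); apply/seteqP; split=> s /= [s0 h]; split=> //.
  by rewrite /Rpos /= mulr_gt0 // invr_gt0.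
by move: s0; rewrite /Rpos /= pmulr_rgt0 // invr_gt0.
Qed.

Lemma dil_S u f : 0 < u -> S_Rplus f -> S_Rplus (dilation u^-1 f).
Proof.
move=> u0 [mf [v v0 hv]]; split; first exact: dil_meas.
by exists v => //; rewrite fdistr_dil // lte_mul_pinfty // lee_fin ltW.
Qed.

(** If [v + e] were not admissible on the left, the dilated rearrangement would exceed [v] on some
    []0, s]] with [s > t]. This replaces [f] by a monotone function, which can be cut along a set of
    prescribed density. *)
Lemma fmu_dil_le u f t : 0 < u -> S_Rplus f -> S_Rplus (fun s => fmu f (u^-1 * s)) -> 0 < t ->
  fmu (dilation u^-1 f) t <= fmu (fun s => fmu f (u^-1 * s)) t.
Proof.
move=> u0 Sf SG t0; have mf := Sf.1.
apply: lb_le_inf; first by have [w w0 hw] := fdistr_small SG t0; exists w.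
move=> v [v0 hv]; apply/ler_addgt0Pr => e e0.
apply: fmu_le_v; first exact: addr_gt0.
rewrite leNgt; apply/negP; rewrite fdistr_dil // => h.
have [s ts hs] : exists2 s, t < s & (s%:E < u%:E * fdistr f (v + e))%E.
  move: h; case: (u%:E * fdistr f (v + e))%E => [r| |] //.
    rewrite lte_fin => tr; exists ((t + r) / 2); rewrite ?lte_fin; lra.
  by move=> _; exists (t + 1); rewrite ?ltry ?ltrDl.
have : (s%:E <= fdistr (fun s => fmu f (u^-1 * s)) v)%E.
  have -> : s%:E = lambda `]0, s]%classic.
    by rewrite lebesgue_measure_itv /= lte_fin (lt_trans t0 ts) sube0.
  apply: le_measure; rewrite ?inE; [exact: measurable_itv|exact: fset_meas SG.1|].
  move=> r /=; rewrite in_itv /= => /andP[r0 rs]; split=> //=.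
  rewrite ger0_norm ?fmu_ge0 //; apply: (@lt_le_trans _ _ (v + e)); first by rewrite ltrDl.
  apply: fmu_ge => //; first by rewrite mulr_gt0 // invr_gt0.
  have : (r%:E < u%:E * fdistr f (v + e))%E by apply: le_lt_trans hs; rewrite lee_fin.
  case: (fdistr f (v + e)) => [d| |] //; rewrite ?ltry //.
    by rewrite -EFinM !lte_fin ltr_pdivrMl // mulrC.
  by rewrite gt0_muleNy // lte_fin.
move=> /le_trans/(_ hv); rewrite lee_fin leNgt ts //.
Qed.

Section log_periodic.
Variables (A : set R) (mA : measurable A) (hA : forall s, A s <-> A (2 * s)).
Hypothesis h12 : lambda (A `&` `]1, 2]%classic) = (2^-1)%:E.

Let m a := lambda (A `&` `]0, a]%classic).

Let mI (i : interval R) : measurable (A `&` [set` i]).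
Proof. by apply: measurableI => //; exact: measurable_itv. Qed.

Let mIle (i : interval R) : (lambda (A `&` [set` i]) <= lambda [set` i])%E.
Proof.
apply: le_measure; last exact: subIsetr; rewrite inE; first exact: mI.
exact: measurable_itv.
Qed.

Let m_fin a : 0 <= a -> m a \is a fin_num.
Proof.
move=> a0; rewrite ge0_fin_numE //; apply: (@le_lt_trans _ _ (lambda `]0, a]%classic)).
  exact: mIle.
by rewrite lebesgue_measure_itv /=; case: ifP => _; rewrite ?ltry // -EFinB ltry.
Qed.

Let m2 a : m (2 * a) = (2%:E * m a)%E.
Proof.
rewrite -lebesgue_scale //; congr (lambda _); apply/seteqP; split=> s /=.
  rewrite !in_itv /= => -[As /andP[s0 sa]]; split.
    by apply/hA; rewrite mulrA divff ?mul1r.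
  by rewrite mulr_gt0 ?invr_gt0 //= ler_pdivrMl.
rewrite !in_itv /= => -[/hA As /andP[s0 sa]]; split.
  by move: As; rewrite mulrA divff ?mul1r.
by move: s0 sa; rewrite pmulr_rgt0 ?invr_gt0 // => -> /=; rewrite ler_pdivrMl.
Qed.

Let m_split a b : 0 <= a -> a <= b -> m b = (m a + lambda (A `&` `]a, b]%classic))%E.
Proof.
move=> a0 ab; rewrite /m -measureU; [|exact: mI|exact: mI|].
  congr (lambda _); rewrite -setIUr; congr (_ `&` _); apply/seteqP; split=> s /=; rewrite !in_itv /=.
    by move=> /andP[s0 sb]; case: (leP s a) => h; [left; rewrite s0|right; rewrite sb].
  by case=> /andP[h1 h2]; rewrite ?h1 ?h2 ?(le_trans h2 ab) //= (le_lt_trans a0 h1).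
by apply/seteqP; split=> // s [[_ +] [_ +]]; rewrite /= !in_itv /= => /andP[_ h1] /andP[h2 _]; have := le_lt_trans h1 h2; rewrite ltxx.
Qed.

Let m1 : m 1 = (2^-1)%:E.
Proof.
have := m_split ler01 (ler1n R 2); rewrite h12 -[2%:R](mulr1 2) m2.
rewrite -(fineK (m_fin ler01)) -EFinM -EFinD => -[h]; congr EFin; lra.
Qed.

(** Here [m a] is at most [1/2 + (a - 1)] and at most 1; the two bounds meet at [a = 3/2], where
    [2 / 3 * a] equals 1. *)
Let m12 a : 1 <= a -> a <= 2 -> (m a <= (2 / 3 * a)%:E)%E.
Proof.
move=> a1 a2; rewrite (m_split ler01 a1) m1.
have l1 : (lambda (A `&` `]1%R, a]%classic) <= (a - 1)%:E)%E.
  apply: (@le_trans _ _ (lambda `]1, a]%classic)).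
    exact: mIle.
  rewrite lebesgue_measure_itv /=; case: ifP => _; rewrite ?EFinB //.
  by rewrite lee_fin subr_ge0.
have l2 : (lambda (A `&` `]1%R, a]%classic) <= (2^-1)%:E)%E.
  rewrite -h12; apply: le_measure; [rewrite inE; exact: mI|rewrite inE; exact: mI|].
  move=> s [As] /=; rewrite !in_itv /= => /andP[s1 sa].
  by split=> //=; rewrite s1 (le_trans sa).
case: (leP a (3 / 2)) => h.
  by apply: (le_trans (leeD2l _ l1)); rewrite -EFinD lee_fin; lra.
by apply: (le_trans (leeD2l _ l2)); rewrite -EFinD lee_fin; lra.
Qed.

(** Both sides double with [a], so a power of 2 reduces the claim to [[1, 2]]. *)
Lemma log_periodic_density a : 0 < a -> (lambda (A `&` `]0%R, a]%classic) <= (2 / 3 * a)%:E)%E.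
Proof.
move=> a0; rewrite -/(m a).
have big k b : 1 <= b -> b <= 2 ^+ k -> (m b <= (2 / 3 * b)%:E)%E.
  elim: k b => [|k IH] b b1 bk; first by apply: m12 => //; move: bk; rewrite expr0; lra.
  case: (leP b 2) => b2; first exact: m12.
  have -> : b = 2 * (b / 2) by field.
  rewrite m2; have hb : (m (b / 2) <= (2 / 3 * (b / 2))%:E)%E.
    by apply: IH; [lra|move: bk; rewrite exprS; lra].
  have -> : 2 / 3 * (2 * (b / 2)) = 2 * (2 / 3 * (b / 2)) by ring.
  by rewrite [leRHS]EFinM; apply: lee_pmul => //; rewrite ?lee_fin // measure_ge0.
have pow (c : R) : exists k, c <= 2 ^+ k.
  exists (Num.truncn c).+1; apply: ltW; apply: (lt_le_trans (truncnS_gt _)).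
  by rewrite -natrX ler_nat; apply: ltnW; exact: ltn_expl.
have all k b : 0 < b -> 1 <= 2 ^+ k * b -> (m b <= (2 / 3 * b)%:E)%E.
  elim: k b => [|k IH] b b0 h.
    by have [k hk] := pow b; apply: (big k) => //; rewrite expr0 mul1r in h.
  have hb : (m (2 * b) <= (2 / 3 * (2 * b))%:E)%E.
    by apply: IH; [rewrite mulr_gt0|move: h; rewrite exprSr mulrA].
  move: hb; rewrite m2 -(fineK (m_fin (ltW b0))) -EFinM !lee_fin; lra.
have [k hk] := pow a^-1; apply: (all k) => //.
by rewrite -[leLHS](mulVf (lt0r_neq0 a0)) ler_pM2r.
Qed.

End log_periodic.

End function_space_basics.

(** * Bounded dilations on symmetric quasi-Banach function spaces *)

Section quasi_banach_function_spaces.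
Set Implicit Arguments.
Unset Strict Implicit.
Variable R : realType.
Implicit Types (f g : R -> R) (t v u s : R).
Local Notation lambda := (@lebesgue_measure R).
Variables (E : set (R -> R)) (nrm : (R -> R) -> R).
Hypothesis hE : symmetric_quasi_Banach E nrm.

Lemma aeS (P Q : R -> Prop) : (forall t, P t -> Q t) ->
  {ae lambda, forall t, P t} -> {ae lambda, forall t, Q t}.
Proof.
move=> h [N [mN N0 hN]]; exists N; split=> // t /= nQ; apply: hN => /= Pt.
by apply: nQ; exact: h.
Qed.

Lemma aeI (P Q : R -> Prop) : {ae lambda, forall t, P t} -> {ae lambda, forall t, Q t} ->
  {ae lambda, forall t, P t /\ Q t}.
Proof.
move=> hP hQ; have : {ae lambda, forall t, forall n : nat, if n is 0%N then P t else Q t}.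
  by apply: ae_foralln => -[|n].
by apply: aeS => t h; split; [exact: (h 0%N)|exact: (h 1%N)].
Qed.

Lemma fdistr_ge0 f v : (0 <= fdistr f v)%E.
Proof. exact: measure_ge0. Qed.

Lemma E_meas f : E f -> measurable_fun (@Rpos R) f.
Proof. by move/(sqb_sub hE) => []. Qed.

Lemma E_le f g : E g -> measurable_fun (@Rpos R) f ->
  (forall v, 0 < v -> (fdistr f v <= fdistr g v)%E) -> E f /\ nrm f <= nrm g.
Proof.
move=> Eg mf h; have Sg := sqb_sub hE Eg.
apply: (sqb_symmetric hE) => //; last by move=> t t0; exact: fmu_le.
by split=> //; have [_ [v v0 hv]] := Sg; exists v => //; apply: le_lt_trans hv; exact: h.
Qed.

Lemma fdistr_ae f g v : measurable_fun (@Rpos R) f -> measurable_fun (@Rpos R) g ->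
  {ae lambda, forall t : R, 0 < t -> `|f t| <= `|g t|} -> (fdistr f v <= fdistr g v)%E.
Proof.
move=> mf mg [N [mN N0 hN]].
rewrite /fdistr; set B := (X in (_ <= lambda X)%E).
have mB : measurable B by exact: fset_meas.
apply: (@le_trans _ _ (lambda (B `|` N))).
  apply: le_measure; rewrite ?inE; [exact: fset_meas|exact: measurableU|].
  move=> t [t0 /= h]; have [Bt|nB] := pselect (B t); [by left|right].
  apply: hN => /= /(_ t0) hfg; apply: nB; split=> //=; exact: lt_le_trans hfg.
have h := measureU2 lambda mB mN; apply: (le_trans h); rewrite [X in (_ + X)%E](_ : _ = 0%E) ?adde0 //; exact: N0.
Qed.

Lemma E_ae f g : E g -> measurable_fun (@Rpos R) f ->
  {ae lambda, forall t : R, 0 < t -> `|f t| <= `|g t|} -> E f /\ nrm f <= nrm g.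
Proof. by move=> Eg mf h; apply: E_le => // v _; apply: fdistr_ae => //; exact: E_meas. Qed.

Lemma E_dom f g : E g -> measurable_fun (@Rpos R) f ->
  (forall t, 0 < t -> `|f t| <= `|g t|) -> E f /\ nrm f <= nrm g.
Proof. by move=> Eg mf h; apply: E_ae => //; apply: aeW => t t0; exact: h. Qed.

Lemma E_0 : E (fun=> 0) /\ nrm (fun=> 0) = 0.
Proof.
have [f Ef _] := sqb_nonzero hE.
have e : (fun=> 0) = (fun t : R => 0 * f t) :> (R -> R) by apply/funext => t; rewrite mul0r.
split; last by rewrite e (sqb_homo hE) // normr0 mul0r.
have -> : (fun=> 0) = (fun t : R => 0 * f t + f t - f t) :> (R -> R) by apply/funext => t; rewrite mul0r add0r subrr.
have := sqb_linear hE (-1) Ef (sqb_linear hE 0 Ef Ef).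
by congr E; apply/funext => t; ring.
Qed.

Lemma E_Z (a : R) f : E f -> E (fun t => a * f t).
Proof.
move=> Ef; have := sqb_linear hE a Ef E_0.1.
by congr E; apply/funext => t; rewrite addr0.
Qed.

Lemma E_D f g : E f -> E g -> E (fun t => f t + g t).
Proof.
move=> Ef Eg; have := sqb_linear hE 1 Ef Eg.
by congr E; apply/funext => t; rewrite mul1r.
Qed.

Lemma E_B f g : E f -> E g -> E (fun t => f t - g t).
Proof.
move=> Ef Eg; have := sqb_linear hE (-1) Eg Ef.
by congr E; apply/funext => t; ring.
Qed.

Lemma E_K : exists2 K : R, 1 <= K & forall f g, E f -> E g ->
    nrm (fun t => f t + g t) <= K * (nrm f + nrm g).
Proof.
have [K hK] := sqb_quasi_triangle hE; exists (Num.max 1 K); first by rewrite le_max lexx.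
move=> f g Ef Eg; apply: (le_trans (hK _ _ Ef Eg)).
by apply: ler_wpM2r; rewrite ?le_max ?lexx ?orbT // addr_ge0 // (sqb_ge0 hE).
Qed.

(** The lower halves of the dyadic intervals over all integer exponents: invariant under doubling,
    with a complement of the same kind. *)
Let A : set R := \bigcup_k (`]2 ^+ k, 3 / 2 * 2 ^+ k]%classic `|` `]2 ^- k, 3 / 2 * 2 ^- k]%classic).

Let mA : measurable A.
Proof. by apply: bigcupT_measurable => k; apply: measurableU; exact: measurable_itv. Qed.

Let hA s : A s <-> A (2 * s).
Proof.
split=> -[k _ []] /=; rewrite in_itv /= => h.
- by exists k.+1 => //; left; rewrite /= in_itv /= exprS; lra.
- case: k h => [|k] h; first by exists 1%N => //; left; rewrite /= in_itv /= expr1; move: h; rewrite expr0 invr1; lra.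
  by exists k => //; right; rewrite /= in_itv /=; move: h; rewrite exprS invfM; lra.
- case: k h => [|k] h; first by exists 1%N => //; right; rewrite /= in_itv /= expr1; move: h; rewrite expr0; lra.
  by exists k => //; left; rewrite /= in_itv /=; move: h; rewrite exprS; lra.
- by exists k.+1 => //; right; rewrite /= in_itv /= exprS invfM; lra.
Qed.

Let pow2_ge1 k : 1 <= 2 ^+ k :> R.
Proof. by apply: exprn_ege1; rewrite ler1n. Qed.

Let A12 : A `&` `]1, 2]%classic = `]1, 3 / 2]%classic.
Proof.
apply/seteqP; split=> s /=; rewrite !in_itv /=.
  case=> -[[|k] _ [] /=]; rewrite in_itv /= ?expr0 ?invr1 ?mulr1; try lra.
    by have := pow2_ge1 k; rewrite exprS; lra.
  have h : 2 ^- k.+1 <= 2^-1 :> R.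
    by rewrite lef_pV2 ?posrE ?exprn_gt0 // -[leLHS]expr1 ler_weXn2l // ler1n.
  by move: h; set z := (2 ^- _); lra.
move=> h; split; last lra.
by exists 0%N => //; left; rewrite /= in_itv /= expr0 mulr1.
Qed.

Let B12 : ~` A `&` `]1, 2]%classic = `]3 / 2, 2]%classic.
Proof.
apply/seteqP; split=> s.
  case=> nA s12; have s12' := s12; rewrite /= !in_itv /= in s12' *.
  have [h|h] := leP s (3 / 2); last lra.
  have : (A `&` `]1, 2]%classic) s by rewrite A12 /= in_itv /=; lra.
  by case.
rewrite /= !in_itv /= => h; split; last lra.
move=> As; have : (A `&` `]1, 2]%classic) s by split=> //; rewrite /= in_itv /=; lra.
by rewrite A12 /= in_itv /=; lra.
Qed.

(* Each of A and its complement fills at most two thirds of every interval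
   ]0, a]: restricting the rearrangement dilated by 3/2 to one of them does not
   increase the distribution function. *)
Let dil_piece (B : set R) f : measurable B -> (forall s, B s <-> B (2 * s)) ->
  lambda (B `&` `]1, 2]%classic) = (2^-1)%:E -> E f ->
  let G := fun t => fmu f ((3 / 2)^-1 * t) * \1_B t in E G /\ nrm G <= nrm f.
Proof.
move=> mB hB l12 Ef G; have Sf := sqb_sub hE Ef.
have G0 t : 0 <= G t by rewrite mulr_ge0 // fmu_ge0.
have mG : measurable_fun (@Rpos R) G.
  apply: measurable_funM; last exact: measurable_indic.
  apply: nonincr_measurable => s t s0 st; apply: fmu_nincr => //; lra.
apply: E_le => // v v0.
case e : (fdistr f v) => [d| |]; [|by rewrite leey|]; last first.
  by have := fdistr_ge0 f v; rewrite e.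
have d0 : 0 <= d by rewrite -lee_fin -e fdistr_ge0.
have key t : 0 < t -> v < `|G t| -> B t /\ t < 3 / 2 * d.
  rewrite ger0_norm // /G indicE => t0; case: (boolP (t \in B)); last by rewrite mulr0; lra.
  rewrite inE mulr1 => Bt h; split=> //.
  have := fmu_gt v0 h; rewrite e lte_fin; lra.
have [d_0|dp] := leP d 0.
  rewrite /fdistr (_ : _ `&` _ = set0) ?measure0 ?lee_fin //.
  apply/seteqP; split=> // t [t0 /= h]; have [_] := key t t0 h.
  by rewrite /Rpos /= in t0; nra.
apply: (@le_trans _ _ (lambda (B `&` `]0%R, 3 / 2 * d]%classic))).
  apply: le_measure; rewrite ?inE; [exact: fset_meas|by apply: measurableI => //; exact: measurable_itv|].
  move=> t [t0 /= h]; have [Bt td] := key t t0 h; split=> //=.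
  by rewrite in_itv /= (ltW td) andbT.
have c0 : 0 < 3 / 2 * d by lra.
apply: (le_trans (log_periodic_density mB hB l12 c0)).
by rewrite lee_fin; lra.
Qed.

(** The dilated rearrangement is the sum of its restrictions to [A] and to the complement, each of
    norm at most [nrm f] by [dil_piece]. The ratio 3/2 is the inverse of the density 2/3. *)
Let dil32 : exists2 C : R, 0 <= C & forall f, E f ->
  E (dilation (3 / 2)^-1 f) /\ nrm (dilation (3 / 2)^-1 f) <= C * nrm f.
Proof.
have [K K1 hK] := E_K; exists (2 * K); first lra.
move=> f Ef; have Sf := sqb_sub hE Ef.
have [E1 n1] : E (fun t => fmu f ((3 / 2)^-1 * t) * \1_A t) /\ nrm (fun t => fmu f ((3 / 2)^-1 * t) * \1_A t) <= nrm f.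
  apply: dil_piece => //; rewrite A12 lebesgue_measure_itv /= lte_fin ifT; last lra.
  by rewrite -EFinB; congr EFin; lra.
have [E2 n2] : E (fun t => fmu f ((3 / 2)^-1 * t) * \1_(~` A) t) /\ nrm (fun t => fmu f ((3 / 2)^-1 * t) * \1_(~` A) t) <= nrm f.
  apply: dil_piece => //; first exact: measurableC.
    by move=> s; rewrite /setC /=; have := hA s; tauto.
  rewrite B12 lebesgue_measure_itv /= lte_fin ifT; last lra.
  by rewrite -EFinB; congr EFin; lra.
have E3 := E_D E1 E2; have n3 := hK _ _ E1 E2.
have e : (fun t => fmu f ((3 / 2)^-1 * t) * \1_A t + fmu f ((3 / 2)^-1 * t) * \1_(~` A) t) = (fun t => fmu f ((3 / 2)^-1 * t)).
  apply/funext => t; rewrite !indicE in_setC -mulrDr.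
  by case: (t \in A); rewrite /= ?addr0 ?add0r mulr1.
rewrite e in E3 n3.
have u0 : 0 < 3 / 2 :> R by lra.
have [E4 n4] : E (dilation (3 / 2)^-1 f) /\ nrm (dilation (3 / 2)^-1 f) <= nrm (fun t => fmu f ((3 / 2)^-1 * t)).
  apply: (sqb_symmetric hE) => //; first exact: dil_S.
  by move=> t t0; apply: fmu_dil_le => //; exact: (sqb_sub hE).
split=> //; apply: (le_trans n4); apply: (le_trans n3).
rewrite mulrAC mulrC ler_pM2r; lra.
Qed.

(** Iterating [dil32] reaches a power of 3/2 above [u], and the distribution function of a dilation
    is monotone in its factor. *)
Lemma dilation_bounded u : 0 < u -> exists2 C : R, 0 <= C & forall f, E f ->
  E (dilation u^-1 f) /\ nrm (dilation u^-1 f) <= C * nrm f.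
Proof.
move=> u0; have [C C0 hC] := dil32.
have pw n f : E f -> E (dilation ((3 / 2) ^+ n)^-1 f) /\ nrm (dilation ((3 / 2) ^+ n)^-1 f) <= C ^+ n * nrm f.
  move=> Ef; elim: n => [|n [IH1 IH2]].
    have -> : dilation ((3 / 2) ^+ 0)^-1 f = f by apply/funext => t; rewrite /dilation expr0 invr1 mul1r.
    by rewrite expr0 mul1r.
  have -> : dilation ((3 / 2) ^+ n.+1)^-1 f = dilation (3 / 2)^-1 (dilation ((3 / 2) ^+ n)^-1 f).
    by apply/funext => t; rewrite /dilation exprS invfM mulrA [_ * (3 / 2)^-1]mulrC.
  have [h1 h2] := hC _ IH1; split=> //; apply: (le_trans h2).
  by rewrite exprS -mulrA; exact: ler_wpM2l.
have [n hn] : exists n, u <= (3 / 2) ^+ n.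
  have : `|(3 / 2)^-1 : R| < 1 by rewrite ger0_norm; lra.
  move=> /cvg_expr/cvgrPdist_lt/(_ u^-1) [|n _ /(_ n (leqnn _))]; first by rewrite invr_gt0.
  rewrite sub0r normrN ger0_norm; last by rewrite exprn_ge0 // invr_ge0; lra.
  have p0 : 0 < (3 / 2 : R) ^+ n by apply: exprn_gt0; lra.
  by rewrite exprVn ltf_pV2 // => h; exists n; exact: ltW.
exists (C ^+ n); first exact: exprn_ge0.
move=> f Ef; have [h1 h2] := pw n f Ef; have mf := E_meas Ef.
have p0 : 0 < (3 / 2 : R) ^+ n by apply: exprn_gt0; lra.
have [h3 h4] : E (dilation u^-1 f) /\ nrm (dilation u^-1 f) <= nrm (dilation ((3 / 2) ^+ n)^-1 f).
  apply: E_le => //; first exact: dil_meas.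
  by move=> v v0; rewrite !fdistr_dil //; apply: lee_wpmul2r; rewrite ?lee_fin // fdistr_ge0.
by split=> //; exact: le_trans h2.
Qed.

Lemma opnorm_bound (T : (R -> R) -> R -> R) : (exists2 C : R, 0 <= C & forall f, E f ->
    E (T f) /\ nrm (T f) <= C * nrm f) ->
  0 <= fine (opnorm E nrm T) /\ forall f, E f -> nrm (T f) <= fine (opnorm E nrm T) * nrm f.
Proof.
move=> [C C0 hC]; rewrite /opnorm; set S := (X in ereal_inf X).
have SC : S C%:E by exists C.
have lb : (0 <= ereal_inf S)%E by apply: le_ereal_inf_tmp => x [D [D0 _] <-]; rewrite lee_fin.
have fi : ereal_inf S \is a fin_num.
  by rewrite ge0_fin_numE //; apply: le_lt_trans (ereal_inf_lbound SC) _; exact: ltry.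
split; first exact: fine_ge0.
move=> f Ef; have [ETf _] := hC f Ef; have n0 := sqb_ge0 hE Ef.
have [z|np] := leP (nrm f) 0.
  have e : nrm f = 0 by apply/eqP; rewrite eq_le z n0.
  by have := (hC f Ef).2; rewrite e !mulr0.
rewrite -ler_pdivrMr // -lee_fin (fineK fi).
apply: le_ereal_inf_tmp => x [D [D0 hD] <-]; rewrite lee_fin ler_pdivrMr //.
exact: (hD f Ef).2.
Qed.

End quasi_banach_function_spaces.

(** * Boyd indices as norm bounds, and series in [E] *)

Section boyd_and_series.
Set Implicit Arguments.
Unset Strict Implicit.
Variable R : realType.
Implicit Types (f g : R -> R) (t v u s : R).
Local Notation lambda := (@lebesgue_measure R).
Variables (E : set (R -> R)) (nrm : (R -> R) -> R).
Hypothesis hE : symmetric_quasi_Banach E nrm.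

(** [n <= 0] is set apart because [ln] vanishes there by convention. For [n > 0], the value [+oo] of
    the quotient means [n = 1], and a quotient above [r > 0] forces [0 < ln n < ln u / r]. *)
Lemma boyd_quotient_gt u r : 1 < u -> 0 < r -> (r%:E < boyd_quotient E nrm u)%E ->
  fine (opnorm E nrm (dilation u^-1)) <= u `^ r^-1.
Proof.
move=> u1 r0; have u0 : 0 < u by lra.
rewrite /boyd_quotient; set n := fine _.
have b1 : 1 <= u `^ r^-1 by rewrite -(powRr0 u); apply: ler_powR; rewrite ?invr_ge0; lra.
have [n0 _|n0] := leP n 0; first by lra.
have lu : 0 < ln u by apply: ln_gt0.
rewrite /=; case: eqP => [/eqP|/eqP ln0].
  by rewrite ln_eq0 // => /eqP ->.
rewrite lte_fin => h.
have l0 : 0 < ln n.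
  rewrite ltNge; apply/negP => l0; have : ln u / ln n <= 0 by rewrite pmulr_rle0 // invr_le0.
  lra.
rewrite -ler_ln ?posrE ?powR_gt0 // ln_powR mulrC ler_pdivlMr //; apply: ltW.
by rewrite mulrC -ltr_pdivlMr.
Qed.

Lemma boyd_quotient_lt u r : 0 < u -> u < 1 -> 0 < r -> (0 < boyd_quotient E nrm u)%E ->
  (boyd_quotient E nrm u < r%:E)%E ->
  fine (opnorm E nrm (dilation u^-1)) <= u `^ r^-1.
Proof.
move=> u0 u1 r0.
rewrite /boyd_quotient; set n := fine _.
have [n0 _ _|n0] := leP n 0; first by apply: (le_trans n0); exact: powR_ge0.
have lu : ln u < 0 by apply: ln_lt0; rewrite u0.
rewrite /=; case: eqP => // /eqP ln0; rewrite !lte_fin => h1 h2.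
have l0 : ln n < 0.
  rewrite ltNge; apply/negP => l0; have : ln u / ln n <= 0 by rewrite nmulr_rle0 // invr_ge0.
  lra.
rewrite -ler_ln ?posrE ?powR_gt0 // ln_powR mulrC ler_pdivlMr //; apply: ltW.
by move: h2; rewrite ltr_ndivrMr // mulrC.
Qed.

Lemma dilation_opnorm u : 0 < u -> forall f, E f ->
  E (dilation u^-1 f) /\ nrm (dilation u^-1 f) <= fine (opnorm E nrm (dilation u^-1)) * nrm f.
Proof.
move=> u0 f Ef; have h := dilation_bounded hE u0; have [C C0 hC] := h.
by split; [exact: (hC f Ef).1|exact: (opnorm_bound hE h).2].
Qed.

(* The quotient converges, since lim is 0 for a divergent filter and p > 0. *)
Lemma boyd_p_dil p : 0 < p -> (p%:E < boyd_p E nrm)%E -> exists p' U : R,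
  [/\ p < p', 1 <= U & forall u f, U < u -> E f ->
    E (dilation u^-1 f) /\ nrm (dilation u^-1 f) <= u `^ p'^-1 * nrm f].
Proof.
move=> p0; rewrite /boyd_p; set F := fmap _ _ => hp.
have [cv|/dvgP nc] := pselect (cvg F); last by move: hp; rewrite nc lte_fin; lra.
have [p' pp' hp'] : exists2 p', p < p' & (p'%:E < lim F)%E.
  move: hp; case: (lim F) => [r| |] //.
    by rewrite lte_fin => h; exists ((p + r) / 2); rewrite ?lte_fin; lra.
  by move=> _; exists (p + 1); rewrite ?ltry //; lra.
have nb : nbhs (lim F) [set x : \bar R | (p'%:E < x)%E].
  by apply: open_nbhs_nbhs; split => //; exact: open_ereal_gt_ereal.
have [U [_ hU]] := cv _ nb.
exists p', (Num.max 1 U); split => //; first by rewrite le_max lexx.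
move=> u f; rewrite gt_max => /andP[u1 uU] Ef.
have u0 : 0 < u by lra.
have [h1 h2] := dilation_opnorm u0 Ef; split=> //; apply: (le_trans h2).
apply: ler_wpM2r; first exact: (sqb_ge0 hE).
by apply: boyd_quotient_gt => //; [lra|exact: hU].
Qed.

(** The lower bound by [p] excludes the default value of [lim] and also negative quotients, which
    correspond to dilation norms above 1 and would break the estimate for [u < 1]. *)
Lemma boyd_q_dil p q : 0 < p -> (p%:E < boyd_q E nrm)%E -> (boyd_q E nrm < q%:E)%E ->
  exists q' U : R, [/\ 0 < q', q' < q, 0 < U & forall u f, 0 < u -> u < U -> E f ->
    E (dilation u^-1 f) /\ nrm (dilation u^-1 f) <= u `^ q'^-1 * nrm f].
Proof.
move=> p0; rewrite /boyd_q; set F := fmap _ _ => hp hq.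
have [cv|/dvgP nc] := pselect (cvg F); last by move: hp; rewrite nc lte_fin; lra.
have [q' [q'0 qq' hq']] : exists q', [/\ 0 < q', q' < q & (lim F < q'%:E)%E].
  move: hp hq; case: (lim F) => [r| |] //.
  by rewrite !lte_fin => h1 h2; exists ((q + r) / 2); rewrite ?lte_fin; split; lra.
have nb : nbhs (lim F) ([set x : \bar R | (p%:E < x)%E] `&` [set x : \bar R | (x < q'%:E)%E]).
  apply: open_nbhs_nbhs; split => //.
  by apply: openI; [exact: open_ereal_gt_ereal|exact: open_ereal_lt_ereal].
have /nbhs_ballP[e /= e0 he] := cv _ nb.
exists q', (Num.min 1 e); split => //; first by rewrite lt_min ltr01.
move=> u f u0; rewrite lt_min => /andP[u1 ue] Ef.
have [h1 h2] := dilation_opnorm u0 Ef; split=> //; apply: (le_trans h2).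
apply: ler_wpM2r; first exact: (sqb_ge0 hE).
have [hu1 hu2] : (p%:E < boyd_quotient E nrm u)%E /\ (boyd_quotient E nrm u < q'%:E)%E.
  by apply: he => //=; rewrite /ball /= sub0r normrN gtr0_norm.
by apply: boyd_quotient_lt => //; apply: lt_trans hu1; rewrite lte_fin.
Qed.

Lemma E_sum (f : nat -> R -> R) n : (forall k, E (f k)) -> E (fun t => \sum_(k < n) f k t).
Proof.
move=> Ef; elim: n => [|n IH].
  by have := (E_0 hE).1; congr E; apply/funext => t; rewrite big_ord0.
by have := E_D hE IH (Ef n); congr E; apply/funext => t; rewrite big_ord_recr.
Qed.

Lemma sum_ordB (h : nat -> R) m n : (m <= n)%N ->
  \sum_(k < n) h k - \sum_(k < m) h k = \sum_(i < n - m) h (m + i)%N.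
Proof.
move=> mn; rewrite -(big_mkord xpredT h) -(big_mkord xpredT h) -(big_mkord xpredT (fun i => h (m + i)%N)).
rewrite (big_cat_nat (leq0n m) mn) /= addrAC subrr add0r -[m in LHS]add0n big_addn.
by apply: eq_bigr => i _; rewrite addnC.
Qed.

Lemma nrmN f : E f -> nrm (fun t => - f t) = nrm f.
Proof.
move=> Ef; have := sqb_homo hE (-1) Ef; rewrite normrN1 mul1r => <-.
by congr nrm; apply/funext => t; rewrite mulN1r.
Qed.

(* Completeness gives a limit F of the partial sums in quasi-norm; F dominates
   them almost everywhere since the norm of the positive part of their
   difference is dominated by the tails. *)
Lemma E_series (K A th : R) (f : nat -> R -> R) : 1 <= K ->
  (forall f g, E f -> E g -> nrm (fun t => f t + g t) <= K * (nrm f + nrm g)) ->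
  0 <= A -> 0 <= th -> K * th <= 2^-1 ->
  (forall k, E (f k)) -> (forall k t, 0 < t -> 0 <= f k t) ->
  (forall k, nrm (f k) <= A * th ^+ k) ->
  exists2 F, E F & {ae lambda, forall t, 0 < t -> forall n, \sum_(k < n) f k t <= F t}.
Proof.
move=> K1 hK A0 th0 Kth Ef f0 fA.
have th12 : th <= 2^-1 by apply: le_trans Kth; rewrite ler_peMl.
(* Each use of the quasi-triangle inequality costs a factor [K], which [K * th <= 2^-1] absorbs into
   the geometric decay. *)
have tail n m : nrm (fun t => \sum_(i < n) f (m + i)%N t) <= 2 * K * A * th ^+ m.
  elim: n m => [|n IH] m.
    have -> : (fun t => \sum_(i < 0) f (m + i)%N t) = (fun=> 0) by apply/funext => t; rewrite big_ord0.
    by rewrite (E_0 hE).2 !mulr_ge0 ?exprn_ge0 //; lra.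
  have -> : (fun t => \sum_(i < n.+1) f (m + i)%N t) = (fun t => f m t + \sum_(i < n) f (m.+1 + i)%N t).
    apply/funext => t; rewrite big_ord_recl addn0; congr (_ + _); apply: eq_bigr => i _.
    by rewrite addSnnS.
  apply: (le_trans (hK _ _ (Ef m) _)); first by apply: (E_sum (f := fun i => f (m.+1 + i)%N)) => k.
  have h1 := fA m; have h2 := IH m.+1.
  have z0 : 0 <= A * th ^+ m by rewrite mulr_ge0 // exprn_ge0.
  have : 2 * K * A * th ^+ m.+1 <= A * th ^+ m.
    rewrite exprS; have -> : 2 * K * A * (th * th ^+ m) = (2 * (K * th)) * (A * th ^+ m) by ring.
    by apply: ler_piMl => //; lra.
  move: (th ^+ m) (th ^+ m.+1) h1 h2 z0 => x y h1 h2 z0 h3.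
  have -> : 2 * K * A * x = K * (2 * (A * x)) by ring.
  by apply: ler_wpM2l; lra.
pose S n t := \sum_(k < n) f k t.
have ES n : E (S n) by exact: E_sum.
have Sdiff m n : (m <= n)%N -> nrm (fun t => S n t - S m t) <= 2 * K * A * th ^+ m.
  move=> mn; apply: le_trans (tail (n - m)%N m); rewrite le_eqVlt; apply/orP; left; apply/eqP.
  by congr nrm; apply/funext => t; rewrite /S (sum_ordB (f ^~ t)).
have [F EF SF] : exists2 F, E F & (fun n => nrm (fun t => S n t - F t)) @ \oo --> 0.
  apply: (sqb_complete hE) => // e e0.
  have c0 : 0 < 2 * K * A + 1 by nra.
  have : `|th| < 1 by rewrite ger0_norm //; lra.
  move=> /cvg_expr/cvgrPdist_lt/(_ (e / (2 * K * A + 1))) [|n0 _ h]; first by rewrite divr_gt0.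
  exists n0 => m n hm hn.
  have sm k : (n0 <= k)%N -> 2 * K * A * th ^+ k < e.
    move=> hk; have := h k hk; rewrite sub0r normrN ger0_norm ?exprn_ge0 // ltr_pdivlMr // => h'.
    have t0 : 0 <= th ^+ k by exact: exprn_ge0.
    move: (th ^+ k) h' t0 => x h' t0; nra.
  case/orP: (leq_total m n) => mn.
    apply: le_lt_trans (sm m hm); apply: le_trans (Sdiff m n mn).
    have EB : E (fun t => S n t - S m t) by exact: (E_B hE).
    rewrite -(nrmN EB) le_eqVlt; apply/orP; left; apply/eqP.
    by congr nrm; apply/funext => t; rewrite opprB.
  by apply: le_lt_trans (sm n hn); exact: Sdiff.
exists F => //.
have dom m : {ae lambda, forall t, 0 < t -> S m t <= F t}.
  pose G t := Num.max (S m t - F t) 0.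
  have mG : measurable_fun (@Rpos R) G.
    by apply: measurable_maxr => //; apply: (E_meas hE); exact: (E_B hE (ES m) EF).
  have GS n : (m <= n)%N -> E G /\ nrm G <= nrm (fun t => S n t - F t).
    move=> mn; apply: (E_dom hE) => //; first exact: (E_B hE).
    move=> t t0; rewrite ger0_norm ?le_max ?lexx ?orbT //.
    rewrite /G ge_max normr_ge0 andbT; apply: le_trans (ler_norm _); rewrite lerD2r.
    by rewrite -subr_ge0 /S (sum_ordB (f ^~ t)) // sumr_ge0 // => i _; exact: f0.
  have [EG _] := GS m (leqnn m).
  have G0 : nrm G = 0.
    apply/eqP; rewrite eq_le (sqb_ge0 hE) // andbT.
    apply: (cvgr_to_ge SF).
    by exists m => // n /= mn; exact: (GS n mn).2.
  have := (sqb_eq0 hE EG).1 G0; apply: aeS => t h t0.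
  have := h t0; rewrite /G => /eqP; rewrite eq_le ge_max lexx andbT => /andP[+ _].
  by rewrite subr_le0.
have := ae_foralln dom; apply: aeS => t h t0 n; exact: h.
Qed.

End boyd_and_series.

(** * Calderon's operator *)

Section hardy_integrals.
Set Implicit Arguments.
Unset Strict Implicit.
Variable R : realType.
Implicit Types (t v u s a b : R).
Local Notation lambda := (@lebesgue_measure R).

Lemma powRX (x e : R) k : 0 <= x -> (x ^+ k) `^ e = (x `^ e) ^+ k.
Proof.
move=> x0; elim: k => [|k IH]; first by rewrite !expr0 powR1.
by rewrite !exprS powRM ?exprn_ge0 // IH.
Qed.

Lemma expr_unbounded (c B : R) : 1 < B -> exists k, c < B ^+ k.
Proof.
move=> B1; have [c0|c0] := leP c 0; first by exists 0%N; rewrite expr0; lra.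
have B0 : 0 < B by lra.
have : `|B^-1| < 1 by rewrite ger0_norm ?invr_ge0 ?ltW // invf_lt1.
move=> /cvg_expr/cvgrPdist_lt/(_ c^-1) [|n _ /(_ n (leqnn _))]; first by rewrite invr_gt0.
rewrite sub0r normrN ger0_norm; last by rewrite exprn_ge0 // invr_ge0 ltW.
by rewrite exprVn ltf_pV2 ?posrE ?exprn_gt0 // => h; exists n.
Qed.

Lemma sum_geom_le (x : R) n : 0 <= x -> x < 1 -> \sum_(k < n) x ^+ k <= (1 - x)^-1.
Proof.
move=> x0 x1; have d0 : 0 < 1 - x by lra.
rewrite -[leRHS]mul1r ler_pdivlMr //.
have := subrX1 x n; set S := \sum_(_ < _) _ => h.
have : 0 <= x ^+ n by exact: exprn_ge0.
by move: (x ^+ n) S h => y S h y0; nra.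
Qed.

(** Countable subadditivity of the integral: finite unions are made disjoint, then monotone
    convergence passes to the whole cover. It turns bounds on discrete sums into bounds on Hardy
    integrals. *)
Lemma integral_cover (w : R -> \bar R) (W A : set R) (D : nat -> set R) (c : nat -> R) (X : R) :
  measurable W -> measurable_fun W w -> (forall s, W s -> (0 <= w s)%E) ->
  (forall k, measurable (D k)) -> (forall k, D k `<=` W) ->
  (forall k, (\int[lambda]_(s in D k) w s <= (c k)%:E)%E) ->
  measurable A -> A `<=` \bigcup_k D k -> (forall n, \sum_(k < n) c k <= X) ->
  (\int[lambda]_(s in A) w s <= X%:E)%E.
Proof.
move=> mW mw w0 mD DW hD mA AD hX.
pose F n := \big[setU/set0]_(k < n) D k.
have FS n : F n.+1 = F n `|` D n by rewrite /F big_ord_recr.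
have mF n : measurable (F n).
  by elim: n => [|n IH]; [rewrite /F big_ord0|rewrite FS; exact: measurableU].
have FW n : F n `<=` W.
  elim: n => [|n IH]; first by rewrite /F big_ord0.
  by rewrite FS => s [/IH //|/DW].
have Fle n : F n `<=` F n.+1 by rewrite FS; exact: subsetUl.
have FD : \bigcup_n F n = \bigcup_n D n.
  apply/seteqP; split=> s [n _ h]; last by exists n.+1 => //; rewrite FS; right.
  elim: n h => [|n IH]; first by rewrite /F big_ord0.
  by rewrite FS => -[/IH //|Dn]; exists n.
have wF (B : set R) : B `<=` W -> measurable_fun B w by move=> BW; apply: measurable_funS mw.
have int n : (\int[lambda]_(s in F n) w s <= (\sum_(k < n) c k)%:E)%E.
  elim: n => [|n IH]; first by rewrite /F !big_ord0 integral_set0.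
  have -> : F n.+1 = F n `|` (D n `\` F n).
    by rewrite FS; apply/seteqP; split=> s [h|h]; [left|case: (pselect (F n s)); [left|right]|left|right; case: h].
  have DFW : D n `\` F n `<=` W by move=> s [/DW].
  have UW : F n `|` D n `\` F n `<=` W by move=> s [/FW|/DFW].
  have dj : [disjoint F n & (D n `\` F n)]%classic by apply/disj_setPS => s [h1 [_ h2]].
  have mDF : measurable (D n `\` F n) by exact: (measurableD (mD n) (mF n)).
  have wU s : (F n `|` D n `\` F n) s -> (0 <= w s)%E by move=> /UW /w0.
  rewrite (ge0_integral_setU lambda (mF n) mDF (wF _ UW) wU dj) big_ord_recr EFinD.
  apply: leeD => //; apply: le_trans (hD n).
  apply: ge0_subset_integral; [exact: mDF|exact: mD|exact: (wF _ (DW n))|by move=> s /DW /w0|].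
  by move=> s [].
have AF : A `<=` \bigcup_n F n by rewrite FD.
have AW : \bigcup_n F n `<=` W by move=> s [n _ /FW].
have mU : measurable (\bigcup_n F n) by exact: bigcupT_measurable.
apply: (@le_trans _ _ (\int[lambda]_(s in \bigcup_n F n) w s)%E).
  by apply: ge0_subset_integral => //; [exact: wF|move=> s /AW /w0].
have hcv : (\int[lambda]_(s in F n) w s)%E @[n --> \oo] --> (\int[lambda]_(s in \bigcup_n F n) w s)%E.
  apply: ge0_nondecreasing_set_cvg_integral => //.
  - by apply/nondecreasing_seqP => n; apply/subsetPset; exact: Fle.
  - by move=> n; exact: wF.
  - by move=> n s /FW /w0.
apply: (cvge_to_le hcv); exists 0%N => // n _ /=; apply: (le_trans (int n)).
by rewrite lee_fin.
Qed.

Variables (g : R -> R) (e : R).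
Hypothesis g0 : forall s, 0 < s -> 0 <= g s.
Hypothesis gm : forall s t, 0 < s -> s <= t -> g t <= g s.
Hypothesis e0 : 0 <= e.

Let w s := (s `^ e * g s / s)%:E.

Lemma weight_meas : measurable_fun (@Rpos R) (fun s => (s `^ e * g s / s)%:E).
Proof.
apply/measurable_EFinP; apply: measurable_funM.
  apply: measurable_funM; last exact: nonincr_measurable.
  exact: measurable_funTS (measurable_powR e).
by apply: nonincr_measurable => s t s0 st; rewrite lef_pV2 ?posrE //; exact: lt_le_trans st.
Qed.

Lemma weight_ge0 s : 0 < s -> (0 <= (s `^ e * g s / s)%:E)%E.
Proof. by move=> s0; rewrite lee_fin; apply: divr_ge0; [by rewrite mulr_ge0 ?powR_ge0 ?g0|exact: ltW]. Qed.

Lemma weight_piece a b : 0 < a -> a <= b ->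
  (\int[lambda]_(s in `]a, b]) (s `^ e * g s / s)%:E <= ((b - a) * (b `^ e * g a / a))%:E)%E.
Proof.
move=> a0 ab.
have ap s : `]a, b]%classic s -> 0 < s by rewrite /= in_itv /= => /andP[h _]; exact: lt_trans h.
apply: (@le_trans _ _ (\int[lambda]_(s in `]a, b]) (cst (b `^ e * g a / a)%:E s))%E).
  apply: ge0_le_integral => //.
  - by move=> s /ap /weight_ge0.
  - by apply: (measurable_funS (@measurable_Rpos R) _ weight_meas) => s /ap.
  - move=> s sab; have s0 := ap s sab; move: sab; rewrite /= in_itv /= => /andP[as_ sb].
    rewrite lee_fin; apply: ler_pM; rewrite ?invr_ge0 ?(ltW s0) ?mulr_ge0 ?powR_ge0 ?g0 //.
      apply: ler_pM; rewrite ?powR_ge0 ?g0 //; last by apply: gm => //; exact: ltW.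
      by apply: ge0_ler_powR; rewrite ?nnegrE // ltW // (lt_le_trans s0).
    by rewrite lef_pV2 ?posrE // ltW.
rewrite integral_cst; last exact: measurable_itv.
rewrite /= lebesgue_measure_itv /= lte_fin; case: ltP => h; first by rewrite -EFinD -EFinM mulrC.
by rewrite mule0 lee_fin mulr_ge0 ?subr_ge0 // mulr_ge0 ?invr_ge0 ?(ltW a0) // mulr_ge0 ?powR_ge0 ?g0.
Qed.

Lemma head_integral_le (B t X : R) : 1 < B -> 0 < t ->
  (forall n, \sum_(k < n) (B - 1) * (t `^ e / (B `^ e) ^+ k) * g ((B ^+ k.+1)^-1 * t) <= X) ->
  (\int[lambda]_(s in `]0%R, t[) (s `^ e * g s / s)%:E <= X%:E)%E.
Proof.
move=> B1 t0 hX; have B0 : 0 < B by lra.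
have Bk k : 0 < B ^+ k by exact: exprn_gt0.
pose D k := `](B ^+ k.+1)^-1 * t, (B ^+ k)^-1 * t]%classic.
have Dp k : 0 < (B ^+ k)^-1 * t by rewrite mulr_gt0 ?invr_gt0.
apply: (@integral_cover w (@Rpos R) _ D (fun k => (B - 1) * (t `^ e / (B `^ e) ^+ k) * g ((B ^+ k.+1)^-1 * t))) => //.
- exact: measurable_Rpos.
- exact: weight_meas.
- exact: weight_ge0.
- by move=> k; exact: measurable_itv.
- by move=> k s; rewrite /D /= in_itv /= => /andP[h _]; exact: lt_trans h.
- move=> k; apply: (le_trans (weight_piece (Dp k.+1) _)).
    rewrite ler_pM2r // lef_pV2 ?posrE // exprS ler_peMl ?ltW //.
  have bV : B^-1 `^ e = (B `^ e)^-1 by rewrite -powR_inv1 ?ltW // -powRrM mulN1r powRN.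
  have Bi : 0 <= B^-1 by rewrite invr_ge0 ltW.
  rewrite lee_fin le_eqVlt; apply/orP; left; apply/eqP.
  rewrite powRM ?(ltW t0) ?invr_ge0 ?(ltW (Bk k)) // -exprVn powRX // bV.
  have h : 0 < B `^ e by exact: powR_gt0.
  rewrite !exprVn exprS; have := Bk k; have := exprn_gt0 k h.
  move: (_ ^+ k) (B ^+ k) (g _) => x y z x0 y0; field.
  by rewrite !gt_eqF.
- move=> s; rewrite /= in_itv /= => /andP[s0 st].
  have [k0 hk0] := expr_unbounded (t / s) B1.
  have ex : exists k, t / s < B ^+ k by exists k0.
  (* The least exponent with [t / s < B ^+ k] locates the piece containing [s]; it is not 0 because
     [s < t]. *)
  case: (ex_minnP ex) => -[|k] hk kmin.
    by move: hk; rewrite expr0 ltr_pdivrMr // mul1r; lra.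
  exists k => //; rewrite /D /= in_itv /= ltr_pdivrMl // ler_pdivlMl //.
  rewrite ltr_pdivrMr // in hk; rewrite hk /=; rewrite leNgt; apply/negP => h.
  have := kmin k; rewrite ltr_pdivrMr // => /(_ h); by rewrite ltnn.
Qed.

Lemma tail_integral_le (B t X : R) : 1 < B -> 0 < t ->
  (forall n, \sum_(k < n) (B - 1) * (t `^ e * (B `^ e) ^+ k.+1) * g (B ^+ k * t) <= X) ->
  (\int[lambda]_(s in `]t, +oo[) (s `^ e * g s / s)%:E <= X%:E)%E.
Proof.
move=> B1 t0 hX; have B0 : 0 < B by lra.
have Bk k : 0 < B ^+ k by exact: exprn_gt0.
pose D k := `]B ^+ k * t, B ^+ k.+1 * t]%classic.
have Dp k : 0 < B ^+ k * t by rewrite mulr_gt0.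
apply: (@integral_cover w (@Rpos R) _ D (fun k => (B - 1) * (t `^ e * (B `^ e) ^+ k.+1) * g (B ^+ k * t))) => //.
- exact: measurable_Rpos.
- exact: weight_meas.
- exact: weight_ge0.
- by move=> k; exact: measurable_itv.
- by move=> k s; rewrite /D /= in_itv /= => /andP[h _]; exact: lt_trans h.
- move=> k; apply: (le_trans (weight_piece (Dp k) _)).
    by rewrite ler_pM2r // exprS ler_peMl ?ltW.
  rewrite lee_fin le_eqVlt; apply/orP; left; apply/eqP.
  rewrite powRM ?ltW // powRX ?ltW // exprS [(B `^ e) ^+ k.+1]exprS.
  have := Bk k; move: ((B `^ e) ^+ k) (B ^+ k) (g _) => x y z y0; field.
  by rewrite !gt_eqF.
- move=> s; rewrite /= in_itv /= andbT => ts.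
  have [k0 hk0] := expr_unbounded (s / t) B1.
  have ex : exists k, s / t <= B ^+ k by exists k0; exact: ltW.
  case: (ex_minnP ex) => -[|k] hk kmin.
    by move: hk; rewrite expr0 ler_pdivrMr // mul1r; lra.
  exists k => //; rewrite /D /= in_itv /=.
  rewrite ler_pdivrMr // in hk; rewrite hk andbT ltNge; apply/negP => h.
  have := kmin k; rewrite ler_pdivrMr // => /(_ h); by rewrite ltnn.
Qed.

(** On []t / 2, t[] each factor is bounded below separately: [s ^ e] by [(t / 2) ^ e], [g s] by
    [g t], and [1 / s] by [1 / t]. *)
Lemma head_integral_ge t : 0 < t ->
  ((2 `^ (- (e + 1)) * (t `^ e * g t))%:E <= \int[lambda]_(s in `]0%R, t[) (s `^ e * g s / s)%:E)%E.
Proof.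
move=> t0; have ap s : `]t / 2, t[%classic s -> 0 < s by rewrite /= in_itv /= => /andP[h _]; lra.
apply: (@le_trans _ _ (\int[lambda]_(s in `](t / 2)%R, t[) w s)%E); last first.
  apply: ge0_subset_integral => //.
  - apply: (measurable_funS (@measurable_Rpos R) _ weight_meas) => s.
    by rewrite /= in_itv /= => /andP[].
  - by move=> s; rewrite /= in_itv /= => /andP[s0 _]; exact: weight_ge0.
  - by move=> s; rewrite /= !in_itv /= => /andP[s0 ->]; rewrite andbT; lra.
apply: (@le_trans _ _ (\int[lambda]_(s in `](t / 2)%R, t[) (cst ((t / 2) `^ e * g t / t)%:E s))%E).
  rewrite integral_cst; last exact: measurable_itv.
  rewrite /= lebesgue_measure_itv /= lte_fin ifT; last lra.
  rewrite -EFinD -EFinM lee_fin le_eqVlt; apply/orP; left; apply/eqP.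
  rewrite powRN powRD ?pnatr_eq0 ?implybT // powRr1 ?ler0n // powRM ?invr_ge0 ?ler0n ?ltW //.
  have -> : 2^-1 `^ e = (2 `^ e)^-1 by rewrite -powR_inv1 ?ler0n // -powRrM mulN1r powRN.
  have h : 0 < (2 : R) `^ e by exact: powR_gt0.
  by field; rewrite !gt_eqF.
apply: ge0_le_integral => //.
- by move=> s sab; rewrite lee_fin; apply: divr_ge0; [by rewrite mulr_ge0 ?powR_ge0 ?g0|exact: ltW].
- by apply: (measurable_funS (@measurable_Rpos R) _ weight_meas) => s /ap.
- move=> s sab; have s0 := ap s sab; move: sab; rewrite /= in_itv /= => /andP[as_ sb].
  rewrite lee_fin; apply: ler_pM; rewrite ?invr_ge0 ?(ltW t0) ?mulr_ge0 ?powR_ge0 ?g0 //.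
    apply: ler_pM; rewrite ?powR_ge0 ?g0 //; last by apply: gm => //; exact: ltW.
    by apply: ge0_ler_powR; rewrite ?nnegrE //; lra.
  by rewrite lef_pV2 ?posrE // ltW.
Qed.

End hardy_integrals.

Section power_integral.
Set Implicit Arguments.
Unset Strict Implicit.
Variable R : realType.
Local Notation lambda := (@lebesgue_measure R).

(** [head_integral_le] for the constant function 1 with ratio 2. The geometric sum exceeds the exact
    value [t ^ e / e] only by a factor depending on [e]. *)
Lemma power_integral_le (e t : R) : 0 < e -> 0 < t ->
  (\int[lambda]_(s in `]0%R, t[) (s `^ e * 1 / s)%:E <= ((1 - (2 `^ e)^-1)^-1 * t `^ e)%:E)%E.
Proof.
move=> e0 t0; apply: (@head_integral_le R (fun=> 1) e _ _ (ltW e0) 2 t) => //.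
  by rewrite ltr1n.
move=> n; have h1 : 1 < (2 : R) `^ e by have := @gt0_ltr_powR R e e0 1 2; rewrite powR1; apply; rewrite ?nnegrE ?ler01 ?ler0n ?ltr1n.
have e1 : (2 - 1 : R) = 1 by lra.
under eq_bigr => k _ do rewrite mulr1 e1 mul1r -exprVn.
rewrite -mulr_sumr mulrC; apply: ler_wpM2r; first exact: powR_ge0.
by apply: sum_geom_le; rewrite ?invr_ge0 ?powR_ge0 // invf_lt1 // powR_gt0.
Qed.

End power_integral.

Section calderon_operator.
Set Implicit Arguments.
Unset Strict Implicit.
Variable R : realType.
Implicit Types (t v u s a b : R).
Local Notation lambda := (@lebesgue_measure R).

Definition hardy_head (g : R -> R) (e t : R) : \bar R :=
  (\int[lambda]_(s in `]0%R, t[) (s `^ e * g s / s)%:E)%E.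

Definition hardy_tail (g : R -> R) (e t : R) : \bar R :=
  (\int[lambda]_(s in `]t, +oo[) (s `^ e * g s / s)%:E)%E.

Lemma powR_base (d c U : R) : 0 < d -> exists B : R, [/\ 1 < B, U < B & c <= B `^ d].
Proof.
move=> d0; pose c' := Num.max c 1; have c'1 : 1 <= c' by rewrite le_max lexx orbT.
pose B := Num.max 2 (Num.max (U + 1) (c' `^ d^-1)).
have c'0 : 0 <= c' by exact: le_trans ler01 c'1.
have B2 : 2 <= B by rewrite le_max lexx.
have BU : U + 1 <= B by rewrite !le_max lexx orbT.
have Bc : c' `^ d^-1 <= B by rewrite !le_max lexx !orbT.
exists B; split; [lra|lra|].
apply: (@le_trans _ _ c'); first by rewrite le_max lexx.
apply: (@le_trans _ _ ((c' `^ d^-1) `^ d)).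
  by rewrite -powRrM mulVf ?gt_eqF // powRr1.
by apply: ge0_ler_powR; rewrite ?nnegrE ?powR_ge0 ?(ltW d0) //; exact: le_trans B2.
Qed.

Lemma ae_exists (P : R -> Prop) a b : 0 <= a -> a < b ->
  {ae lambda, forall t, 0 < t -> P t} -> exists t, [/\ a < t, t <= b & P t].
Proof.
move=> a0 ab [N [mN N0 hN]]; apply: contrapT => h.
have sub : `]a, b]%classic `<=` N.
  move=> t; rewrite /= in_itv /= => /andP[at_ tb]; apply: hN => /= hP.
  by apply: h; exists t; split=> //; apply: hP; exact: le_lt_trans at_.
have mab : measurable (`]a, b]%classic : set R) by exact: measurable_itv.
have : (lambda `]a, b]%classic <= lambda N)%E by apply: le_measure; rewrite ?inE.
rewrite [X in (_ <= X)%E](_ : _ = 0%E); last exact: N0.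
by rewrite lebesgue_measure_itv /= lte_fin ab -EFinB lee_fin; lra.
Qed.

Variables (E : set (R -> R)) (nrm : (R -> R) -> R).
Hypothesis hE : symmetric_quasi_Banach E nrm.
Variable g : R -> R.
Hypothesis Eg : E g.
Hypothesis g0 : forall s, 0 < s -> 0 <= g s.
Hypothesis gm : forall s t, 0 < s -> s <= t -> g t <= g s.

(** [f k] is a term of the discretised Hardy integral divided by [t ^ (1/p)]. The Boyd estimate
    makes its norm geometric of ratio [B ^ (1/p' - 1/p)]; [B] is taken beyond [U], so that every
    dilation obeys the estimate, and so large that [K] times the ratio is at most 1/2. *)
Lemma head_dominated p : 0 < p -> (p%:E < boyd_p E nrm)%E ->
  exists2 F, E F & {ae lambda, forall t, 0 < t -> (hardy_head g p^-1 t <= (t `^ p^-1 * F t)%:E)%E}.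
Proof.
move=> p0 hp; have [p' [U [pp' U1 hU]]] := boyd_p_dil hE p0 hp.
have [K K1 hK] := E_K hE.
have p'0 : 0 < p' by lra.
have d0 : 0 < p^-1 - p'^-1 by rewrite subr_gt0 ltf_pV2.
have [B [B1 BU Bd]] := powR_base (2 * K) U d0.
have B0 : 0 < B by lra.
have Bp0 : 0 < B `^ p^-1 by exact: powR_gt0.
have Bp'0 : 0 < B `^ p'^-1 by exact: powR_gt0.
pose f k t := (B - 1) * (B `^ p^-1)^-1 ^+ k * dilation (B ^+ k.+1)^-1 g t.
have BkU k : U < B ^+ k.+1 by apply: (lt_le_trans BU); rewrite exprS; apply: ler_peMr; [exact: ltW|by rewrite exprn_ege1 // ltW].
have Bk0 k : 0 < B ^+ k by exact: exprn_gt0.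
have c0 k : 0 <= (B - 1) * (B `^ p^-1)^-1 ^+ k by rewrite mulr_ge0 ?exprn_ge0 ?invr_ge0 ?powR_ge0 //; lra.
have [F EF hF] : exists2 F, E F & {ae lambda, forall t, 0 < t -> forall n, \sum_(k < n) f k t <= F t}.
  apply: (E_series hE (K := K) (A := (B - 1) * B `^ p'^-1 * nrm g) (th := B `^ p'^-1 * (B `^ p^-1)^-1)) => //.
  - by rewrite !mulr_ge0 ?powR_ge0 ?(sqb_ge0 hE) //; lra.
  - by rewrite mulr_ge0 ?invr_ge0 ?powR_ge0.
  - move: Bd; rewrite powRD ?(gt_eqF B0) ?implybT // powRN => Bd.
    have -> : K * (B `^ p'^-1 / B `^ p^-1) = K / (B `^ p^-1 / B `^ p'^-1).
      by field; rewrite !gt_eqF.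
    by rewrite ler_pdivrMr ?divr_gt0 //; lra.
  - by move=> k; apply: (E_Z hE); exact: (hU _ _ (BkU k) Eg).1.
  - by move=> k t t0; rewrite mulr_ge0 // g0 // mulr_gt0 // invr_gt0.
  - move=> k; have [Ed nd] := hU _ _ (BkU k) Eg.
    rewrite (sqb_homo hE) // ger0_norm //.
    apply: (le_trans (ler_wpM2l (c0 k) nd)).
    rewrite powRX ?(ltW B0) // exprMn exprS le_eqVlt; apply/orP; left; apply/eqP.
    by rewrite exprVn; ring.
exists F => //; apply: aeS hF => t h t0.
apply: (head_integral_le g0 gm _ B1 t0) => [|n]; first by rewrite invr_ge0 ltW.
rewrite (eq_bigr (fun k : 'I_n => t `^ p^-1 * f k t)).
  by rewrite -mulr_sumr; apply: ler_wpM2l; [exact: powR_ge0|exact: h].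
by move=> k _; rewrite /f /dilation exprVn; ring.
Qed.

Lemma tail_dominated p q : 0 < p -> (p%:E < boyd_q E nrm)%E -> (boyd_q E nrm < q%:E)%E ->
  exists2 F, E F & {ae lambda, forall t, 0 < t -> (hardy_tail g q^-1 t <= (t `^ q^-1 * F t)%:E)%E}.
Proof.
move=> p0 hp hq; have [q' [U [q'0 qq' U0 hU]]] := boyd_q_dil hE p0 hp hq.
have [K K1 hK] := E_K hE.
have q0 : 0 < q by lra.
have d0 : 0 < q'^-1 - q^-1 by rewrite subr_gt0 ltf_pV2.
have [B [B1 BU Bd]] := powR_base (2 * K) U^-1 d0.
have B0 : 0 < B by lra.
have Bp0 : 0 < B `^ q^-1 by exact: powR_gt0.
have Bp'0 : 0 < B `^ q'^-1 by exact: powR_gt0.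
pose f k t := (B - 1) * (B `^ q^-1) ^+ k.+1 * dilation (B^-1 ^+ k)^-1 g t.
have Bk0 k : 0 < B^-1 ^+ k by rewrite exprn_gt0 // invr_gt0.
have Bi1 : B^-1 <= 1 by rewrite invf_le1 // ltW.
(* The term [k = 0] is no dilation at all and need not fall in the range [u < U] of the Boyd
   estimate, so it is treated apart. *)
have dil k : E (dilation (B^-1 ^+ k)^-1 g) /\ nrm (dilation (B^-1 ^+ k)^-1 g) <= (B^-1 ^+ k) `^ q'^-1 * nrm g.
  case: k => [|k].
    have -> : dilation (B^-1 ^+ 0)^-1 g = g by apply/funext => t; rewrite /dilation expr0 invr1 mul1r.
    by rewrite expr0 powR1 mul1r.
  apply: hU => //; apply: (@le_lt_trans _ _ B^-1).
    have Bi0 : 0 <= B^-1 by rewrite invr_ge0 ltW.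
    by rewrite exprS; apply: ler_piMr => //; exact: exprn_ile1.
  by rewrite -[ltRHS]invrK ltf_pV2 ?posrE ?invr_gt0.
have c0 k : 0 <= (B - 1) * (B `^ q^-1) ^+ k by rewrite mulr_ge0 ?exprn_ge0 ?powR_ge0 //; lra.
have bV : B^-1 `^ q'^-1 = (B `^ q'^-1)^-1 by rewrite -powR_inv1 ?(ltW B0) // -powRrM mulN1r powRN.
have [F EF hF] : exists2 F, E F & {ae lambda, forall t, 0 < t -> forall n, \sum_(k < n) f k t <= F t}.
  apply: (E_series hE (K := K) (A := (B - 1) * B `^ q^-1 * nrm g) (th := B `^ q^-1 * (B `^ q'^-1)^-1)) => //.
  - by rewrite !mulr_ge0 ?powR_ge0 ?(sqb_ge0 hE) //; lra.
  - by rewrite mulr_ge0 ?invr_ge0 ?powR_ge0.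
  - move: Bd; rewrite powRD ?(gt_eqF B0) ?implybT // powRN => Bd.
    have -> : K * (B `^ q^-1 / B `^ q'^-1) = K / (B `^ q'^-1 / B `^ q^-1).
      by field; rewrite !gt_eqF.
    by rewrite ler_pdivrMr ?divr_gt0 //; lra.
  - by move=> k; apply: (E_Z hE); exact: (dil k).1.
  - by move=> k t t0; rewrite mulr_ge0 // g0 // mulr_gt0 // invr_gt0.
  - move=> k; have [Ed nd] := dil k.
    rewrite (sqb_homo hE) // ger0_norm //.
    apply: (le_trans (ler_wpM2l (c0 k.+1) nd)).
    rewrite powRX ?invr_ge0 ?(ltW B0) // bV exprMn exprS le_eqVlt; apply/orP; left; apply/eqP.
    by ring.
exists F => //; apply: aeS hF => t h t0.
apply: (tail_integral_le g0 gm _ B1 t0) => [|n]; first by rewrite invr_ge0 ltW.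
rewrite (eq_bigr (fun k : 'I_n => t `^ q^-1 * f k t)).
  by rewrite -mulr_sumr; apply: ler_wpM2l; [exact: powR_ge0|exact: h].
by move=> k _; rewrite /f /dilation exprVn invrK; ring.
Qed.

Variable e : R.

Lemma head_ge0 t : (0 <= hardy_head g e t)%E.
Proof.
by apply: integral_ge0 => s; rewrite /= in_itv /= => /andP[s0 _]; exact: weight_ge0.
Qed.

Lemma tail_ge0 t : 0 <= t -> (0 <= hardy_tail g e t)%E.
Proof.
move=> t0; apply: integral_ge0 => s; rewrite /= in_itv /= andbT => ts.
by apply: weight_ge0 => //; exact: le_lt_trans ts.
Qed.

Lemma head_ndecr s t : s <= t -> (hardy_head g e s <= hardy_head g e t)%E.
Proof.
move=> st; apply: ge0_subset_integral => //.
- apply: (measurable_funS (@measurable_Rpos R) _ (@weight_meas R g e gm)) => r.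
  by rewrite /= in_itv /= => /andP[].
- by move=> r; rewrite /= in_itv /= => /andP[r0 _]; exact: weight_ge0.
- by move=> r; rewrite /= !in_itv /= => /andP[-> h]; exact: lt_le_trans st.
Qed.

Lemma tail_nincr s t : 0 <= s -> s <= t -> (hardy_tail g e t <= hardy_tail g e s)%E.
Proof.
move=> s0 st; apply: ge0_subset_integral => //.
- apply: (measurable_funS (@measurable_Rpos R) _ (@weight_meas R g e gm)) => r.
  by rewrite /= in_itv /= andbT => h; exact: le_lt_trans h.
- by move=> r; rewrite /= in_itv /= andbT => h; apply: weight_ge0 => //; exact: le_lt_trans h.
- by move=> r; rewrite /= !in_itv /= !andbT => h; exact: le_lt_trans h.
Qed.

(** The integral is nondecreasing in [t], so the almost everywhere bound at a single point beyond
    [t] suffices. *)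
Lemma head_fin F t : {ae lambda, forall t, 0 < t -> (hardy_head g e t <= (t `^ e * F t)%:E)%E} ->
  0 < t -> hardy_head g e t \is a fin_num.
Proof.
move=> h t0; have t1 : t < t + 1 by lra.
have [s [ts _ hs]] := ae_exists (ltW t0) t1 h.
rewrite ge0_fin_numE ?head_ge0 //; apply: le_lt_trans (head_ndecr (ltW ts)) _.
by apply: le_lt_trans hs _; exact: ltry.
Qed.

Lemma tail_fin F t : {ae lambda, forall t, 0 < t -> (hardy_tail g e t <= (t `^ e * F t)%:E)%E} ->
  0 < t -> hardy_tail g e t \is a fin_num.
Proof.
move=> h t0; have t20 : 0 <= t / 2 by lra.
have t2 : t / 2 < t by lra.
have [s [ts st hs]] := ae_exists t20 t2 h.
rewrite ge0_fin_numE ?tail_ge0 ?ltW //; apply: le_lt_trans (tail_nincr _ st) _; first lra.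
by apply: le_lt_trans hs _; exact: ltry.
Qed.

Lemma head_meas : (forall t, 0 < t -> hardy_head g e t \is a fin_num) ->
  measurable_fun (@Rpos R) (fun t => fine (hardy_head g e t)).
Proof.
move=> fi; have : measurable_fun (@Rpos R) (fun t => - fine (hardy_head g e t)).
  apply: nonincr_measurable => s t s0 st; rewrite lerN2.
  by apply: fine_le; [exact: fi|apply: fi; exact: lt_le_trans st|exact: head_ndecr].
by move=> /measurable_funN; congr measurable_fun; apply/funext => t; rewrite /= opprK.
Qed.

Lemma tail_meas : (forall t, 0 < t -> hardy_tail g e t \is a fin_num) ->
  measurable_fun (@Rpos R) (fun t => fine (hardy_tail g e t)).
Proof.
move=> fi; apply: nonincr_measurable => s t s0 st.
have t0 : 0 < t by exact: lt_le_trans st.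
by apply: fine_le; [exact: fi|exact: fi|apply: tail_nincr => //; exact: ltW].
Qed.

End calderon_operator.

Section calderon_membership.
Set Implicit Arguments.
Unset Strict Implicit.
Variable R : realType.
Implicit Types (t v u s a b : R).
Local Notation lambda := (@lebesgue_measure R).
Variables (E : set (R -> R)) (nrm : (R -> R) -> R).
Hypothesis hE : symmetric_quasi_Banach E nrm.
Variable g : R -> R.
Hypothesis Eg : E g.
Hypothesis g0 : forall s, 0 < s -> 0 <= g s.
Hypothesis gm : forall s t, 0 < s -> s <= t -> g t <= g s.

Let powR_neg_meas (e : R) : measurable_fun (@Rpos R) (fun t => t `^ e).
Proof. exact: measurable_funTS (measurable_powR e). Qed.

Let scale_le t e (x : \bar R) F : 0 < t -> (0 <= x)%E -> (x <= (t `^ e * F)%:E)%E ->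
  0 <= t `^ (- e) * fine x <= F.
Proof.
move=> t0; case: x => [x| |] // x0; rewrite !lee_fin /= in x0 * => h.
have p0 : 0 < t `^ e by exact: powR_gt0.
by rewrite mulr_ge0 ?powR_ge0 //= powRN mulrC ler_pdivrMr // mulrC.
Qed.

Lemma calderon_oo p : 0 < p -> (p%:E < boyd_p E nrm)%E ->
  (forall t, 0 < t -> hardy_head g p^-1 t \is a fin_num) /\ E (calderon p +oo%E g).
Proof.
move=> p0 hp; have [F EF hF] := head_dominated hE Eg g0 gm p0 hp.
have fi t : 0 < t -> hardy_head g p^-1 t \is a fin_num by exact: (head_fin g0 gm hF).
split=> //; apply: (E_ae hE EF _ _).1.
  apply: measurable_funD => //; apply: measurable_funM => //; exact: (head_meas g0 gm fi).
apply: aeS hF => t h t0; rewrite /calderon addr0.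
have /andP[h1 h2] := scale_le t0 (head_ge0 g0 p^-1 t) (h t0).
by rewrite ger0_norm //; apply: (le_trans h2); exact: ler_norm.
Qed.

(** Finiteness ensures that the real-valued integrals in [calderon] are the true Hardy integrals,
    not default values; membership follows by domination in [E]. *)
Lemma calderon_fin p q : 0 < p -> (p%:E < boyd_p E nrm)%E ->
  (boyd_p E nrm <= boyd_q E nrm)%E -> (boyd_q E nrm < q%:E)%E -> 0 < q ->
  [/\ forall t, 0 < t -> hardy_head g p^-1 t \is a fin_num,
      forall t, 0 < t -> hardy_tail g q^-1 t \is a fin_num & E (calderon p q%:E g)].
Proof.
move=> p0 hp hpq hq q0; have [F EF hF] := head_dominated hE Eg g0 gm p0 hp.
have [G EG hG] := tail_dominated hE Eg g0 gm p0 (lt_le_trans hp hpq) hq.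
have fi t : 0 < t -> hardy_head g p^-1 t \is a fin_num by exact: (head_fin g0 gm hF).
have fi' t : 0 < t -> hardy_tail g q^-1 t \is a fin_num by exact: (tail_fin g0 gm hG).
split=> //; apply: (E_ae hE (E_D hE EF EG) _ _).1.
  apply: measurable_funD => //; apply: measurable_funM => //.
    exact: (head_meas g0 gm fi).
  exact: (tail_meas g0 gm fi').
apply: aeS (aeI hF hG) => t [hF' hG'] t0.
have /andP[h1 h2] := scale_le t0 (head_ge0 g0 p^-1 t) (hF' t0).
have /andP[h3 h4] := scale_le t0 (tail_ge0 g0 q^-1 (ltW t0)) (hG' t0).
by rewrite /calderon ger0_norm ?addr_ge0 //; apply: le_trans (ler_norm _); exact: lerD.
Qed.

End calderon_membership.

(** * Interpolation *)

Section hardy_operators.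
Set Implicit Arguments.
Unset Strict Implicit.
Variable R : realType.
Implicit Types (t v u s a b : R).
Local Notation lambda := (@lebesgue_measure R).

Lemma hardy_split (h : R -> R) (e t : R) :
  (forall s, 0 < s -> 0 <= h s) -> (forall s t, 0 < s -> s <= t -> h t <= h s) -> 0 < t ->
  (\int[lambda]_(s in `]0%R, +oo[) (s `^ e * h s / s)%:E = hardy_head h e t + hardy_tail h e t)%E.
Proof.
move=> h0 hm t0; have hw := @weight_meas R h e hm.
have -> : `]0%R, +oo[%classic = `]0%R, t[%classic `|` `[t, +oo[%classic :> set R.
  apply/seteqP; split=> s /=; rewrite !in_itv /= !andbT.
    by move=> s0; case: (ltP s t) => st; [left; rewrite s0|right].
  by case=> [/andP[]|/(lt_le_trans t0)].
have U0 s : (`]0%R, t[%classic `|` `[t, +oo[%classic) s -> 0 < s.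
  by case; rewrite /= in_itv /= ?andbT; [case/andP|exact: lt_le_trans].
rewrite ge0_integral_setU //.
- rewrite /hardy_head /hardy_tail; congr (_ + _)%E; symmetry.
  apply: integral_itv_obnd_cbnd.
  apply: (measurable_funS (@measurable_Rpos R) _ hw) => s.
  by rewrite /= in_itv /= andbT; exact: lt_trans.
- by apply: (measurable_funS (@measurable_Rpos R) _ hw).
- by move=> s /U0; exact: weight_ge0.
- by apply/disj_setPS => s [] /=; rewrite !in_itv /= andbT => /andP[_ st]; rewrite leNgt st.
Qed.

Lemma weight_integral_le (h g : R -> R) (e r : R) (A : set R) : measurable A -> A `<=` @Rpos R ->
  (forall s, 0 < s -> 0 <= h s) -> (forall s t, 0 < s -> s <= t -> h t <= h s) ->
  (forall s, 0 < s -> 0 <= g s) -> (forall s t, 0 < s -> s <= t -> g t <= g s) ->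
  0 <= r -> (forall s, A s -> h s <= r * g s) ->
  (\int[lambda]_(s in A) (s `^ e * h s / s)%:E <= r%:E * \int[lambda]_(s in A) (s `^ e * g s / s)%:E)%E.
Proof.
move=> mA AR h0 hm g0 gm r0 hg.
have mg : measurable_fun A (fun s => (s `^ e * g s / s)%:E).
  exact: (measurable_funS (@measurable_Rpos R) AR (@weight_meas R g e gm)).
rewrite -ge0_integralZl_EFin //; last by move=> s /AR; exact: weight_ge0.
apply: ge0_le_integral => //.
- by move=> s /AR; exact: weight_ge0.
- exact: (measurable_funS (@measurable_Rpos R) AR (@weight_meas R h e hm)).
- exact: measurable_funeM.
- move=> s As; have s0 := AR s As; rewrite -EFinM lee_fin.
  rewrite mulrA mulrCA; apply: ler_wpM2r; first by rewrite invr_ge0 ltW.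
  by apply: ler_wpM2l; [exact: powR_ge0|exact: hg].
Qed.

End hardy_operators.

(** * Lorentz norms of the cuts *)

Section lorentz_cuts.
Set Implicit Arguments.
Unset Strict Implicit.
Variables (R : realType) (H : hilbertSpace R).
Variables (M : set (H -> H)) (tau : (H -> H) -> \bar R).
Hypothesis vM : von_Neumann_algebra M.
Hypothesis tr : normal_semifinite_faithful_trace M tau.
Implicit Types (x y : set (H * H)) (p r v t : R).

Lemma lorentz1_normE y p t : S_tau M tau y -> positive_op y -> 0 < t ->
  lorentz1_norm tau p%:E y = (hardy_head (op_mu tau y) p^-1 t + hardy_tail (op_mu tau y) p^-1 t)%E.
Proof.
move=> Sy py t0; rewrite -hardy_split //.
- apply: eq_integral => s; rewrite inE /= in_itv /= andbT => s0; congr EFin.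
  by rewrite powRD ?(gt_eqF s0) ?implybT // powR_inv1 ?ltW // mulrAC.
- by move=> s _; exact: op_mu_ge0.
- by move=> s s' s0 ss; exact: (op_mu_nincr vM tr).
Qed.

Variable x : set (H * H).
Hypothesis px : positive_op x.
Hypothesis Sx : S_tau M tau x.
Let g := op_mu tau x.
Let g0 s : 0 < s -> 0 <= g s. Proof. by move=> _; exact: op_mu_ge0. Qed.
Let gm s t : 0 < s -> s <= t -> g t <= g s.
Proof. by move=> s0 st; exact: (op_mu_nincr vM tr). Qed.

Let mu0 y s : 0 < s -> 0 <= op_mu tau y s. Proof. by move=> _; exact: op_mu_ge0. Qed.
Let mum y s t : S_tau M tau y -> positive_op y -> 0 < s -> s <= t -> op_mu tau y t <= op_mu tau y s.
Proof. by move=> Sy py s0 st; exact: (op_mu_nincr vM tr). Qed.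

Lemma upper_cut_lorentz p r v t : 0 < t -> 0 < r -> 0 <= v -> (op_distr tau x v <= t%:E)%E ->
  (lorentz1_norm tau p%:E (upper_cut x v r) <= r%:E * hardy_head g p^-1 t)%E.
Proof.
move=> t0 r0 v0 hv; have [Sy py] := upper_cut_S vM px Sx v r0.
rewrite (lorentz1_normE p Sy py t0).
have -> : hardy_tail (op_mu tau (upper_cut x v r)) p^-1 t = 0%E.
  apply: integral0_eq => s; rewrite /= in_itv /= andbT => ts.
  rewrite (upper_cut_mu0 vM tr px Sx v0 r0) ?mulr0 ?mul0r //.
  by apply: (le_trans hv); rewrite lee_fin ltW.
rewrite adde0; apply: weight_integral_le => //; [|by move=> s; exact: mu0|by move=> s s'; exact: mum|exact: ltW|].
  by move=> s; rewrite /= in_itv /= => /andP[].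
by move=> s; rewrite /= in_itv /= => /andP[s0 _]; exact: (upper_cut_mu vM tr).
Qed.

Lemma lower_cut_lorentz q r v t : 0 < q -> 0 < t -> 0 < r -> 0 <= v ->
  (lorentz1_norm tau q%:E (lower_cut x v r) <=
    r%:E * ((v * ((1 - (2 `^ q^-1)^-1)^-1 * t `^ q^-1))%:E + hardy_tail g q^-1 t))%E.
Proof.
move=> q0 t0 r0 v0; have [Sy py] := lower_cut_S vM px Sx v r0.
have qi : 0 < q^-1 by rewrite invr_gt0.
rewrite (lorentz1_normE q Sy py t0) ge0_muleDr; last 2 first.
- rewrite lee_fin mulr_ge0 // mulr_ge0 ?powR_ge0 // invr_ge0 subr_ge0.
  rewrite invf_le1 ?powR_gt0 // -[leLHS](powRr0 2); apply: ler_powR; last exact: ltW.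
  by rewrite ler1n.
- by apply: tail_ge0 => //; exact: ltW.
apply: leeD.
  rewrite -EFinM mulrA [leRHS]EFinM.
  have h1 : (hardy_head (op_mu tau (lower_cut x v r)) q^-1 t <= (r * v)%:E * hardy_head (fun=> 1%R) q^-1 t)%E.
    apply: weight_integral_le => //.
    + by move=> s; rewrite /= in_itv /= => /andP[].
    + by move=> s; exact: mu0.
    + by move=> s s'; exact: mum.
    + by rewrite mulr_ge0 // ltW.
    + move=> s; rewrite /= in_itv /= => /andP[s0 _]; rewrite mulr1.
      exact: (lower_cut_mu_le vM tr).
  apply: (le_trans h1); apply: lee_wpmul2l; first by rewrite lee_fin mulr_ge0 // ltW.
  exact: power_integral_le.
apply: weight_integral_le => //.
- by move=> s; rewrite /= in_itv /= andbT; exact: lt_trans.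
- by move=> s; exact: mu0.
- by move=> s s'; exact: mum.
- exact: ltW.
- move=> s; rewrite /= in_itv /= andbT => ts; apply: (lower_cut_mu vM tr) => //.
  exact: lt_trans ts.
Qed.

Lemma zero_cut_lorentz (q : \bar R) : (0 < q)%E -> lorentz1_pos M tau q (zero_cut x).
Proof.
have [Sz pz] := zero_cut_S vM px Sx.
move=> q0; split=> //; case: q q0 => [q| |] // q0; last exact: zero_cut_graph.
split=> //; rewrite (lorentz1_normE q Sz pz ltr01) -hardy_split //; [|by move=> s; exact: mu0|by move=> s s'; exact: mum].
rewrite integral0_eq ?ltry // => s; rewrite /= in_itv /= andbT => s0.
by rewrite (zero_cut_mu vM tr) // mulr0 mul0r.
Qed.

Lemma S_tau_closed y : S_tau M tau y -> closed y.
Proof. by case=> -[[]]. Qed.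

Lemma sum_cone_l y (p q : \bar R) : (0 < q)%E -> lorentz1_pos M tau p y -> sum_cone M tau p q y.
Proof.
move=> q0 hy; exists y, (zero_cut x); split=> //; first exact: zero_cut_lorentz.
by rewrite add_zero_cut //; exact: S_tau_closed hy.2.1.
Qed.

Lemma sum_cone_r y (p q : \bar R) : (0 < p)%E -> lorentz1_pos M tau q y -> sum_cone M tau p q y.
Proof.
move=> q0 hy; exists (zero_cut x), y; split=> //; first exact: zero_cut_lorentz.
by rewrite zero_add_cut //; exact: S_tau_closed hy.2.1.
Qed.

Lemma upper_cut_pos p r v t : 0 < t -> 0 < r -> 0 <= v -> (op_distr tau x v <= t%:E)%E ->
  hardy_head g p^-1 t \is a fin_num -> lorentz1_pos M tau p%:E (upper_cut x v r).
Proof.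
move=> t0 r0 v0 hv fi; have [Sy py] := upper_cut_S vM px Sx v r0; split=> //; split=> //.
apply: le_lt_trans (upper_cut_lorentz p t0 r0 v0 hv) _.
by rewrite -(fineK fi) -EFinM ltry.
Qed.

Lemma lower_cut_pos q r v t : 0 < q -> 0 < t -> 0 < r -> 0 <= v ->
  hardy_tail g q^-1 t \is a fin_num -> lorentz1_pos M tau q%:E (lower_cut x v r).
Proof.
move=> q0 t0 r0 v0 fi; have [Sy py] := lower_cut_S vM px Sx v r0; split=> //; split=> //.
apply: le_lt_trans (lower_cut_lorentz q0 t0 r0 v0) _.
by rewrite -(fineK fi) -EFinD -EFinM ltry.
Qed.

Lemma lower_cut_pos_oo r v : 0 < r -> 0 <= v -> lorentz1_pos M tau +oo%E (lower_cut x v r).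
Proof.
by move=> r0 v0; split; [exact: (lower_cut_bounded vM px Sx)|exact: lower_cut_S].
Qed.

End lorentz_cuts.

Section interpolation.
Set Implicit Arguments.
Unset Strict Implicit.
Variables (R : realType) (H K : hilbertSpace R).
Variables (M : set (H -> H)) (tau : (H -> H) -> \bar R).
Variables (N : set (K -> K)) (sigma : (K -> K) -> \bar R).
Hypothesis vM : von_Neumann_algebra M.
Hypothesis trM : normal_semifinite_faithful_trace M tau.
Hypothesis vN : von_Neumann_algebra N.
Hypothesis trN : normal_semifinite_faithful_trace N sigma.
Variables (T : set (H * H) -> set (K * K)) (p : R) (q : \bar R).
Hypothesis p0 : 0 < p.
Hypothesis q0 : (0 < q)%E.
Hypothesis T_pos : forall x, sum_cone M tau p%:E q x -> S_tau_pos N sigma (T x).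
Hypothesis T_convex : forall x y, sum_cone M tau p%:E q x -> sum_cone M tau p%:E q y ->
  op_le (T (midpoint x y)) (midpoint (T x) (T y)).
Variables Cp Cq : R.
Hypothesis Cp0 : 0 < Cp.
Hypothesis Cq0 : 0 < Cq.
Hypothesis weak_p : forall x, lorentz1_pos M tau p%:E x ->
  (weak_norm sigma p%:E (T x) <= Cp%:E * lorentz1_norm tau p%:E x)%E.
Hypothesis weak_q : forall x, lorentz1_pos M tau q x ->
  (weak_norm sigma q (T x) <= Cq%:E * lorentz1_norm tau q x)%E.

Lemma weak_norm_mu r (z : set (K * K)) (C t : R) : 0 < r -> 0 < t ->
  (weak_norm sigma r%:E z <= C%:E)%E ->
  op_mu sigma z (t / 2) <= 2 `^ r^-1 * t `^ (- r^-1) * C.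
Proof.
move=> r0 t0 hC; have t20 : 0 < t / 2 by lra.
have : (((t / 2) `^ r^-1 * op_mu sigma z (t / 2))%:E <= C%:E)%E.
  apply: le_trans hC; apply: ereal_sup_ubound; exists (t / 2) => //.
  by rewrite /= in_itv /= t20.
rewrite lee_fin powRM ?invr_ge0 ?ler0n ?(ltW t0) //.
have -> : (2^-1 : R) `^ r^-1 = (2 `^ r^-1)^-1 by rewrite -powR_inv1 ?ler0n // -powRrM mulN1r powRN.
have a0 : 0 < (2 : R) `^ r^-1 by exact: powR_gt0.
have b0 : 0 < t `^ r^-1 by exact: powR_gt0.
rewrite powRN => h.
have -> : 2 `^ r^-1 * (t `^ r^-1)^-1 * C = C / (t `^ r^-1 / 2 `^ r^-1) by field; rewrite !gt_eqF.
by rewrite ler_pdivlMr ?divr_gt0 // mulrC.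
Qed.

Variable x : set (H * H).
Hypothesis px : positive_op x.
Hypothesis Sx : S_tau M tau x.
Let g := op_mu tau x.
Let g0 s : 0 < s -> 0 <= g s. Proof. by move=> _; exact: op_mu_ge0. Qed.
Let gm s t : 0 < s -> s <= t -> g t <= g s.
Proof. by move=> s0 st; exact: (op_mu_nincr vM trM). Qed.
Hypothesis head_fin : forall t, 0 < t -> hardy_head g p^-1 t \is a fin_num.

(** The bound on the lower cut is left as a parameter [k], so that finite and infinite [q] share the
    argument. *)
Lemma cut_estimate t v k : 0 < t -> 0 < v -> (op_distr tau x v <= t%:E)%E ->
  S_tau_pos N sigma (T x) ->
  sum_cone M tau p%:E q (lower_cut x v 2) ->
  op_mu sigma (T (lower_cut x v 2)) (t / 2) <= 2 * k ->
  op_mu sigma (T x) t <= 2 `^ p^-1 * Cp * (t `^ (- p^-1) * fine (hardy_head g p^-1 t)) + k.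
Proof.
move=> t0 v0 hv STx c2 hk; have r2 : 0 < 2 :> R by [].
have t20 : 0 < t / 2 by lra.
have L1 := upper_cut_pos vM trM px Sx t0 r2 (ltW v0) hv (head_fin t0).
have c1 : sum_cone M tau p%:E q (upper_cut x v 2) by exact: (sum_cone_l vM trM px Sx q0 L1).
have le := T_convex c1 c2; rewrite (cut_midpoint px) in le.
have := op_mu_midpoint vN trN (T_pos c1) (T_pos c2) STx le t20 t20.
rewrite -splitr => h.
have h1 : op_mu sigma (T (upper_cut x v 2)) (t / 2) <= 2 `^ p^-1 * t `^ (- p^-1) * (Cp * (2 * fine (hardy_head g p^-1 t))).
  apply: weak_norm_mu => //; apply: (le_trans (weak_p L1)).
  rewrite EFinM; apply: lee_wpmul2l; first by rewrite lee_fin ltW.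
  have hL := upper_cut_lorentz vM trM px Sx p t0 r2 (ltW v0) hv; apply: (le_trans hL).
  by rewrite EFinM (fineK (head_fin t0)).
apply: (le_trans h).
move: h1 hk; set A := op_mu _ _ _; set B := op_mu _ _ _; set D := fine _.
move: A B D (2 `^ p^-1) (t `^ (- p^-1)) => A B D a b h1 hk.
have -> : a * Cp * (b * D) + k = 2^-1 * (a * b * (Cp * (2 * D)) + 2 * k) by field.
by apply: ler_wpM2l; rewrite ?invr_ge0 ?ler0n //; lra.
Qed.

Lemma mu_le_head t : 0 < t ->
  g t <= 2 `^ (p^-1 + 1) * (t `^ (- p^-1) * fine (hardy_head g p^-1 t)).
Proof.
move=> t0; have pi0 : 0 <= p^-1 by rewrite invr_ge0 ltW.
have := head_integral_ge g0 gm pi0 t0; rewrite -/(hardy_head g p^-1 t).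
rewrite -(fineK (head_fin t0)) lee_fin !powRN.
have a0 : 0 < (2 : R) `^ (p^-1 + 1) by exact: powR_gt0.
have b0 : 0 < t `^ p^-1 by exact: powR_gt0.
move: (fine _) (2 `^ (p^-1 + 1)) (t `^ p^-1) a0 b0 => D a b a0 b0 h.
have -> : a * (b^-1 * D) = D * a / b by field; rewrite gt_eqF.
by rewrite ler_pdivlMr // -ler_pdivrMr // mulrC [g t * b]mulrC.
Qed.

(** The level [g t] may be 0, where no cut estimate is available; admissible levels are taken
    arbitrarily close above it. *)
Lemma limit_estimate t A k1 k2 : 0 < t -> 0 <= k1 ->
  (forall v, 0 < v -> (op_distr tau x v <= t%:E)%E -> A <= k1 * v + k2) ->
  A <= k1 * g t + k2.
Proof.
move=> t0 k10 h; apply/ler_addgt0Pr => e e0.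
have d0 : 0 < k1 + 1 by lra.
have e1 : 0 < e / (k1 + 1) by rewrite divr_gt0.
have : op_mu tau x t < op_mu tau x t + e / (k1 + 1) by rewrite ltrDl.
move=> /(op_mu_lt vM trM Sx px t0)[v [v0 vg hv]].
apply: (le_trans (h v v0 hv)); rewrite -/g in vg.
have : k1 * v <= k1 * (g t + e / (k1 + 1)) by apply: ler_wpM2l => //; exact: ltW.
have : k1 * (e / (k1 + 1)) <= e by rewrite mulrA ler_pdivrMr // mulrC ler_pM2l //; lra.
rewrite mulrDr; lra.
Qed.

Lemma sum_cone_cuts : (forall v, 0 < v -> lorentz1_pos M tau q (lower_cut x v 1)) ->
  sum_cone M tau p%:E q x.
Proof.
move=> hl; have g1 : op_mu tau x 1 < op_mu tau x 1 + 1 by rewrite ltrDl.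
have [v [v0 _ hv]] := op_mu_lt vM trM Sx px ltr01 g1.
exists (upper_cut x v 1), (lower_cut x v 1); split; last by rewrite cut_add.
  exact: (upper_cut_pos vM trM px Sx ltr01 ltr01 (ltW v0) hv (head_fin ltr01)).
exact: hl.
Qed.

Lemma mu_T_le (k1 k2 : R) t : 0 < t -> 0 <= k1 ->
  (forall v r, 0 < v -> 0 < r -> lorentz1_pos M tau q (lower_cut x v r)) ->
  (forall v, 0 < v -> op_mu sigma (T (lower_cut x v 2)) (t / 2) <= 2 * (k1 * v + k2)) ->
  op_mu sigma (T x) t <=
    2 `^ p^-1 * Cp * (t `^ (- p^-1) * fine (hardy_head g p^-1 t)) + (k1 * g t + k2).
Proof.
move=> t0 k10 hl hk.
have STx : S_tau_pos N sigma (T x) by apply: T_pos; apply: sum_cone_cuts => v v0; exact: hl.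
rewrite addrCA; apply: limit_estimate => // v v0 hv.
rewrite addrCA; apply: (cut_estimate t0 v0 hv STx); last exact: (hk v v0).
by apply: (sum_cone_r vM trM px Sx); [rewrite lte_fin|exact: hl].
Qed.

Lemma mu_T_oo t : q = +oo%E -> 0 < t ->
  op_mu sigma (T x) t <= (2 `^ p^-1 + 2 `^ (p^-1 + 1)) * Num.max Cp Cq *
    (t `^ (- p^-1) * fine (hardy_head g p^-1 t)).
Proof.
move=> qE t0; have hl v r : 0 < v -> 0 < r -> lorentz1_pos M tau q (lower_cut x v r).
  by move=> v0 r0; rewrite qE; apply: (lower_cut_pos_oo vM px Sx r0 (ltW v0)).
have hk v : 0 < v -> op_mu sigma (T (lower_cut x v 2)) (t / 2) <= 2 * (Cq * v + 0).
  move=> v0; have L := hl v 2 v0 (ltr0n _ 2).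
  have SL : S_tau_pos N sigma (T (lower_cut x v 2)).
    by apply: T_pos; apply: (sum_cone_r vM trM px Sx) => //; rewrite lte_fin.
  have h := weak_q L; rewrite qE /weak_norm /lorentz1_norm in h.
  have -> : 2 * (Cq * v + 0) = Cq * (2 * v) by ring.
  apply: (op_mu_op_norm vN trN SL); [by rewrite !mulr_ge0 // ltW| |by rewrite divr_gt0].
  apply: (le_trans h); rewrite EFinM; apply: lee_wpmul2l; first by rewrite lee_fin ltW.
  exact: (lower_cut_norm px (ltW v0) (ltr0n _ 2)).
apply: (le_trans (mu_T_le t0 (ltW Cq0) hl hk)).
have m1 : Cp <= Num.max Cp Cq by rewrite le_max lexx.
have m2 : Cq <= Num.max Cp Cq by rewrite le_max lexx orbT.
have hg := mu_le_head t0; have gt0 := g0 t0.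
have al0 : 0 <= t `^ (- p^-1) * fine (hardy_head g p^-1 t).
  by rewrite mulr_ge0 ?powR_ge0 // fine_ge0 //; exact: head_ge0.
have a0 : 0 <= (2 : R) `^ p^-1 by exact: powR_ge0.
have b0 : 0 <= (2 : R) `^ (p^-1 + 1) by exact: powR_ge0.
move: (Num.max Cp Cq) (t `^ (- p^-1) * _) (2 `^ p^-1) (2 `^ (p^-1 + 1)) (g t) m1 m2 hg gt0 al0 a0 b0.
move=> m al a b gt m1 m2 hg gt0 al0 a0 b0; rewrite addr0 !mulrDl; apply: lerD.
  by apply: ler_wpM2r => //; apply: ler_wpM2l.
apply: (@le_trans _ _ (m * (b * al))); last by rewrite mulrA [m * b]mulrC.
by apply: ler_pM => //; exact: ltW.
Qed.

(** In the constant, [2 ^ (1/p)] comes from the upper cut. The lower cut contributes [2 ^ (1/q')]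
    times a sum: 1 for its tail, and the power integral over []0, t[] times the constant of
    [mu_le_head] for its plateau. *)
Lemma mu_T_fin q' t : q = q'%:E -> 0 < t -> (forall t, 0 < t -> hardy_tail g q'^-1 t \is a fin_num) ->
  op_mu sigma (T x) t <=
    (2 `^ p^-1 + 2 `^ q'^-1 * ((1 - (2 `^ q'^-1)^-1)^-1 * 2 `^ (p^-1 + 1) + 1)) * Num.max Cp Cq *
    (t `^ (- p^-1) * fine (hardy_head g p^-1 t) + t `^ (- q'^-1) * fine (hardy_tail g q'^-1 t)).
Proof.
move=> qE t0 tail_fin; have q'0 : 0 < q' by move: q0; rewrite qE lte_fin.
have r2 : 0 < 2 :> R by [].
have qi0 : 0 < q'^-1 by rewrite invr_gt0.
have hl v r : 0 < v -> 0 < r -> lorentz1_pos M tau q (lower_cut x v r).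
  move=> v0 r0; rewrite qE.
  exact: (lower_cut_pos vM trM px Sx q'0 ltr01 r0 (ltW v0) (tail_fin 1 ltr01)).
have [ka kaE] : exists ka : R, ka = (1 - (2 `^ q'^-1)^-1)^-1 by eexists.
have ka0 : 0 <= (1 - (2 `^ q'^-1)^-1)^-1 :> R.
  rewrite invr_ge0 subr_ge0 invf_le1 ?powR_gt0 // -[leLHS](powRr0 2); apply: ler_powR; last exact: ltW.
  by rewrite ler1n.
rewrite -kaE in ka0 *.
have be0 : 0 <= fine (hardy_tail g q'^-1 t) by rewrite fine_ge0 // tail_ge0 // ltW.
have hk v : 0 < v -> op_mu sigma (T (lower_cut x v 2)) (t / 2) <=
    2 * (Cq * 2 `^ q'^-1 * ka * v + Cq * 2 `^ q'^-1 * (t `^ (- q'^-1) * fine (hardy_tail g q'^-1 t))).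
  move=> v0; have L := hl v 2 v0 r2.
  have h := weak_q L; rewrite qE in h.
  have hL := lower_cut_lorentz vM trM px Sx q'0 t0 r2 (ltW v0); rewrite -kaE in hL.
  have h2 : (weak_norm sigma q'%:E (T (lower_cut x v 2)) <=
     (Cq * (2 * (v * (ka * t `^ q'^-1) + fine (hardy_tail g q'^-1 t))))%:E)%E.
    apply: (le_trans h); rewrite EFinM; apply: lee_wpmul2l; first by rewrite lee_fin ltW.
    apply: (le_trans hL); rewrite -/g.
    by have := tail_fin t t0; case: (hardy_tail g q'^-1 t) => [b| |] // _; rewrite -EFinD -EFinM /=.
  apply: (le_trans (weak_norm_mu q'0 t0 h2)); rewrite le_eqVlt; apply/orP; left; apply/eqP.
  have tq : t `^ (- q'^-1) * t `^ q'^-1 = 1 by rewrite powRN mulVf // gt_eqF // powR_gt0.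
  clear hL h2; move: (fine _) (2 `^ q'^-1) (t `^ (- q'^-1)) (t `^ q'^-1) tq => b a c d tq.
  have -> : a * c * (Cq * (2 * (v * (ka * d) + b))) = 2 * (Cq * a * ka * v * (c * d) + Cq * a * (c * b)) by ring.
  by rewrite tq mulr1.
have k10 : 0 <= Cq * 2 `^ q'^-1 * ka by rewrite !mulr_ge0 ?powR_ge0 // ltW.
apply: (le_trans (mu_T_le t0 k10 hl hk)).
have m1 : Cp <= Num.max Cp Cq by rewrite le_max lexx.
have m2 : Cq <= Num.max Cp Cq by rewrite le_max lexx orbT.
have hg := mu_le_head t0; have gt0 := g0 t0.
have al0 : 0 <= t `^ (- p^-1) * fine (hardy_head g p^-1 t).
  by rewrite mulr_ge0 ?powR_ge0 // fine_ge0 //; exact: head_ge0.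
have {}be0 : 0 <= t `^ (- q'^-1) * fine (hardy_tail g q'^-1 t) by rewrite mulr_ge0 ?powR_ge0.
have a0 : 0 <= (2 : R) `^ p^-1 by exact: powR_ge0.
have b0 : 0 <= (2 : R) `^ (p^-1 + 1) by exact: powR_ge0.
have d0 : 0 <= (2 : R) `^ q'^-1 by exact: powR_ge0.
have cp := ltW Cp0; have cq := ltW Cq0.
clear kaE hk k10; move: (Num.max Cp Cq) (t `^ (- p^-1) * _) (t `^ (- q'^-1) * _) ka (2 `^ p^-1) (2 `^ (p^-1 + 1)) (2 `^ q'^-1) (g t) m1 m2 hg gt0 al0 be0 ka0 a0 b0 d0.
clear -cp cq.
move=> m al be ka a b d gt m1 m2 hg gt0 al0 be0 ka0 a0 b0 d0.
have m0 : 0 <= m by exact: le_trans m1.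
have h1 : a * Cp * al <= a * m * al by apply: ler_wpM2r => //; exact: ler_wpM2l.
have h2 : Cq * d * ka * gt <= m * (d * ka * (b * al)).
  by rewrite -!mulrA; apply: ler_pM => //; rewrite ?mulr_ge0 //; do 2 (apply: ler_wpM2l => //).
have h3 : Cq * d * be <= m * d * be by apply: ler_wpM2r => //; exact: ler_wpM2r.
have e : (a + d * (ka * b + 1)) * m * (al + be) =
  a * m * al + (m * (d * ka * (b * al)) + m * d * be) + (a * m * be + d * ka * b * m * be + d * m * al) by ring.
rewrite e; apply: ler_wpDr; first by rewrite !addr_ge0 // !mulr_ge0.
by apply: lerD => //; exact: lerD.
Qed.

End interpolation.

(** * From the pointwise estimate to the norm estimate *)

Section norm_estimate.
Set Implicit Arguments.
Unset Strict Implicit.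
Variable R : realType.
Variables (E : set (R -> R)) (nrm : (R -> R) -> R).
Hypothesis hE : symmetric_quasi_Banach E nrm.

Lemma weight0_integral (g : R -> R) (e : R) (A : set R) : A `<=` @Rpos R ->
  (forall s, 0 < s -> g s = 0) ->
  (\int[@lebesgue_measure R]_(s in A) (s `^ e * g s / s))%R = 0.
Proof.
move=> AR g0; rewrite /Rintegral integral0_eq // => s As.
by rewrite g0 ?mulr0 ?mul0r //; exact: AR.
Qed.

Lemma calderon0 p q (g : R -> R) t : (forall s, 0 < s -> g s = 0) -> 0 < t -> calderon p q g t = 0.
Proof.
move=> g0 t0; rewrite /calderon weight0_integral // ?mulr0 ?add0r; last first.
  by move=> s; rewrite /= in_itv /= => /andP[].
case: q => // q; rewrite weight0_integral // ?mulr0 // => s.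
by rewrite /= in_itv /= andbT; exact: lt_trans.
Qed.

(** The case [nrm g = 0] is separate since an infinite operator norm times 0 is 0: a monotone [g]
    vanishing almost everywhere vanishes everywhere, and so do [calderon p q g] and [f] on the
    half-line. *)
Lemma nrm_opnorm (p : R) (q : \bar R) (k : R) (f g : R -> R) : 0 < k -> E g ->
  (forall s, 0 < s -> 0 <= g s) -> (forall s t, 0 < s -> s <= t -> g t <= g s) ->
  E (calderon p q g) -> measurable_fun (@Rpos R) f -> (forall t, 0 < t -> 0 <= f t) ->
  (forall t, 0 < t -> f t <= k * calderon p q g t) ->
  E f /\ ((nrm f)%:E <= k%:E * opnorm E nrm (calderon p q) * (nrm g)%:E)%E.
Proof.
move=> k0 Eg g0 gm Ecg mf f0 fc.
have fle t : 0 < t -> `|f t| <= `|k * calderon p q g t|.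
  by move=> t0; rewrite ger0_norm ?f0 //; apply: (le_trans (fc t t0)); exact: ler_norm.
have [Ef nf] := E_dom hE (E_Z hE k Ecg) mf fle; split=> //.
rewrite (sqb_homo hE) // gtr0_norm // in nf.
have n0 := sqb_ge0 hE Eg.
have o0 : (0 <= opnorm E nrm (calderon p q))%E.
  by apply: le_ereal_inf_tmp => x [C [C0 _] <-]; rewrite lee_fin.
have [nz|np] := leP (nrm g) 0.
  have nE : nrm g = 0 by apply/eqP; rewrite eq_le nz.
  have gz s : 0 < s -> g s = 0.
    move=> s0; apply/eqP; rewrite eq_le g0 // andbT.
    have s2 : 0 <= s / 2 by lra.
    have s3 : s / 2 < s by lra.
    have [r [sr rs gr]] := ae_exists s2 s3 ((sqb_eq0 hE Eg).1 nE).
    by rewrite -gr; apply: gm => //; lra.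
  have [_] : E f /\ nrm f <= nrm (fun=> 0).
    apply: (E_dom hE (E_0 hE).1 mf) => t t0.
    by apply: (le_trans (fle t t0)); rewrite calderon0 // mulr0.
  by rewrite (E_0 hE).2 nE mule0 lee_fin.
have kn : 0 < k * nrm g by rewrite mulr_gt0.
have h : ((nrm f / (k * nrm g))%:E <= opnorm E nrm (calderon p q))%E.
  apply: le_ereal_inf_tmp => x [C [C0 hC] <-]; rewrite lee_fin ler_pdivrMr //.
  apply: (le_trans nf); rewrite mulrCA; apply: ler_wpM2l; first exact: ltW.
  exact: (hC g Eg).2.
move: h o0; case: (opnorm _ _ _) => [r| |] //; last first.
  by move=> _ _; rewrite gt0_muley ?lte_fin // gt0_mulye ?lte_fin // leey.
rewrite !lee_fin ler_pdivrMr // => h _; apply: (le_trans h).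
by rewrite le_eqVlt; apply/orP; left; apply/eqP; ring.
Qed.

End norm_estimate.

Theorem theoremA3 (R : realType) (p : R) (q : \bar R)
    (hp : 0 < p) (hpq : (p%:E < q)%E) :
  exists2 c : R, 0 < c &
  forall (E : set (R -> R)) (nrm : (R -> R) -> R) (s : R),
    symmetric_quasi_Banach E nrm -> 0 < s -> s_convex E nrm s ->
  forall (H K : hilbertSpace R)
    (M : set (H -> H)) (tau : (H -> H) -> \bar R)
    (N : set (K -> K)) (sigma : (K -> K) -> \bar R),
    von_Neumann_algebra M -> normal_semifinite_faithful_trace M tau ->
    von_Neumann_algebra N -> normal_semifinite_faithful_trace N sigma ->
  forall T : set (H * H) -> set (K * K),
    (forall x, sum_cone M tau p%:E q x -> S_tau_pos N sigma (T x)) ->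
    (forall x y, sum_cone M tau p%:E q x -> sum_cone M tau p%:E q y ->
       op_le (T (midpoint x y)) (midpoint (T x) (T y))) ->
  forall Cp Cq : R, 0 < Cp -> 0 < Cq ->
    (forall x, lorentz1_pos M tau p%:E x ->
       (weak_norm sigma p%:E (T x) <= Cp%:E * lorentz1_norm tau p%:E x)%E) ->
    (forall x, lorentz1_pos M tau q x ->
       (weak_norm sigma q (T x) <= Cq%:E * lorentz1_norm tau q x)%E) ->
    [/\ (p%:E < boyd_p E nrm)%E, (boyd_p E nrm <= boyd_q E nrm)%E,
        (boyd_q E nrm < q)%E & (q < +oo)%E] \/
    ((p%:E < boyd_p E nrm)%E /\ q = +oo%E) ->
  forall x, ncspace M tau E x -> positive_op x ->
    ncspace N sigma E (T x) /\
    ((ncnorm sigma nrm (T x))%:E <=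
       c%:E * (Num.max Cp Cq)%:E * opnorm E nrm (calderon p q) *
       (ncnorm tau nrm x)%:E)%E.
Proof.
have q0 : (0 < q)%E by apply: lt_trans hpq; rewrite lte_fin.
pose a := (2 : R) `^ p^-1; pose b := (2 : R) `^ (p^-1 + 1).
have a0 : 0 < a by exact: powR_gt0.
have b0 : 0 < b by exact: powR_gt0.
pose c := if q is q'%:E then a + 2 `^ q'^-1 * ((1 - (2 `^ q'^-1)^-1)^-1 * b + 1) else a + b.
have c0 : 0 < c.
  rewrite /c; clear c hpq; case: q q0 => [q'| |] q0; rewrite ?addr_gt0 //.
  rewrite lte_fin in q0; rewrite mulr_gt0 ?powR_gt0 // ltr_wpDl // mulr_ge0 ?ltW //.
  rewrite invr_gt0 subr_gt0 invf_lt1 ?powR_gt0 //.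
  have qi : 0 < q'^-1 by rewrite invr_gt0.
  by have := @gt0_ltr_powR R _ qi 1 2; rewrite powR1; apply; rewrite ?nnegrE ?ler01 ?ler0n ?ltr1n.
exists c => // E nrm _ hE _ _ H K M tau N sigma vM trM vN trN T T_pos T_convex Cp Cq Cp0 Cq0 wp wq idx x [Sx Eg] px.
have m0 : 0 < Num.max Cp Cq by rewrite lt_max Cp0.
have g0 s : 0 < s -> 0 <= op_mu tau x s by move=> _; exact: op_mu_ge0.
have gm s t : 0 < s -> s <= t -> op_mu tau x t <= op_mu tau x s by move=> s0 st; exact: (op_mu_nincr vM trM).
have main : [/\ S_tau_pos N sigma (T x), E (calderon p q (op_mu tau x)) &
    forall t, 0 < t -> op_mu sigma (T x) t <= c * Num.max Cp Cq * calderon p q (op_mu tau x) t].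
  case: idx => [[hp1 hp2 hp3 qoo]|[hp1 qE]].
    have [q' qE] : exists q', q = q'%:E.
      by clear -qoo q0; case: q qoo q0 => [q'| |] // _ _; exists q'.
    rewrite qE in hp3; have q'0 : 0 < q' by move: q0; rewrite qE lte_fin.
    have [hf tf Ec] := calderon_fin hE Eg g0 gm hp hp1 hp2 hp3 q'0.
    split; [|by rewrite qE|].
      apply: T_pos; apply: (sum_cone_cuts vM trM px Sx hf) => v v0; rewrite qE.
      exact: (lower_cut_pos vM trM px Sx q'0 ltr01 ltr01 (ltW v0) (tf 1 ltr01)).
    move=> t t0; rewrite /c qE /calderon.
    exact: (mu_T_fin vM trM vN trN hp q0 T_pos T_convex Cp0 Cq0 wp wq px Sx hf qE t0 tf).
  have [hf Ec] := calderon_oo hE Eg g0 gm hp hp1; split; [|by rewrite qE|].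
    apply: T_pos; apply: (sum_cone_cuts vM trM px Sx hf) => v v0; rewrite qE.
    exact: (lower_cut_pos_oo vM px Sx ltr01 (ltW v0)).
  move=> t t0; rewrite /c qE /calderon addr0.
  exact: (mu_T_oo vM trM vN trN hp q0 T_pos T_convex Cp0 Cq0 wp wq px Sx hf qE t0).
have [[ST pT] Ec hle] := main.
have mf : measurable_fun (@Rpos R) (op_mu sigma (T x)).
  by apply: nonincr_measurable => s t s0 st; exact: (op_mu_nincr vN trN).
have f0 t : 0 < t -> 0 <= op_mu sigma (T x) t by move=> _; exact: op_mu_ge0.
have [Ef nf] := nrm_opnorm hE (mulr_gt0 c0 m0) Eg g0 gm Ec mf f0 hle.
by split; [split|rewrite -EFinM].
Qed.
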